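(* Let $d\ge4$, $G=\mathrm{GSO}_{2d}(\mathbb{Q}_p)$, and let $\phi$, $C^{(\bullet)}$, $\tau$ be as in the context, i.e. $\phi=(p^n\cdot\mathrm{id})\dot s_{d-1}\dot s_{d-2}\cdots\dot s_2\dot s_1\dot s_d\dot s_{d-2}\dot s_{d-3}\cdots\dot s_3\dot s_2\dot s_0=(p^n\cdot\mathrm{id})\dot s_{\beta(1)}\cdots\dot s_{\beta(2d-2)}$ with $n=1$ if $d$ is even and $n=2$ if $d$ is odd, $C^{(a(2d-2)+b)}=\phi^as_{\beta(1)}\cdots s_{\beta(b)}C$ for $a\ge0$, $0\le b<2d-2$, and $\tau(x)=\mathrm{diag}(xE_{d-1},E_d,x)$. (a) We have $\phi^d\in T$ and $\phi^dN_0\phi^{-d}\subset N_0$. The sequence $C=C^{(0)},C^{(1)},C^{(2)},\dots$ satisfies, with $N_0^{(i)}=I_{C^{(i)}}\cap N$: $N_0=N_0^{(0)}\supset N_0^{(1)}\supset N_0^{(2)}\supset\cdots$ with $[N_0^{(i)}:N_0^{(i+1)}]=p$ for all $i\ge0$. In particular one may define $\alpha^{(j)}\in\Phi^+$ for all $j\ge0$ (see context). (b) For any $j\ge0$ we have $\alpha^{(j)}\circ\tau=\mathrm{id}_{\mathbb{Z}_p^\times}$. (c) We have $\tau(a)\phi=\phi\tau(a)$ for all $a\in\mathbb{Z}_p^\times$.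
   Context: $p$ is a prime; $E_m$ is the identity matrix; $S_m=\begin{pmatrix}0&E_m\\ E_m&0\end{pmatrix}$. $\mathrm{GO}_{2d}(\mathbb{Q}_p)=\{A\in\mathrm{GL}_{2d}(\mathbb{Q}_p): {}^tAS_dA=\kappa(A)S_d,\ \kappa(A)\in\mathbb{Q}_p^\times\}$, $\mathrm{SO}_{2d}(\mathbb{Q}_p)=\{A\in\mathrm{SL}_{2d}(\mathbb{Q}_p): {}^tAS_dA=S_d\}$, and $G=\mathrm{GSO}_{2d}(\mathbb{Q}_p)$ is the subgroup of $\mathrm{GO}_{2d}(\mathbb{Q}_p)$ generated by $\mathrm{SO}_{2d}(\mathbb{Q}_p)$ and all $\mathrm{diag}(xE_d,E_d)$, $x\in\mathbb{Q}_p^\times$. $Z$ is its center, $T$ its diagonal torus, $T_0$ the maximal bounded subgroup of $T$. For $1\le i\ne j\le d$, $\epsilon_1,\epsilon_2\in\{\pm1\}$ the character $\epsilon_1e_i+\epsilon_2e_j$ of $T$ is $A=\mathrm{diag}(x_1,\dots,x_{2d})\mapsto x_i^{\epsilon_1}x_j^{\epsilon_2}\kappa(A)^{(-\epsilon_1-\epsilon_2)/2}$. $\Phi=\{\pm e_i\pm e_j: i\neq j\}$, $\Phi^+=\{e_i\pm e_j: i<j\}$. $N_\alpha$ are the root subgroups, $N_\alpha^0=N_\alpha\cap\mathrm{SL}_{2d}(\mathbb{Z}_p)$, $N=\prod_{\alpha\in\Phi^+}N_\alpha$, $N_0$ is generated by the $N_\alpha^0$, $\alpha\in\Phi^+$.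 $I_0$ is the pro-$p$-Iwahori subgroup generated by $N_\alpha^0$ ($\alpha\in\Phi^+$), $(N_\alpha^0)^p$ ($\alpha\in-\Phi^+$) and the maximal pro-$p$ subgroup of $T_0$; $I$ is the Iwahori subgroup containing $I_0$; $C$ is the chamber fixed by $I$ in the apartment $A$ of $T$ in the semisimple Bruhat–Tits building; $I_D$ is the Iwahori subgroup fixing a chamber $D$. $\dot s_i=\mathrm{diag}(E_{i-1},S_1,E_{d-i-1},E_{i-1},S_1,E_{d-i-1})$ for $1\le i\le d-1$; $\dot u$ sends the first standard basis vector to $p$ times the $(d+1)$-st, the $(d+1)$-st to $p^{-1}$ times the first, exchanges the $d$-th and $2d$-th, and fixes the others; $\dot s_0=\dot u\dot s_1\dot u$, $\dot s_d=\dot u\dot s_{d-1}\dot u$. $s_i$ is the image of $\dot s_i$ in $N(T)/ZT_0$. $\beta(i)=d-i$ for $1\le i\le d-1$, $\beta(d)=d$, $\beta(i)=2d-1-i$ for $d+1\le i\le2d-3$, $\beta(2d-2)=0$. $\tau:\mathbb{Z}_p^\times\to T_0$. Definition of $\alpha^{(j)}$: for adjacent distinct chambers $D_1,D_2$ of $A$ there is a unique $\delta\in\Phi$ with $I_{D_1}\cap N_{\delta'}=I_{D_2}\cap N_{\delta'}$ for $\delta'\ne\pm\delta$, and with $I_{D_1}\cap N_{-\delta}\subset I_{D_2}\cap N_{-\delta}$ and $I_{D_2}\cap N_\delta\subset I_{D_1}\cap N_\delta$ both of index $p$. For $D_1=C^{(j)}$, $D_2=C^{(j+1)}$ one puts $\alpha^{(j)}=\delta$;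 the index-$p$ chain condition means precisely that all $\alpha^{(j)}$ lie in $\Phi^+$. *)

(* Defs.v *)
From HB Require Import structures.
From mathcomp Require Import all_boot all_order all_algebra.
From mathcomp Require Import fraction.
From mathcomp Require Import boolp classical_sets functions cardinality.
From mathcomp Require Import reals topology normedtype.
Set Implicit Arguments.
Unset Strict Implicit.
Unset Printing Implicit Defensive.
Import Order.TTheory GRing.Theory Num.Theory.
Import numFieldNormedType.Exports.
Local Open Scope ring_scope.

(* Z_p is the inverse limit of the Z/p^n: an element is the sequence of its
   least nonnegative residues modulo p^n.  Coherence at n also forces
   0 <= f n < p^n. *)
Definition coherent (p : nat) (f : nat -> int) :=
  `[< forall n, (f n.+1 %% (p ^ n)%N)%Z = f n >].

Record padic_int (p : nat) (p_pr : prime p) :=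
  PadicInt { res : nat -> int; _ : coherent p res }.

Section PadicIntegers.
Context (p : nat) (p_pr : prime p).
Local Notation padic_int := (padic_int p_pr).

HB.instance Definition _ := [isSub of padic_int for @res p p_pr].
HB.instance Definition _ := [Choice of padic_int by <:].

Implicit Types x y z : padic_int.

Lemma padic_eqP x y : (forall n, res x n = res y n) -> x = y.
Proof. by move=> xy; apply: val_inj; apply/funext. Qed.

Lemma res_succ x n : (res x n.+1 %% (p ^ n)%N)%Z = res x n.
Proof. by case: x => f fc /=; move/asboolP: fc. Qed.

Lemma res_mod x n : (res x n %% (p ^ n)%N)%Z = res x n.
Proof. by rewrite -res_succ modz_mod. Qed.

Lemma modz_modX (m n : nat) (a : int) : (m <= n)%N ->
  ((a %% (p ^ n)%N)%Z %% (p ^ m)%N)%Z = (a %% (p ^ m)%N)%Z.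
Proof.
move=> mn; rewrite {2}(divz_eq a (p ^ n)%N) -[RHS]modzDml.
by rewrite -(subnKC mn) expnD PoszM mulrCA mulrA -mulrA modzMr add0r.
Qed.

Lemma mod_coherent (f : nat -> int) :
    (forall n, (f n.+1 = f n %[mod (p ^ n)%N])%Z) ->
  coherent p (fun n => (f n %% (p ^ n)%N)%Z).
Proof. by move=> fc; apply/asboolP => n; rewrite modz_modX. Qed.

Lemma add_coherent x y n :
  (res x n.+1 + res y n.+1 = res x n + res y n %[mod (p ^ n)%N])%Z.
Proof. by rewrite -modzDm !res_succ. Qed.
Lemma opp_coherent x n :
  (- res x n.+1 = - res x n %[mod (p ^ n)%N])%Z.
Proof. by rewrite -modzNm res_succ. Qed.
Lemma mul_coherent x y n :
  (res x n.+1 * res y n.+1 = res x n * res y n %[mod (p ^ n)%N])%Z.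
Proof. by rewrite -modzMm !res_succ. Qed.

Definition padic_zero : padic_int := @PadicInt p p_pr _ (@mod_coherent (fun=> 0) (fun=> erefl)).
Definition padic_one : padic_int := @PadicInt p p_pr _ (@mod_coherent (fun=> 1) (fun=> erefl)).
Definition padic_add x y : padic_int := @PadicInt p p_pr _ (mod_coherent (add_coherent x y)).
Definition padic_opp x : padic_int := @PadicInt p p_pr _ (mod_coherent (opp_coherent x)).
Definition padic_mul x y : padic_int := @PadicInt p p_pr _ (mod_coherent (mul_coherent x y)).

Fact padic_addA : associative padic_add.
Proof. by move=> x y z; apply: padic_eqP => n /=; rewrite modzDml modzDmr addrA. Qed.
Fact padic_addC : commutative padic_add.
Proof. by move=> x y; apply: padic_eqP => n /=; rewrite addrC. Qed.
Fact padic_add0 : left_id padic_zero padic_add.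
Proof. by move=> x; apply: padic_eqP => n /=; rewrite modzDml add0r res_mod. Qed.
Fact padic_addN : left_inverse padic_zero padic_opp padic_add.
Proof. by move=> x; apply: padic_eqP => n /=; rewrite modzDml addNr. Qed.

HB.instance Definition _ := GRing.isZmodule.Build padic_int
  padic_addA padic_addC padic_add0 padic_addN.

Fact padic_mulA : associative padic_mul.
Proof. by move=> x y z; apply: padic_eqP => n /=; rewrite modzMml modzMmr mulrA. Qed.
Fact padic_mulC : commutative padic_mul.
Proof. by move=> x y; apply: padic_eqP => n /=; rewrite mulrC. Qed.
Fact padic_mul1 : left_id padic_one padic_mul.
Proof. by move=> x; apply: padic_eqP => n /=; rewrite modzMml mul1r res_mod. Qed.
Fact padic_mulDl : left_distributive padic_mul padic_add.
Proof.
by move=> x y z; apply: padic_eqP => n /=; rewrite modzMml modzDm mulrDl.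
Qed.
Fact padic_neq0 : padic_one != 0.
Proof.
apply/eqP => /(congr1 (fun x : padic_int => res x 1)) /=.
rewrite expn1 modz_small ?modz_small //= ?ltz_nat ?prime_gt0 ?prime_gt1 //.
Qed.

HB.instance Definition _ := GRing.Zmodule_isComNzRing.Build padic_int
  padic_mulA padic_mulC padic_mul1 padic_mulDl padic_neq0.

(* Units and inverses in Z_p are chosen classically. *)
Definition padic_unit : {pred padic_int} := [pred x | `[< exists y, y * x = 1 >]].
Definition padic_inv x : padic_int :=
  if padic_unit x then xget 0 [set y | y * x = 1]%classic else x.

Fact padic_mulV : {in padic_unit, left_inverse 1 padic_inv *%R}.
Proof.
move=> x xu; rewrite /padic_inv; have -> : padic_unit x = true by exact: xu.
by case/asboolP: xu => y xy; rewrite (@xgetPex _ 0 [set y | y * x = 1]%classic) //; exists y.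
Qed.
Fact padic_unitP x y : y * x = 1 -> padic_unit x.
Proof. by move=> xy; apply/asboolP; exists y. Qed.
Fact padic_invN : {in [predC padic_unit], padic_inv =1 id}.
Proof. by move=> x; rewrite inE /padic_inv /= => /negbTE; rewrite /in_mem /= => ->. Qed.

HB.instance Definition _ := GRing.ComNzRing_hasMulInverse.Build padic_int
  padic_mulV padic_unitP padic_invN.

Lemma res_le x m n : (m <= n)%N -> (res x n %% (p ^ m)%N)%Z = res x m.
Proof.
move=> /subnK <-; elim: (n - m)%N => [|k IH]; first exact: res_mod.
by rewrite addSn -(modz_modX _ (leq_addl k m)) res_succ IH.
Qed.

Lemma padic_neq0P x : x != 0 -> exists n, forall m, (n <= m)%N ->
  res x m <> 0 /\ (logn p `|res x m| < n)%N.
Proof.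
move=> x0; have [n xn] : exists n, res x n <> 0.
  apply: contrapT => xn; move/eqP: x0; apply; apply: padic_eqP => n /=.
  by rewrite mod0z; apply: contrapT => h; apply: xn; exists n.
exists n => m nm; have xm : ~~ (p ^ n %| `|res x m|)%N.
  apply/negP => h; apply: xn; rewrite -(res_le x nm).
  by apply/dvdz_mod0P; rewrite dvdzE.
have xm0 : res x m <> 0 by move=> h; rewrite h dvdn0 in xm.
split=> //; rewrite ltnNge; apply: contra xm => h.
by rewrite pfactor_dvdn // absz_gt0; apply/eqP.
Qed.

Fact padic_idomain x y : x * y = 0 -> (x == 0) || (y == 0).
Proof.
move=> xy; apply/norP => -[/padic_neq0P[m xm] /padic_neq0P[n yn]].
have [x0 lx] := xm _ (leq_addr n m); have [y0 ly] := yn _ (leq_addl m n).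
have := congr1 (fun x : padic_int => res x (m + n)) xy.
rewrite /= mod0z => /dvdz_mod0P; rewrite dvdzE /= abszM.
have gt0 (a : int) : a <> 0 -> (0 < `|a|)%N by move=> /eqP; rewrite absz_gt0.
rewrite pfactor_dvdn ?muln_gt0 ?gt0 // lognM ?gt0 //.
by apply/negP; rewrite -ltnNge -addSn leq_add // ltnW.
Qed.

HB.instance Definition _ := GRing.ComUnitRing_isIntegral.Build padic_int
  padic_idomain.

End PadicIntegers.

Notation padic p_pr := {fraction padic_int p_pr}.

Local Notation "x %:F" := (FracField.tofrac x) : ring_scope.
Local Open Scope classical_set_scope.

Section Padic.
Context (p : nat) (p_pr : prime p).
Local Notation Qp := (padic p_pr).

Definition integral (x : Qp) := exists z : padic_int p_pr, x = z%:F.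

(* The value at 0 is junk. *)
Definition padic_val (x : Qp) : int :=
  xget 0 [set k | exists2 u : padic_int p_pr,
    u \is a GRing.unit & x = p%:R ^ k * u%:F].

Definition val_ge (R : realType) (r : R) (x : Qp) :=
  x = 0 \/ r <= (padic_val x)%:~R.

End Padic.

Section MatrixGroups.
Context (p : nat) (p_pr : prime p) (n : nat).
Local Notation Qp := (padic p_pr).
Local Notation M := 'M[Qp]_n.

Definition is_subgroup (H : set M) :=
  [/\ H `<=` [set g : M | g \in unitmx], H 1,
      forall g h, H g -> H h -> H (g * h) &
      forall g, H g -> H (invmx g)].

Definition generated (S : set M) : set M := smallest is_subgroup S.

Definition has_index (H K : set M) (m : nat) :=
  [/\ is_subgroup H, is_subgroup K, K `<=` H &
      ([set [set h * k | k in K] | h in H] #= `I_m)%card].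

Definition SL_Zp : set M :=
  [set g : M | (forall a b, integral (g a b)) /\ \det g = 1].

Definition GL_Zp : set M :=
  [set g : M | [/\ g \in unitmx, forall a b, integral (g a b) &
    forall a b, integral (invmx g a b)]].

Definition bounded_subgroup (H : set M) :=
  is_subgroup H /\ exists2 c : Qp, c != 0 &
    forall g, H g -> forall a b, integral (c * g a b).

Definition congruence_subgroup (m : nat) : set M :=
  [set g : M | GL_Zp g /\
    forall a b, exists2 z : Qp, integral z & (g - 1) a b = p%:R ^+ m * z].

(* A pro-p subgroup of the profinite group GL_n(Z_p): a closed subgroup in
   which the open normal subgroups cut out by the congruence subgroups (a
   basis of neighbourhoods of 1) all have p-power index. *)
Definition pro_p_subgroup (H : set M) :=
  [/\ is_subgroup H, H `<=` GL_Zp,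
      forall g, (forall m, exists2 h, H h & congruence_subgroup m (invmx h * g))
        -> H g &
      forall m, exists e, has_index H (H `&` congruence_subgroup m) (p ^ e)].

End MatrixGroups.

Arguments SL_Zp {p} p_pr n _.
Arguments GL_Zp {p} p_pr n _.

Section GSO.
Context (p : nat) (p_pr : prime p) (d : nat).
Local Notation Qp := (padic p_pr).
Local Notation M := 'M[Qp]_(d + d).

Definition Smx : M := block_mx 0 1%:M 1%:M 0.

Definition GO : set M :=
  [set A : M | A \in unitmx /\ exists2 k : Qp, k != 0 & A^T * Smx * A = k *: Smx].

Definition kappa (A : M) : Qp := xget 0 [set k : Qp | A^T * Smx * A = k *: Smx].

Definition SO : set M := [set A : M | \det A = 1 /\ A^T * Smx * A = Smx].

Definition GSO : set M :=
  generated (SO `|`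
    [set block_mx x%:M 0 0 1%:M | x in [set x : Qp | x != 0]]).

Definition torus : set M := [set A : M | GSO A /\ is_diag_mx A].

(* T_0, the largest bounded subgroup of T, as the union of all of them;
   likewise below for its largest pro-p subgroup. *)
Definition torus0 : set M :=
  \bigcup_(H in [set H | bounded_subgroup H /\ H `<=` torus]) H.

Definition torus0_pro_p : set M :=
  \bigcup_(H in [set H | pro_p_subgroup H /\ H `<=` torus0]) H.

(* A root is stored as its coordinates in the basis e_1, ..., e_d. *)
Definition e_ (i : 'I_d) : 'rV[int]_d := delta_mx 0 i.

Definition Phi : set 'rV[int]_d :=
  [set a | exists i j (b c : bool), i != j /\
    a = (-1) ^+ b *: e_ i + (-1) ^+ c *: e_ j].

Definition Phi_pos : set 'rV[int]_d :=
  [set a | exists (i j : 'I_d) (c : bool), (i < j)%N /\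
    a = e_ i + (-1) ^+ c *: e_ j].

(* For a root the coordinates add up to an even number, so that the division
   by 2 is exact. *)
Definition root_char (a : 'rV[int]_d) (A : M) : Qp :=
  (\prod_i A (lshift d i) (lshift d i) ^ a 0 i) *
  kappa A ^ ((- \sum_i a 0 i) %/ 2)%Z.

(* The Lie algebra of N_a consists of matrices of square 0, on which the
   exponential is X |-> 1 + X. *)
Definition root_subgroup (a : 'rV[int]_d) : set M :=
  [set g : M | GSO g /\
    forall t, torus t -> t * (g - 1) * invmx t = root_char a t *: (g - 1)].

Definition root_subgroup0 (a : 'rV[int]_d) : set M :=
  root_subgroup a `&` SL_Zp p_pr (d + d).

(* The product does not depend on the order of the factors. *)
Definition unipotent : set M :=
  [set g : M | exists (s : seq 'rV[int]_d) (h : 'rV[int]_d -> M),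
    [/\ uniq s, forall a, a \in s <-> Phi_pos a,
        forall a, Phi_pos a -> root_subgroup a (h a) &
        g = \prod_(a <- s) h a]].

Definition unipotent0 : set M :=
  generated (\bigcup_(a in Phi_pos) root_subgroup0 a).

Definition pro_p_Iwahori : set M :=
  generated (\bigcup_(a in Phi_pos) root_subgroup0 a `|`
    \bigcup_(a in Phi_pos) [set g ^+ p | g in root_subgroup0 (- a)] `|`
    torus0_pro_p).

(* The matrix sending the basis vector b to c b times the basis vector f b,
   basis vectors being numbered 1, ..., 2d. *)
Definition monomial (f : nat -> nat) (c : nat -> Qp) : M :=
  \matrix_(a, b) if a.+1 == f b.+1 then c b.+1 else 0.

Definition swap (i j k : nat) : nat :=
  if k == i then j else if k == j then i else k.

Definition sdot_mid (i : nat) : M :=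
  monomial (swap i i.+1 \o swap (d + i) (d + i).+1) (fun=> 1).

Definition udot : M :=
  monomial (swap 1 d.+1 \o swap d (d + d))
    (fun b => if b == 1%N then p%:R else if b == d.+1 then p%:R^-1 else 1).

Definition sdot (i : nat) : M :=
  if i == 0%N then udot * sdot_mid 1 * udot
  else if i == d then udot * sdot_mid d.-1 * udot
  else sdot_mid i.

Definition beta (i : nat) : nat :=
  if (i <= d - 1)%N then (d - i)%N
  else if i == d then d
  else if (i <= d + d - 3)%N then (d + d - 1 - i)%N
  else 0%N.

Definition phi : M :=
  (p%:R ^+ (if odd d then 2 else 1))%:M *
  \prod_(1 <= i < d + d - 1) sdot (beta i).

Definition tau (x : Qp) : M :=
  diag_mx (\row_k if (k.+1 <= d - 1)%N || (k.+1 == d + d)%N then x else 1).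

End GSO.

Arguments GO {p} p_pr d _.
Arguments SO {p} p_pr d _.
Arguments GSO {p} p_pr d _.
Arguments torus {p} p_pr d _.
Arguments torus0 {p} p_pr d _.
Arguments torus0_pro_p {p} p_pr d _.
Arguments unipotent {p} p_pr d _.
Arguments unipotent0 {p} p_pr d _.
Arguments pro_p_Iwahori {p} p_pr d _.
Arguments Smx {p} p_pr d.
Arguments udot {p} p_pr d.
Arguments phi {p} p_pr d.
Arguments sdot {p} p_pr d i.
Arguments tau {p p_pr} d x.
Arguments root_subgroup {p} p_pr {d} a _.
Arguments root_subgroup0 {p} p_pr {d} a _.

(* The apartment of T in the semisimple building is the real affine space
   X_*(T)_R / X_*(Z)_R.  Each class has a unique representative
   (x_1, ..., x_d, -x_1, ..., -x_d), and is stored as (x_1, ..., x_d). *)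
Section Apartment.
Context (R : realType) (p : nat) (p_pr : prime p) (d : nat).
Local Notation Qp := (padic p_pr).
Local Notation M := 'M[Qp]_(d + d).
Local Notation A := 'rV[R]_d.

Definition root_eval (a : 'rV[int]_d) (x : A) : R :=
  \sum_i (a 0 i)%:~R * x 0 i.

(* The walls are the hyperplanes root_eval a x = k, with a a root and k an
   integer; a facet is a class of points having the same position with
   respect to every wall. *)
Definition facet (x : A) : set A :=
  [set y | forall a (k : int), Phi a ->
    Num.sg (root_eval a y - k%:~R) = Num.sg (root_eval a x - k%:~R)].

Definition is_chamber (D : set A) :=
  exists2 x, forall a (k : int), Phi a -> root_eval a x <> k%:~R & D = facet x.

(* Facets contained in exactly one wall. *)
Definition is_panel (F : set A) :=
  exists x a (k : int), [/\ Phi a, root_eval a x = k%:~R,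
    forall a' (k' : int), Phi a' -> root_eval a' x = k'%:~R -> a' = a \/ a' = - a &
    F = facet x].

Definition adjacent (D1 D2 : set A) :=
  [/\ is_chamber D1, is_chamber D2, D1 <> D2 &
      exists F, [/\ is_panel F, F `<=` closure D1 & F `<=` closure D2]].

(* The action of N(T) on the apartment.  For t in T this is the translation
   with root_eval a (t x) = root_eval a x - padic_val (root_char a t), and for a
   general monomial matrix the line of the basis vector b is moved to the line
   of the basis vector i with coefficient g i b.  The similitude factor brings
   the result back to the chosen representative modulo X_*(Z)_R.  The action
   is trivial on Z T_0. *)
Definition act (g : M) (x : A) : A :=
  \row_i (\sum_(b | g (lshift d i) b != 0)
            (row_mx x (- x) 0 b - (padic_val (g (lshift d i) b))%:~R)
          + (padic_val (kappa g))%:~R / 2).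

(* The elements of N_a fixing D pointwise. *)
Definition root_fixer (a : 'rV[int]_d) (D : set A) : set M :=
  [set g : M | root_subgroup p_pr a g /\
    forall x, D x -> forall i j, val_ge (- root_eval a x) ((g - 1) i j)].

Definition Iwahori (D : set A) : set M :=
  generated (torus0 p_pr d `|` \bigcup_(a in @Phi d) root_fixer a D).

Definition crossing_root (D1 D2 : set A) (a : 'rV[int]_d) :=
  [/\ Phi a,
      forall a', Phi a' -> a' <> a -> a' <> - a ->
        Iwahori D1 `&` root_subgroup p_pr a' = Iwahori D2 `&` root_subgroup p_pr a',
      has_index (Iwahori D2 `&` root_subgroup p_pr (- a))
                (Iwahori D1 `&` root_subgroup p_pr (- a)) p &
      has_index (Iwahori D1 `&` root_subgroup p_pr a)
                (Iwahori D2 `&` root_subgroup p_pr a) p].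

Definition chamber_seq (C : set A) (j : nat) : set A :=
  let a := (j %/ (d + d - 2))%N in
  let b := (j %% (d + d - 2))%N in
  act (phi p_pr d ^+ a * \prod_(1 <= i < b.+1) sdot p_pr d (beta d i)) @` C.

Definition N0_seq (C : set A) (i : nat) : set M :=
  Iwahori (chamber_seq C i) `&` unipotent p_pr d.

End Apartment.

Arguments Iwahori {R p} p_pr {d} D _.
Arguments crossing_root {R p} p_pr {d} D1 D2 a.
Arguments chamber_seq {R p} p_pr {d} C j _.
Arguments N0_seq {R p} p_pr {d} C i _.

(* Main.v *)
(* Basis vectors are indexed by 'I_(d + d) with the duality [star], and a point x
   of the apartment by its extension (x, -x), so that each root is a difference
   [eps r - eps s] and takes the value x_r - x_s.  An Iwahori subgroup is bounded
   by the inequalities val g_rs >= x_s - x_r at each point x of its chamber, which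
   determines its root subgroups.  An element of N is a block matrix
   (A, A W; 0, A^-T) with A unitriangular and W skew, hence a product of root
   elements whose parameters are bounded by its entries; the group cut out of N by
   a chamber is therefore given by bounds on these parameters.  If two chambers
   are separated by a single wall, of direction eps r - eps s, only the parameter
   at (r, s) changes its bound, by one; modulo p the entry at (r, s) is additive,
   and the index is p.
   The matrices s_i act on the apartment by the simple affine reflections, and the
   point rho / h of the base alcove shows that it shares a panel with its image
   under each of them; translating by the prefixes of the word of phi gives a
   gallery.  The cocharacter z = (1, ..., 1, -1), moved along the word, pairs to 2
   with the direction of each crossed wall and comes back to itself.  This gives
   the positivity of alpha_j, then alpha_j (tau x) = x^(z(alpha_j) / 2) = x and the
   commutation of tau and phi.  Along the coordinates where z is positive phi is a
   cyclic shift by two places, so its d-th power is diagonal, of valuations 2 z up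
   to the center. *)
Require Import Defs.
From mathcomp Require Import all_boot all_order all_algebra.
From mathcomp Require Import fraction.
From mathcomp Require Import boolp classical_sets functions cardinality.
From mathcomp Require Import reals topology normedtype.
From mathcomp Require Import zify ring lra.
Import Order.TTheory GRing.Theory Num.Theory.
Import numFieldNormedType.Exports.
Local Open Scope classical_set_scope.
Local Open Scope ring_scope.

Set Implicit Arguments.
Unset Strict Implicit.
Unset Printing Implicit Defensive.

(** Iwahori subgroups are given by generators, so the difficulty is to bound them from above.
    Entrywise bounds at a point do this, and they are sharp on root subgroups and on [N]; no
    description of a whole Iwahori subgroup is sought. For the index in [N] the bounds are taken at
    a point of the common wall, not inside a chamber: there every root except the two normal to the
    wall has a non-integral value, so its bound on valuations is strict, and each cross term in a
    product of matrices gains a factor p. Two successive chambers are the images, under the prefix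
    of the word preceding a letter s, of the base alcove and its transform by s, so only this pair
    has to be studied. The point rho / h is convenient because each simple affine root takes the
    value 1 / h there: a reflection displaces it by a coroot over h, too little to cross a second
    wall. The cocharacter z controls positivity because the roots pairing to 2 with it are e_i - e_d
    and e_i + e_j with i, j < d, all of them positive. *)

Local Notation "x %:F" := (FracField.tofrac x) : ring_scope.

(** * The p-adic numbers *)

Section PadicIntegers.
Context (p : nat) (p_pr : prime p).
Local Notation Zp := (padic_int p_pr).
Implicit Types x y : Zp.

Lemma expp_gt0 n : (0 < p ^ n)%N.
Proof. by rewrite expn_gt0 prime_gt0. Qed.

Lemma res_mulE x y n : res (x * y) n = (res x n * res y n %% (p ^ n)%N)%Z.
Proof. by []. Qed.

Lemma res_addE x y n : res (x + y) n = ((res x n + res y n) %% (p ^ n)%N)%Z.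
Proof. by []. Qed.

Lemma res_oppE x n : res (- x) n = (- res x n %% (p ^ n)%N)%Z.
Proof. by []. Qed.

Lemma res_nat (k : nat) n : res (k%:R : Zp) n = (k%:Z %% (p ^ n)%N)%Z.
Proof.
elim: k => [|k IH] //.
by rewrite -addn1 natrD res_addE IH PoszD /= modzDml modzDmr.
Qed.

(** Each residue is invertible modulo p^n by Bezout; the inverses are coherent because an inverse
    modulo p^n is unique. *)
Lemma unit_of_res x : res x 1 <> 0 -> x \is a GRing.unit.
Proof.
move=> x1; have cop n : coprimez (res x n) (p ^ n)%N.
  case: n => [|n]; first by rewrite /coprimez /gcdz /= expn0 gcdn1.
  rewrite coprimezE /= coprimeXr // coprime_sym prime_coprime //.
  apply/negP => h; apply: x1; rewrite -(res_le x (leq_addr n 1)) add1n expn1.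
  by apply/dvdz_mod0P; rewrite dvdzE.
pose y n := (egcdz (res x n) (p ^ n)%N).1.
have yP n : (y n * res x n = 1 %[mod (p ^ n)%N])%Z.
  rewrite /y; case: egcdzP => u v /= e _; move: (cop n); rewrite coprimezE => /eqP c.
  have -> : u * res x n = 1 - v * (p ^ n)%N.
    by apply/eqP; rewrite -subr_eq opprK e /gcdz c.
  by rewrite -modzDmr -mulNr modzMl addr0.
have cy n : (y n.+1 = y n %[mod (p ^ n)%N])%Z.
  have e : (y n.+1 * res x n = 1 %[mod (p ^ n)%N])%Z.
    rewrite -(res_succ x n) modzMmr -(modz_modX p _ (leqnSn n)) yP.
    by rewrite modz_modX.
  rewrite -[y n.+1]mulr1 -modzMmr -(yP n) modzMmr mulrCA -modzMmr e modzMmr.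
  by rewrite mulr1.
apply/asboolP; exists (PadicInt p_pr (mod_coherent cy)).
by apply: padic_eqP => n; rewrite res_mulE /= modzMml yP.
Qed.

Lemma dvdp_of_res x : res x 1 = 0 -> exists y, x = p%:R * y.
Proof.
move=> x1; have dv n : (p%:Z %| res x n.+1)%Z.
  by apply/dvdz_mod0P; move: (res_le x (ltn0Sn n)); rewrite expn1 x1.
(* Division by p costs one digit, so the residue at [n] comes from that of [x] at [n.+1]. *)
pose y n := (res x n.+1 %/ p)%Z.
have yE n : p%:Z * y n = res x n.+1 by rewrite mulrC divzK.
have p0 : p%:Z != 0 by rewrite eqz_nat -lt0n prime_gt0.
have cy n : (y n.+1 %% (p ^ n)%N)%Z = y n.
  apply: (mulfI p0); rewrite mulz_modr ?ltz_nat ?prime_gt0 // yE.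
  by rewrite -PoszM -expnS res_succ yE.
have cy' : coherent p y by apply/asboolP.
exists (PadicInt p_pr cy'); apply: padic_eqP => n.
by rewrite res_mulE res_nat modzMml /= yE res_succ.
Qed.

Lemma padic_int_factor x : x != 0 ->
  exists k, exists2 u : Zp, u \is a GRing.unit & x = p%:R ^+ k * u.
Proof.
move=> /(@padic_neq0P _ p_pr)[n /(_ n (leqnn n)) [+ _]].
elim: n x => [|n IH] x xn.
  by case: xn; rewrite -(res_mod x) expn0 modz1.
have [x1|/eqP x1] := eqVneq (res x 1) 0; last first.
  by exists 0; exists x; rewrite ?expr0 ?mul1r //; exact: unit_of_res.
have [y xy] := dvdp_of_res x1.
have [yn|k [u uu yE]] := IH y.
  case: xn; rewrite xy res_mulE res_nat modzMml expnS PoszM -mulz_modr; last first.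
    by rewrite ltz_nat prime_gt0.
  by rewrite res_le // yn mulr0.
by exists k.+1; exists u => //; rewrite xy yE mulrA exprS.
Qed.

Lemma natp_neq0 : (p%:R : Zp) != 0.
Proof.
apply/eqP => /(congr1 (fun x : Zp => res x 2)) /=; rewrite res_nat /= mod0z.
rewrite modz_small /=; first by move=> [e]; move: (prime_gt0 p_pr); rewrite e.
by rewrite ltz_nat -{1}(expn1 p) ltn_exp2l ?prime_gt1.
Qed.

Lemma natp_nonunit x : p%:R * x != 1.
Proof.
apply/eqP => /(congr1 (fun x : Zp => res x 1)).
rewrite res_mulE res_nat expn1 modzz mul0r mod0z /= expn1 modz_small //.
by rewrite ltz_nat prime_gt1.
Qed.

Lemma nat_residue x : exists i : nat, (i < p)%N /\ exists y, x = i%:R + p%:R * y.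
Proof.
have h : res x 1 = `|res x 1|%N.
  by rewrite gez0_abs // -(res_mod x 1) modz_ge0 // eqz_nat -lt0n expp_gt0.
exists `|res x 1|%N; split.
  rewrite -ltz_nat -h -(res_mod x 1) expn1 ltz_pmod // ltz_nat prime_gt0 //.
have [|y e] := @dvdp_of_res (x - `|res x 1|%N%:R); last by exists y; rewrite -e subrKC.
by rewrite res_addE /= res_nat -h res_mod modzDmr addrN mod0z.
Qed.

Lemma nat_residue_inj (i j : nat) x :
  (i < p)%N -> (j < p)%N -> (i%:R - j%:R : Zp) = p%:R * x -> i = j.
Proof.
move=> ip jp h; have: res (i%:R - j%:R : Zp) 1 = res (p%:R * x) 1 by rewrite h.
rewrite res_addE res_mulE res_oppE !res_nat expn1 modzz mul0r mod0z.
rewrite modzDmr modzDml -modzDmr modzNm modzDmr => /dvdz_mod0P.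
rewrite dvdzE /= => {}h; apply/eqP; apply: contraLR h => ij.
have: (0 < `|i%:Z - j%:Z|%N < p)%N by lia.
by case/andP=> h0 h1; rewrite gtnNdvd.
Qed.

End PadicIntegers.
Lemma fractionP (A : idomainType) (x : {fraction A}) :
  exists n d : A, d != 0 /\ x = n%:F / d%:F.
Proof.
have [r ->] : exists r, x = generic_quotient.pi {fraction A} r.
  by exists (generic_quotient.repr x); rewrite generic_quotient.reprK.
exists (\n_r), (\d_r); split; first exact: denom_ratioP.
have d0 : (\d_r)%:F != 0 by rewrite tofrac_eq0 denom_ratioP.
apply: (mulIf d0); rewrite divfK //.
(* Exposes the product as the operation lifted to the quotient, which [piE] computes on
   representatives. *)
change (FracField.mul (generic_quotient.pi {fraction A} r) (\d_r)%:F = (\n_r)%:F).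
rewrite !generic_quotient.piE /FracField.mulf.
apply/generic_quotient.eqmodP => /=.
by rewrite FracField.equivfE !numden_Ratio ?mulf_neq0 ?oner_eq0 ?denom_ratioP //
  !mulr1 mulrC.
Qed.

(** * Valuations and their integral or real lower bounds *)

Section Valuation.
Context (p : nat) (p_pr : prime p).
Local Notation Zp := (padic_int p_pr).
Local Notation Qp := (padic p_pr).
Local Notation pi := (p%:R : Qp).
Implicit Types (x y : Qp) (k l : int).

(** Valuation at least [k], phrased as divisibility so as to include 0, at which [padic_val] has a
    junk value. *)
Definition vg k x := exists z : Zp, x = pi ^ k * z%:F.

Lemma pi_neq0 : pi != 0.
Proof. by rewrite -(rmorph_nat (@FracField.tofrac Zp)) tofrac_eq0 natp_neq0. Qed.

Lemma piX_neq0 k : pi ^ k != 0.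
Proof. exact: expfz_neq0 pi_neq0. Qed.

Lemma piD k l : pi ^ (k + l) = pi ^ k * pi ^ l.
Proof. exact: expfzDr pi_neq0. Qed.

Lemma tofrac_pi (z : Zp) (n : nat) : (p%:R ^+ n * z)%:F = pi ^ n%:Z * z%:F.
Proof. by rewrite rmorphM rmorphXn rmorph_nat. Qed.

Lemma vgM k l x y : vg k x -> vg l y -> vg (k + l) (x * y).
Proof.
by move=> [z ->] [t ->]; exists (z * t); rewrite piD rmorphM mulrACA.
Qed.

Lemma vg_le k l x : k <= l -> vg l x -> vg k x.
Proof.
move=> kl [z ->]; exists (p%:R ^+ `|l - k|%N * z).
rewrite tofrac_pi mulrA -piD; congr (pi ^ _ * _); lia.
Qed.

Lemma vgD k x y : vg k x -> vg k y -> vg k (x + y).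
Proof. by move=> [z ->] [t ->]; exists (z + t); rewrite rmorphD mulrDr. Qed.

Lemma vgN k x : vg k x -> vg k (- x).
Proof. by move=> [z ->]; exists (- z); rewrite rmorphN mulrN. Qed.

Lemma vg0 k : vg k 0.
Proof. by exists 0; rewrite rmorph0 mulr0. Qed.

Lemma vgX k : vg k (pi ^ k).
Proof. by exists 1; rewrite rmorph1 mulr1. Qed.

Lemma vg0_nat n : vg 0 n%:R.
Proof. by exists n%:R; rewrite rmorph_nat expr0z mul1r. Qed.

Lemma vg_sum k (I : Type) (r : seq I) (P : pred I) (F : I -> Qp) :
  (forall i, P i -> vg k (F i)) -> vg k (\sum_(i <- r | P i) F i).
Proof. by move=> h; elim/big_ind: _ => //; [exact: vg0 | exact: vgD]. Qed.

Lemma integralE x : integral x <-> vg 0 x.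
Proof. by split=> -[z ->]; exists z; rewrite expr0z mul1r. Qed.

Lemma padic_factor x : x != 0 ->
  exists k, exists2 u : Zp, u \is a GRing.unit & x = pi ^ k * u%:F.
Proof.
have [n [e [e0 ->]]] := fractionP x; rewrite mulf_eq0 invr_eq0 tofrac_eq0 => /norP[n0 _].
have [k [u uu ->]] := padic_int_factor n0; have [l [v vu ->]] := padic_int_factor e0.
exists (k%:Z - l%:Z); exists (u / v); first by rewrite unitrM uu unitrV.
rewrite !tofrac_pi invfM piD mulrACA rmorphM /= rmorphV //.
by rewrite -exprnN.
Qed.

Lemma vg_unit k l (u : Zp) : u \is a GRing.unit -> vg k (pi ^ l * u%:F) -> k <= l.
Proof.
move=> uu [z]; rewrite leNgt; apply: contraPN => lk e.
have: p%:R ^+ `|k - l|%N * z = u.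
  apply/eqP; rewrite -tofrac_eq tofrac_pi; apply/eqP.
  apply: (mulfI (piX_neq0 l)); rewrite e mulrA -piD; congr (pi ^ _ * _); lia.
have -> : `|k - l|%N = (`|k - l|%N).-1.+1 by lia.
move/(congr1 (fun t : Zp => t * u^-1)); rewrite mulrV // exprS -!mulrA => /eqP.
by rewrite (negbTE (natp_nonunit _)).
Qed.

Lemma padic_valE k (u : Zp) : u \is a GRing.unit -> padic_val (pi ^ k * u%:F) = k.
Proof.
move=> uu; rewrite /padic_val; case: xgetP => [l _ [v vu e]|/(_ k)[]]; last by exists u.
apply/eqP; rewrite eq_le; apply/andP; split.
  by apply: (vg_unit uu); rewrite e; exists v.
by apply: (vg_unit vu); rewrite -e; exists u.
Qed.

Lemma padic_valX k : padic_val (pi ^ k) = k.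
Proof. by have := padic_valE k (unitr1 Zp); rewrite rmorph1 mulr1. Qed.

Lemma vg_val k x : x != 0 -> vg k x -> k <= padic_val x.
Proof. by case/padic_factor=> l [u uu ->]; rewrite padic_valE //; exact: vg_unit. Qed.

Lemma val_vg x : x != 0 -> vg (padic_val x) x.
Proof. by case/padic_factor=> l [u uu ->]; rewrite padic_valE //; exists u. Qed.

(** Together with [vg_residue]: the i p^k with i < p represent p^k Z_p modulo p^(k+1) Z_p, which is
    how cosets are counted later. *)
Lemma vg_succ_nat k (i j : nat) : (i < p)%N -> (j < p)%N ->
  vg (k + 1) ((i%:R - j%:R) * pi ^ k) -> i = j.
Proof.
move=> ip jp [z e]; apply: (nat_residue_inj ip jp (x := z)).
apply/eqP; rewrite -tofrac_eq rmorphB rmorphM !rmorph_nat; apply/eqP.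
by apply: (mulIf (piX_neq0 k)); rewrite e piD expr1z [RHS]mulrC mulrA.
Qed.

Lemma vg_residue k x : vg k x -> exists i : nat, (i < p)%N /\ vg (k + 1) (x - i%:R * pi ^ k).
Proof.
case=> z ->; have [i [ip [y ->]]] := nat_residue z.
exists i; split=> //; exists y; rewrite rmorphD rmorphM !rmorph_nat piD mulrDr.
by rewrite [_ * i%:R]mulrC addrAC subrr add0r mulrA.
Qed.

Lemma two_neq0 : (2%:R : Qp) != 0.
Proof.
rewrite -(rmorph_nat (@FracField.tofrac Zp)) tofrac_eq0; apply/eqP.
(* Residues modulo p^2 are compared, since for p = 2 the residue of 2 modulo p vanishes. *)
move/(congr1 (fun x : Zp => res x 2)); rewrite res_nat /= mod0z modz_small //.
have := prime_gt1 p_pr; case: (p) => [|[|q]] // _.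
by rewrite ltz_nat expnS expn1; lia.
Qed.

(** A negative valuation is multiplied by n in the n-th power and falls below any bound. *)
Lemma vg0_of_powers k x : (forall n, vg k (x ^+ n)) -> vg 0 x.
Proof.
move=> h; have [->|x0] := eqVneq x 0; first exact: vg0.
case: (padic_factor x0) => l [u uu xE].
have [l0|l0] := leP 0 l; first by apply: (vg_le l0); rewrite xE; exists u.
have := h `|k|%N.+1; rewrite xE exprMn -rmorphXn exprnP exprz_exp.
have uXu : u ^+ `|k|%N.+1 \is a GRing.unit by rewrite unitrX.
by move/(vg_unit uXu) => ?; exfalso; nia.
Qed.

Section RealBound.
Context (R : realType).
Implicit Types r s : R.

Lemma val_geP r x : val_ge r x <-> exists k, r <= k%:~R /\ vg k x.
Proof.
split=> [[->|rx]|[k [rk kx]]].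
- by exists (Num.ceil r); split; [exact: ceil_ge | exact: vg0].
- have [->|x0] := eqVneq x 0.
    by exists (Num.ceil r); split; [exact: ceil_ge | exact: vg0].
  by exists (padic_val x); split=> //; exact: val_vg.
- have [->|x0] := eqVneq x 0; first by left.
  by right; apply: (le_trans rk); rewrite ler_int; exact: vg_val.
Qed.

Lemma val_geM r s x y : val_ge r x -> val_ge s y -> val_ge (r + s) (x * y).
Proof.
move=> /val_geP[k [rk kx]] /val_geP[l [sl ly]]; apply/val_geP.
by exists (k + l); split; [rewrite intrD lerD | exact: vgM].
Qed.

Lemma val_ge0 r : val_ge r (0 : Qp).
Proof. by left. Qed.

Lemma val_geD r x y : val_ge r x -> val_ge r y -> val_ge r (x + y).
Proof.
move=> /val_geP[k [rk kx]] /val_geP[l [sl ly]]; apply/val_geP.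
have [kl|/ltW lk] := leP k l.
  by exists k; split=> //; apply: vgD => //; exact: (vg_le kl).
by exists l; split=> //; apply: vgD => //; exact: (vg_le lk).
Qed.

Lemma val_geN r x : val_ge r x -> val_ge r (- x).
Proof.
by move=> /val_geP[k [rk kx]]; apply/val_geP; exists k; split=> //; exact: vgN.
Qed.

Lemma val_ge_sum r (I : Type) (q : seq I) (P : pred I) (F : I -> Qp) :
  (forall i, P i -> val_ge r (F i)) -> val_ge r (\sum_(i <- q | P i) F i).
Proof. by move=> h; elim/big_ind: _ => //; [exact: val_ge0 | exact: val_geD]. Qed.

Lemma val_ge_le r s x : r <= s -> val_ge s x -> val_ge r x.
Proof.
by move=> rs /val_geP[k [sk kx]]; apply/val_geP; exists k; split=> //; apply: le_trans sk.
Qed.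

Lemma val_ge_int k x : val_ge (k%:~R : R) x <-> vg k x.
Proof.
split=> [/val_geP[l [kl lx]]|kx]; last by apply/val_geP; exists k.
by apply: vg_le lx; move: kl; rewrite ler_int.
Qed.

(** Valuations are integers, so a strict real bound gains a unit; the factor p gained at a wall
    comes from here. *)
Lemma val_ge_lt k r x : k%:~R < r -> val_ge r x -> vg (k + 1) x.
Proof.
move=> kr /val_geP[l [rl lx]]; apply: vg_le lx.
by rewrite -ltzD1 ltrD2r -(ltr_int R); exact: lt_le_trans rl.
Qed.

Lemma val_ge_eq r s x : (forall k, r <= k%:~R -> s <= k%:~R) -> val_ge r x -> val_ge s x.
Proof. by move=> rs /val_geP[k [rk kx]]; apply/val_geP; exists k; split=> //; exact: rs. Qed.

Lemma val_ge_strict r x : (forall k, r <> k%:~R) -> val_ge r x ->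
  exists2 s, r < s & val_ge s x.
Proof.
move=> nr /val_geP[k [rk kx]]; exists k%:~R; last exact/val_ge_int.
by rewrite lt_neqAle rk andbT; apply/eqP.
Qed.

Lemma val_ge_1 r : r <= 0 -> val_ge r (1 : Qp).
Proof. by move=> r0; apply/val_geP; exists 0; split=> //; exact: (vg0_nat 1). Qed.

End RealBound.

End Valuation.
(** * Weights, similitudes and root subgroups *)

Section Star.
Context (d : nat).
Local Notation J := 'I_(d + d).
Implicit Types (r s t u : J) (i j : 'I_d).

(* Basis vectors numbered by [r] and [star r] are dual for the form [Smx]. *)
Definition star r : J :=
  match fintype.split r with inl i => rshift d i | inr i => lshift d i end.

Lemma star_lshift i : star (lshift d i) = rshift d i.
Proof. by rewrite /star -[lshift d i]/(unsplit (inl i)) unsplitK. Qed.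

Lemma star_rshift i : star (rshift d i) = lshift d i.
Proof. by rewrite /star -[rshift d i]/(unsplit (inr i)) unsplitK. Qed.

Lemma starP r : (exists i, r = lshift d i) \/ (exists i, r = rshift d i).
Proof. by case: (split_ordP r) => i ->; [left | right]; exists i. Qed.

Lemma starK : involutive star.
Proof.
by move=> r; case: (starP r) => -[i ->]; rewrite ?(star_lshift, star_rshift).
Qed.

Lemma star_inj : injective star.
Proof. exact: inv_inj starK. Qed.

Lemma val_star r : val (star r) = if (r < d)%N then (r + d)%N else (r - d)%N.
Proof.
case: (starP r) => -[i ->]; rewrite ?(star_lshift, star_rshift) /=.
  by rewrite ltn_ord addnC.
by rewrite ltnNge leq_addr addKn.
Qed.

Lemma star_neq r : star r != r.
Proof.
apply/eqP => /(congr1 val); rewrite val_star; have := ltn_ord r.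
by case: ifP => /=; lia.
Qed.

Lemma eq_star r s : (star r == s) = (r == star s).
Proof. exact: (inv_eq starK). Qed.

(* The condition for [eps r - eps s] to be a root. *)
Definition rt r s := (s != r) && (s != star r).

Lemma rt_sym r s : rt r s = rt s r.
Proof. by rewrite /rt eq_sym [r == star s]eq_sym eq_star. Qed.

Lemma rt_star r s : rt (star r) (star s) = rt r s.
Proof. by rewrite /rt !(inj_eq star_inj). Qed.

(* The weight of the basis vector [r], up to the similitude character. *)
Definition eps r : 'rV[int]_d :=
  match fintype.split r with inl i => e_ i | inr i => - e_ i end.

Lemma eps_lshift i : eps (lshift d i) = e_ i.
Proof. by rewrite /eps -[lshift d i]/(unsplit (inl i)) unsplitK. Qed.

Lemma eps_rshift i : eps (rshift d i) = - e_ i.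
Proof. by rewrite /eps -[rshift d i]/(unsplit (inr i)) unsplitK. Qed.

Definition epsE := (eps_lshift, eps_rshift, star_lshift, star_rshift).

Lemma eps_star r : eps (star r) = - eps r.
Proof. by case: (starP r) => -[i ->]; rewrite !epsE ?opprK. Qed.

Definition proot r s := eps r - eps s.

Lemma proot_star r s : proot (star s) (star r) = proot r s.
Proof. by rewrite /proot !eps_star opprK addrC. Qed.

Lemma proot_opp r s : - proot r s = proot s r.
Proof. by rewrite /proot opprB. Qed.

Lemma eps_coord r i : eps r 0 i = (r == lshift d i)%:Z - (r == rshift d i)%:Z.
Proof.
case: (starP r) => -[j ->]; rewrite !epsE !mxE eqxx /=.
  by rewrite eq_lshift eq_lrshift subr0 eq_sym; case: eqP.
by rewrite eq_rshift eq_rlshift sub0r eq_sym; case: eqP.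
Qed.

Lemma proot_coord r s q :
  (r == q)%:Z - (r == star q)%:Z - ((s == q)%:Z - (s == star q)%:Z) =
  match fintype.split q with inl i => proot r s 0 i | inr i => - proot r s 0 i end.
Proof.
case: (starP q) => -[i ->].
  by rewrite -[lshift d i]/(unsplit (inl i)) unsplitK /= star_lshift /proot !mxE -!eps_coord.
rewrite -[rshift d i]/(unsplit (inr i)) unsplitK /= star_rshift /proot !mxE !eps_coord.
by ring.
Qed.

Definition same_root t u r s := ((t == r) && (u == s)) || ((t == star s) && (u == star r)).

(** The coordinates of [proot r s] encode the function that is 1 at r and [star s], and -1 at s and
    [star r]. These four indices are distinct, so the function determines the set {r, [star s]}. *)
Lemma proot_inj r s t u : rt r s -> proot t u = proot r s -> same_root t u r s.
Proof.
move=> /andP[sr srs] e.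
have E q : (t == q)%:Z - (t == star q)%:Z - ((u == q)%:Z - (u == star q)%:Z) =
   (r == q)%:Z - (r == star q)%:Z - ((s == q)%:Z - (s == star q)%:Z).
  by rewrite !proot_coord e.
have excl v : ((v == r) + (v == star r) + (v == s) + (v == star s) <= 1)%N.
  have rr := negbTE (star_neq r); have ss := negbTE (star_neq s).
  have [->|_] := eqVneq v r.
    by rewrite [r == star r]eq_sym rr [r == s]eq_sym (negbTE sr) -eq_star eq_sym (negbTE srs).
  have [->|_] := eqVneq v (star r).
    by rewrite eq_sym (negbTE srs) (inj_eq star_inj) eq_sym (negbTE sr).
  by have [->|_] := eqVneq v s; rewrite ?[s == star s]eq_sym ?ss // leq_b1.
have := E s; have := E r; have := excl u; have := excl t; rewrite /same_root !eqxx.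
rewrite [r == star r]eq_sym (negbTE (star_neq r)) (negbTE sr) (negbTE srs).
rewrite [r == s]eq_sym (negbTE sr) -(eq_star r s) [star r == s]eq_sym (negbTE srs).
rewrite [s == star s]eq_sym (negbTE (star_neq s)).
case: (t == r); case: (t == star r); case: (t == s); case: (t == star s) => //;
by case: (u == r); case: (u == star r); case: (u == s); case: (u == star s).
Qed.

Lemma same_root_proot r s t u : same_root t u r s -> proot t u = proot r s.
Proof. by case/orP => /andP[/eqP -> /eqP ->] //; rewrite proot_star. Qed.

(** Chosen so that, after [lshift d i], [true] gives e_i - e_j and [false] gives e_i + e_j, as the
    sign (-1)^c in [Phi_pos]. *)
Definition rt_sign (c : bool) j : J := if c then lshift d j else rshift d j.

Lemma eps_sign c j : - eps (rt_sign c j) = (-1) ^+ c *: e_ j.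
Proof. by case: c; rewrite /rt_sign epsE ?opprK ?scaleN1r ?scale1r. Qed.

Lemma rt_signP i j c : i != j -> rt (lshift d i) (rt_sign c j).
Proof.
rewrite /rt /rt_sign epsE eq_sym => ij.
by case: c; rewrite ?eq_lshift ?eq_rshift ?eq_lrshift ?eq_rlshift ?ij.
Qed.

Lemma Phi_posE a : Phi_pos a <-> exists i j c, (i < j)%N /\ a = proot (lshift d i) (rt_sign c j).
Proof.
by split=> -[i [j [c [ij ->]]]]; exists i, j, c; split=> //; rewrite /proot eps_sign epsE.
Qed.

Lemma PhiP a : Phi a <-> exists r s, rt r s /\ a = proot r s.
Proof.
split=> [[i [j [b [c [ij ->]]]]]|[r [s [rs ->]]]].
  exists (rt_sign (~~ b) i), (rt_sign c j); split.
    rewrite /rt /rt_sign; case: b; case: c; rewrite /= epsE;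
    by rewrite ?eq_lshift ?eq_rshift ?eq_lrshift ?eq_rlshift eq_sym ij.
  by rewrite /proot eps_sign; case: b; rewrite /rt_sign /= epsE ?scaleN1r ?scale1r.
have H (k : J) : exists i (b : bool), k = rt_sign b i.
  by case: (starP k) => -[i ->]; [exists i, true | exists i, false].
have [i [b ri]] := H r; have [j [c sj]] := H s.
exists i, j, (~~ b), c; split.
  by apply: contraTneq rs => ij; rewrite ri sj ij /rt /rt_sign; case: b {ri}; case: c {sj};
    rewrite ?epsE eqxx ?andbF.
rewrite /proot sj eps_sign ri; congr (_ + _).
by case: b {ri}; rewrite /rt_sign /= epsE ?scaleN1r ?scale1r.
Qed.

Lemma proot_Phi r s : rt r s -> Phi (proot r s).
Proof. by move=> rs; apply/PhiP; exists r, s. Qed.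

Section Coordinates.
Context (R : realType).
Implicit Types x y : 'rV[R]_d.

Definition ext x r : R := row_mx x (- x) 0 r.

Lemma ext_lshift x i : ext x (lshift d i) = x 0 i.
Proof. by rewrite /ext row_mxEl. Qed.

Lemma ext_rshift x i : ext x (rshift d i) = - x 0 i.
Proof. by rewrite /ext row_mxEr mxE. Qed.

Lemma ext_star x r : ext x (star r) = - ext x r.
Proof. by case: (starP r) => -[i ->]; rewrite !epsE ?ext_lshift ?ext_rshift ?opprK. Qed.

Lemma root_evalB (a b : 'rV[int]_d) x : root_eval (a - b) x = root_eval a x - root_eval b x.
Proof.
rewrite /root_eval -sumrB; apply: eq_bigr => i _.
by rewrite !mxE intrD mulrDl mulrNz mulNr.
Qed.

Lemma root_evalN (a : 'rV[int]_d) x : root_eval (- a) x = - root_eval a x.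
Proof.
by rewrite /root_eval -sumrN; apply: eq_bigr => i _; rewrite !mxE mulrNz mulNr.
Qed.

Lemma root_eval_e i x : root_eval (e_ i) x = x 0 i.
Proof.
rewrite /root_eval (bigD1 i) //= big1 => [|j ji].
  by rewrite mxE !eqxx mul1r addr0.
by rewrite mxE (negbTE ji) mul0r.
Qed.

Lemma root_evalE r s x : root_eval (proot r s) x = ext x r - ext x s.
Proof.
have H k : root_eval (eps k) x = ext x k.
  by case: (starP k) => -[i ->]; rewrite !epsE ?root_evalN root_eval_e ?ext_lshift ?ext_rshift.
by rewrite root_evalB !H.
Qed.

End Coordinates.

End Star.

(** * Generated subgroups and the ring of square matrices *)

Section Subgroups.
Context (p : nat) (p_pr : prime p) (n : nat).
Local Notation M := 'M[padic p_pr]_n.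
Implicit Types H S : set M.

Lemma generated_sub S H : is_subgroup H -> S `<=` H -> generated S `<=` H.
Proof. by move=> gH SH; exact: smallest_sub. Qed.

Lemma sub_generated S : S `<=` generated S.
Proof. exact: sub_gen_smallest. Qed.

(** [generated S] is an intersection, and its elements are known to be invertible only once some
    subgroup [H] contains [S]. *)
Lemma generated_group S H : is_subgroup H -> S `<=` H -> is_subgroup (generated S).
Proof.
move=> gH SH; split.
- by move=> g /(generated_sub gH SH); case: gH => + _ _ _; exact.
- by move=> K [[_ K1 _ _] _].
- by move=> g h gg gh K [gK SK]; case: (gK) => _ _ KM _; apply: KM; [exact: gg | exact: gh].
- by move=> g gg K [gK SK]; case: (gK) => _ _ _ KV; apply: KV; exact: gg.
Qed.

Lemma setI_group H K : is_subgroup H -> is_subgroup K -> is_subgroup (H `&` K).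
Proof.
move=> [Hu H1 HM HV] [Ku K1 KM KV]; split.
- by move=> g [/Hu].
- by split.
- by move=> g h [Hg Kg] [Hh Kh]; split; [exact: HM | exact: KM].
- by move=> g [Hg Kg]; split; [exact: HV | exact: KV].
Qed.

Lemma prod_group (I : eqType) (r : seq I) (P : pred I) (F : I -> M) H : is_subgroup H ->
  (forall i, i \in r -> P i -> H (F i)) -> H (\prod_(i <- r | P i) F i).
Proof.
move=> [_ H1 HM _] h; rewrite big_seq_cond; elim/big_ind: _ => //.
by move=> i /andP[ir Pi]; apply: h.
Qed.

End Subgroups.

Section SquareMatrices.
Context (F : fieldType) (n : nat).
Local Notation M := 'M[F]_n.

Lemma mxMl (A B : M) i j : (A * B) i j = \sum_k A i k * B k j.
Proof. by rewrite !mxE. Qed.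

Lemma mxZr k (A B : M) : A * (k *: B) = k *: (A * B).
Proof. by rewrite [RHS]scalemxAr. Qed.

Lemma mxZl k (A B : M) : (k *: A) * B = k *: (A * B).
Proof. by rewrite [RHS]scalemxAl. Qed.

Lemma mxMsl k (A : M) : k%:M * A = k *: A.
Proof. exact: mul_scalar_mx. Qed.

Lemma mxMsr k (A : M) : A * k%:M = k *: A.
Proof. exact: mul_mx_scalar. Qed.

Lemma invmx_uniq (A B : M) : A * B = 1 -> A \in unitmx /\ invmx A = B.
Proof.
rewrite -[A * B]/(A *m B) => AB; have [Au _] := mulmx1_unit AB.
by split=> //; rewrite -[RHS](mulKmx Au B) AB [RHS]mulmx1.
Qed.

Lemma invmx_mul (A B : M) : A \in unitmx -> B \in unitmx ->
  invmx (A * B) = invmx B * invmx A.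
Proof.
move=> Au Bu; apply: (proj2 (invmx_uniq _)).
rewrite -[LHS]/(A *m B *m (invmx B *m invmx A)) mulmxA -(mulmxA A) mulmxV // mulmx1.
exact: mulmxV.
Qed.

End SquareMatrices.

(** * The adjoint for the quadratic form, and similitudes *)

Section Form.
Context (F : fieldType) (d : nat).
Local Notation M := 'M[F]_(d + d).
Local Notation J := 'I_(d + d).
Implicit Types (g h : M) (r s t u : J) (k : F).

(* The adjoint with respect to [form]. *)
Definition adj g : M := \matrix_(i, j) g (star j) (star i).

Lemma adjE g i j : adj g i j = g (star j) (star i).
Proof. by rewrite mxE. Qed.

Lemma adjK g : adj (adj g) = g.
Proof. by apply/matrixP => i j; rewrite !mxE !starK. Qed.

Lemma adjM g h : adj (g * h) = adj h * adj g.
Proof.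
apply/matrixP => i j; rewrite adjE !mxMl (reindex_inj (@star_inj d)) /=.
by apply: eq_bigr => r _; rewrite !adjE mulrC.
Qed.

Lemma adjD g h : adj (g + h) = adj g + adj h.
Proof. by apply/matrixP => i j; rewrite !mxE. Qed.

Lemma adjZ k g : adj (k *: g) = k *: adj g.
Proof. by apply/matrixP => i j; rewrite !mxE. Qed.

Lemma adj1 : adj 1 = 1.
Proof.
by apply/matrixP => i j; rewrite !mxE (inj_eq (@star_inj d)) eq_sym.
Qed.

(* [Smx] over an arbitrary field. *)
Definition form : M := block_mx 0 1%:M 1%:M 0.

Lemma formE i j : form i j = (j == star i)%:R.
Proof.
by case: (starP i) => -[a ->]; case: (starP j) => -[b ->]; rewrite /form epsE
  ?block_mxEul ?block_mxEur ?block_mxEdl ?block_mxEdr ?eq_lshift ?eq_rshift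
  ?eq_lrshift ?eq_rlshift !mxE // eq_sym.
Qed.

Lemma form_mul g i j : (form * g) i j = g (star i) j.
Proof.
rewrite mxMl (bigD1 (star i)) //= formE eqxx mul1r big1 ?addr0 // => k ki.
by rewrite formE (negbTE ki) mul0r.
Qed.

Lemma mul_form g i j : (g * form) i j = g i (star j).
Proof.
rewrite mxMl (bigD1 (star j)) //= formE starK eqxx mulr1 big1 ?addr0 // => k kj.
by rewrite formE -eq_star [_ == k]eq_sym (negbTE kj) mulr0.
Qed.

Lemma form_form : form * form = 1.
Proof.
by apply/matrixP => i j; rewrite form_mul formE starK mxE eq_sym.
Qed.

Lemma adj_form g : adj g = form * g^T * form.
Proof. by apply/matrixP => i j; rewrite mul_form form_mul !mxE. Qed.

(** The form squares to 1, so multiplying by it turns the condition on the transpose into an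
    identity of the matrix ring. *)
Lemma similP g k : g^T * form * g = k *: form <-> adj g * g = k%:M.
Proof.
split=> e.
  have -> : adj g * g = form * (g^T * form * g) by rewrite adj_form !mulrA.
  by rewrite e mxZr form_form scalemx1.
have -> : g^T * form * g = form * (adj g * g).
  by rewrite adj_form !mulrA form_form mul1r.
by rewrite e mxMsr.
Qed.

Lemma simil_inv g k : k != 0 -> adj g * g = k%:M ->
  [/\ g \in unitmx, invmx g = k^-1 *: adj g & g * adj g = k%:M].
Proof.
move=> k0 e; have e1 : (k^-1 *: adj g) * g = 1.
  by rewrite mxZl e scale_scalar_mx mulVf.
have e2 : g * (k^-1 *: adj g) = 1 by exact: mulmx1C.
have [gu gi] := invmx_uniq e2; split=> //.
have e3 : k^-1 *: (g * adj g) = 1 by rewrite -mxZr.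
rewrite -[LHS]scale1r -(mulfV k0) -scalerA e3; exact: scalemx1.
Qed.

Lemma simil_mul g h k l : adj g * g = k%:M -> adj h * h = l%:M ->
  adj (g * h) * (g * h) = (k * l)%:M.
Proof.
move=> gk hl.
have -> : adj (g * h) * (g * h) = adj h * (adj g * g * h) by rewrite adjM !mulrA.
by rewrite gk mxMsl mxZr hl scale_scalar_mx.
Qed.

Lemma simil_invmx g k : k != 0 -> adj g * g = k%:M ->
  adj (invmx g) * invmx g = (k^-1)%:M.
Proof.
move=> k0 gk; have [gu gi gag] := simil_inv k0 gk.
by rewrite gi adjZ adjK mxZl mxZr gag !scale_scalar_mx mulVf // mulr1.
Qed.

Lemma diag_simil (t : J -> F) k : (forall i, t i * t (star i) = k) ->
  adj (diag_mx (\row_i t i)) * diag_mx (\row_i t i) = k%:M.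
Proof.
move=> tk; apply/matrixP => i j; rewrite mxMl (bigD1 i) //= big1 ?addr0; last first.
  by move=> l li; rewrite !mxE (inj_eq (@star_inj d)) (negbTE li) mulr0n mul0r.
rewrite !mxE eqxx mulr1n; have [_|_] := eqVneq i j.
  by rewrite !mulr1n mulrC tk.
by rewrite !mulr0n mulr0.
Qed.

Definition half_scalar k (i : J) : F := if (i < d)%N then k else 1.

Lemma half_scalar_star k i : half_scalar k i * half_scalar k (star i) = k.
Proof.
rewrite /half_scalar val_star; have := ltn_ord i.
have [id _|di ?] := ltnP i d; first by rewrite ltnNge leq_addl mulr1.
by rewrite ltn_subLR // ifT ?mul1r.
Qed.

Lemma half_scalar_neq0 k i : k != 0 -> half_scalar k i != 0.
Proof. by rewrite /half_scalar; case: ifP; rewrite ?oner_neq0. Qed.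

Lemma half_scalarE k :
  diag_mx (\row_i half_scalar k i) = block_mx k%:M 0 0 1%:M :> M.
Proof.
apply/matrixP => i j; rewrite /half_scalar.
case: (starP i) => -[a ->]; case: (starP j) => -[b ->]; rewrite
  ?block_mxEul ?block_mxEur ?block_mxEdl ?block_mxEdr !mxE /= ?eq_lshift ?eq_rshift
  ?eq_lrshift ?eq_rlshift ?mulr0n //; case: eqP => // _; first by rewrite ltn_ord.
by rewrite ltnNge leq_addr.
Qed.

Lemma diag_mul (t s : J -> F) :
  diag_mx (\row_i t i) * diag_mx (\row_i s i) = diag_mx (\row_i (t i * s i)) :> M.
Proof.
rewrite -[LHS]/(_ *m _) mulmx_diag; congr diag_mx; apply/rowP => i.
by rewrite !mxE.
Qed.

Lemma diag_simil_entries g k : is_diag_mx g -> adj g * g = k%:M ->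
  g = diag_mx (\row_i g i i) /\ forall i, g i i * g (star i) (star i) = k.
Proof.
move=> /is_diag_mxP gd gk.
have gE : g = diag_mx (\row_i g i i).
  apply/matrixP => i j; rewrite !mxE; have [->|ij] := eqVneq i j; first by rewrite mulr1n.
  by rewrite mulr0n gd.
split=> // i; move: (congr1 (fun A : M => A i i) gk); rewrite mxMl (bigD1 i) //= big1 ?addr0.
  by rewrite !mxE eqxx mulr1n mulrC.
by move=> l li; rewrite mxE gd ?mul0r // (inj_eq (val_inj)) (inj_eq (@star_inj d)).
Qed.

Lemma scalar_inj k l : (0 < d)%N -> k%:M = l%:M :> M -> k = l.
Proof.
move=> hd /matrixP/(_ (lshift d (Ordinal hd)) (lshift d (Ordinal hd))).
by rewrite !mxE eqxx !mulr1n.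
Qed.

(** [GSO] is given by generators. Dividing by the generator diag(k, 1) leaves a diagonal isometry,
    of determinant 1 because dual entries are inverse to each other. *)
Lemma diag_half_decomp (t : J -> F) k : k != 0 -> (forall i, t i * t (star i) = k) ->
  exists s : J -> F, [/\ diag_mx (\row_i t i) = block_mx k%:M 0 0 1%:M * diag_mx (\row_i s i),
    \det (diag_mx (\row_i s i)) = 1 & forall i, s i * s (star i) = 1].
Proof.
move=> k0 tk; pose s i := t i / half_scalar k i.
have sE i : s i * s (star i) = 1.
  by rewrite /s mulrACA tk -invfM half_scalar_star mulfV.
exists s; split=> //.
  rewrite -half_scalarE diag_mul; congr diag_mx; apply/rowP => i.
  by rewrite !mxE /s mulrC divfK // half_scalar_neq0.
rewrite det_diag big_split_ord /= -big_split /= big1 // => i _.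
by rewrite !mxE -star_lshift.
Qed.

End Form.

Section Similitudes.
Context (p : nat) (p_pr : prime p) (d : nat).
Local Notation Qp := (padic p_pr).
Local Notation M := 'M[Qp]_(d + d).
Local Notation J := 'I_(d + d).
Implicit Types (g h : M) (k : Qp).

Lemma similQP g k : g^T * Smx p_pr d * g = k *: Smx p_pr d <-> adj g * g = k%:M.
Proof. exact: similP. Qed.

Definition simil : set M := [set g | exists2 k, k != 0 & adj g * g = k%:M].

Lemma simil_group : is_subgroup simil.
Proof.
split.
- by move=> g [k k0 /(simil_inv k0)[]].
- exists 1; first exact: oner_neq0.
  by rewrite adj1 mulr1.
- move=> g h [k k0 gk] [l l0 hl]; exists (k * l); first exact (mulf_neq0 k0 l0).
  exact: simil_mul gk hl.
- move=> g [k k0 gk]; exists k^-1; last exact: simil_invmx k0 gk.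
  by rewrite invr_eq0; exact k0.
Qed.

Lemma SO_simil g : SO p_pr d g -> adj g * g = 1.
Proof.
by case=> _ e; have /similQP -> // : g^T * Smx p_pr d * g = 1 *: Smx p_pr d by rewrite scale1r.
Qed.

Lemma GSO_simil : GSO p_pr d `<=` simil.
Proof.
apply: generated_sub; first exact: simil_group.
move=> g [/SO_simil e|[x x0 <-]]; first by exists 1; [exact: oner_neq0 | exact: e].
exists x; first exact: x0.
by rewrite -half_scalarE; apply: diag_simil => i; exact: half_scalar_star.
Qed.

Lemma GSO_group : is_subgroup (GSO p_pr d).
Proof.
apply: (generated_group simil_group) => g gS; apply: GSO_simil.
exact: sub_generated.
Qed.

Lemma kappaE (hd : (0 < d)%N) g k : adj g * g = k%:M -> kappa g = k.
Proof.
move=> gk; rewrite /kappa; case: xgetP => [l _|/(_ k)[]]; last exact/similQP.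
by move/similQP; rewrite gk => /(scalar_inj hd).
Qed.

Lemma torusP (hd : (0 < d)%N) t : torus p_pr d t ->
  [/\ t = diag_mx (\row_i t i i), forall i, t i i != 0, kappa t != 0 &
      forall i, t i i * t (star i) (star i) = kappa t].
Proof.
move=> [/GSO_simil[k k0 tk] td]; rewrite (kappaE hd tk).
have [tE tt] := diag_simil_entries td tk; split; [exact: tE | | exact: k0 | exact: tt].
by move=> i; move: k0; rewrite -(tt i) mulf_eq0 => /norP[ti _]; exact ti.
Qed.

Lemma diag_torus (t : J -> Qp) k : k != 0 -> (forall i, t i * t (star i) = k) ->
  torus p_pr d (diag_mx (\row_i t i)).
Proof.
move=> k0 tk; split; last exact: diag_mx_is_diag.
have [_ _ GM _] := GSO_group.
have [s [-> s1 ss]] := diag_half_decomp k0 tk.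
apply: GM; apply: sub_generated; first by right; exists k.
left; split; first exact: s1.
by rewrite -[RHS]scale1r; apply/similQP; exact: diag_simil.
Qed.

End Similitudes.

(** * Root elements, root characters and root subgroups *)

Section RootElements.
Context (F : fieldType) (d : nat).
Local Notation M := 'M[F]_(d + d).
Local Notation J := 'I_(d + d).
Implicit Types (g h : M) (r s i j : J) (u v k : F).

Definition rootmx r s u v : M := u *: delta_mx r s + v *: delta_mx (star s) (star r).

(** The adjoint exchanges the two coefficients of [rootmx], so opposite ones make this an
    isometry. *)
Definition xr r s u : M := 1 + rootmx r s u (- u).

Lemma rootmxE r s u v i j : rootmx r s u v i j =
  u * ((i == r) && (j == s))%:R + v * ((i == star s) && (j == star r))%:R.
Proof. by rewrite !mxE. Qed.

Lemma rootmxD r s u v u' v' :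
  rootmx r s (u + u') (v + v') = rootmx r s u v + rootmx r s u' v'.
Proof. by rewrite /rootmx !scalerDl addrACA. Qed.

Lemma rootmx_mul r s u v u' v' : rt r s -> rootmx r s u v * rootmx r s u' v' = 0.
Proof.
move=> /andP[sr ssr].
have D (a b c e : J) : b != c -> (delta_mx a b : M) * delta_mx c e = 0.
  by move=> bc; rewrite -[LHS]/(_ *m _) mul_delta_mx_cond (negbTE bc) mulr0n.
rewrite /rootmx mulrDl !mulrDr !mxZl !mxZr !D ?scaler0 ?addr0 //.
- by rewrite (inj_eq (@star_inj d)) eq_sym.
- exact: star_neq.
- by rewrite eq_sym star_neq.
Qed.

Lemma adj_rootmx r s u v : adj (rootmx r s u v) = rootmx r s v u.
Proof.
apply/matrixP => i j; rewrite adjE !rootmxE addrC !(inj_eq (@star_inj d)) !eq_star.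
by rewrite andbC [(i == _) && _]andbC; congr (_ + _); rewrite andbC.
Qed.

Lemma adj_xr r s u : adj (xr r s u) = xr r s (- u).
Proof. by rewrite /xr adjD adj1 adj_rootmx opprK. Qed.

Lemma xrD r s u v : rt r s -> xr r s u * xr r s v = xr r s (u + v).
Proof.
move=> rs; rewrite /xr mulrDl mul1r mulrDr mulr1 rootmx_mul // addr0.
by rewrite opprD rootmxD -addrA; congr (1 + _); rewrite addrC.
Qed.

Lemma xr0 r s : xr r s 0 = 1.
Proof. by rewrite /xr /rootmx oppr0 !scale0r !addr0. Qed.

Lemma xrX r s u n : rt r s -> xr r s u ^+ n = xr r s (u *+ n).
Proof.
move=> rs; elim: n => [|n IH]; first by rewrite expr0 mulr0n xr0.
by rewrite exprS IH xrD // mulrS.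
Qed.

Lemma xr_invmx r s u : rt r s -> xr r s u \in unitmx /\ invmx (xr r s u) = xr r s (- u).
Proof. by move=> rs; apply: invmx_uniq; rewrite xrD // subrr xr0. Qed.

Lemma xr_sub1 r s u : xr r s u - 1 = rootmx r s u (- u).
Proof. by rewrite /xr addrC addKr. Qed.

Lemma xr_rs r s u : rt r s -> xr r s u r s = u.
Proof.
move=> /andP[sr srs]; rewrite mxE rootmxE !mxE !eqxx eq_sym (negbTE sr) /= add0r mulr1.
by rewrite -eq_star eq_sym (negbTE srs) mulr0 addr0.
Qed.

Lemma xr_rsD r s u v : rt r s ->
  (xr r s u * xr r s v) r s - (xr r s u r s + xr r s v r s) = 0.
Proof. by move=> rs; rewrite xrD // !xr_rs // subrr. Qed.

Lemma xr_simil r s u : rt r s -> adj (xr r s u) * xr r s u = 1.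
Proof. by move=> rs; rewrite adj_xr xrD // addNr xr0. Qed.

Lemma simil_det g : adj g * g = 1 -> (\det g) ^+ 2 = 1.
Proof.
rewrite adj_form => /(congr1 (fun A : M => \det A)).
have fform : \det (form F d) * \det (form F d) = 1.
  by rewrite -det_mulmx -[_ *m _]/(form F d * form F d) form_form det1.
rewrite -[_ * g]/(_ *m _) -[_ * g^T * _]/(_ *m _ *m _) !det_mulmx det_tr det1.
move: fform; move: (\det (form F d)) (\det g) => f e ff h.
by rewrite -h -[LHS]mul1r -ff; ring.
Qed.

(* [xr r s u] is the square of [xr r s (u / 2)]. *)
Lemma xr_det r s u : (2%:R : F) != 0 -> rt r s -> \det (xr r s u) = 1.
Proof.
move=> two rs; have -> : u = u / 2%:R + u / 2%:R by field.
by rewrite -xrD // -[_ * _]/(_ *m _) det_mulmx -expr2 simil_det // xr_simil.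
Qed.

Lemma simil_xr g k r s : rt r s -> adj g * g = k%:M ->
  (forall i j, (g - 1) i j != 0 -> same_root i j r s) -> g = xr r s (g r s).
Proof.
move=> rs gk supp; have /andP[sr srs] := rs.
have rs' : (r == s) = false by rewrite eq_sym (negbTE sr).
pose u := (g - 1) r s; pose v := (g - 1) (star s) (star r).
have gE : g = 1 + rootmx r s u v.
  rewrite -[g in LHS](subrKC 1); congr (_ + _); apply/matrixP => i j; rewrite rootmxE.
  have [h|] := boolP ((g - 1) i j == 0); last first.
    case/supp/orP => /andP[/eqP -> /eqP ->]; rewrite !eqxx.
      by rewrite (negbTE srs) andbF mulr1 mulr0 addr0.
    by rewrite [star r == s]eq_sym (negbTE srs) andbF mulr1 mulr0 add0r.
  have -> : u * ((i == r) && (j == s))%:R = 0.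
    by case: andP => [[/eqP ir /eqP js]|_]; rewrite ?mulr0 // /u -ir -js (eqP h) mul0r.
  have -> : v * ((i == star s) && (j == star r))%:R = 0.
    by case: andP => [[/eqP ir /eqP js]|_]; rewrite ?mulr0 // /v -ir -js (eqP h) mul0r.
  by rewrite (eqP h) addr0.
(* The sum of the two coefficients is the entry at (r, s) of [adj g * g], off the diagonal of a
   scalar matrix. *)
have vu : v = - u.
  have: adj g * g = 1 + rootmx r s (u + v) (u + v).
    rewrite gE adjD adj1 adj_rootmx mulrDl mul1r mulrDr mulr1 rootmx_mul // addr0.
    by rewrite -addrA -rootmxD [v + u]addrC.
  rewrite gk => /matrixP/(_ r s); rewrite !mxE rs' !mulr0n !add0r !eqxx mulr1.
  rewrite (negbTE srs) andbF mulr0 addr0 => /esym/eqP.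
  by rewrite addrC addr_eq0 => /eqP.
by rewrite gE /xr vu; congr (1 + rootmx r s _ (- _)); rewrite -vu -gE /u !mxE rs' subr0.
Qed.

Lemma diag_conj (t : J -> F) g i j : (forall i, t i != 0) ->
  (diag_mx (\row_i t i) * g * invmx (diag_mx (\row_i t i))) i j = t i * g i j / t j.
Proof.
move=> t0.
have [|_ ->] := @invmx_uniq _ _ (diag_mx (\row_i t i) : M) (diag_mx (\row_i (t i)^-1)).
  by rewrite diag_mul; apply/matrixP => a b; rewrite !mxE mulfV.
rewrite -[LHS]/((_ *m _ *m _) i j) mul_mx_diag mxE mul_diag_mx !mxE; done.
Qed.

End RootElements.
Section RootCharacter.
Context (F : fieldType) (d : nat).
Local Notation J := 'I_(d + d).

(** Since T (star i) = k / T i, the power of k compensates for those of r and s that lie in the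
    second half. *)
Lemma rootchar_prod (T : J -> F) k (r s : J) : k != 0 -> (forall i, T i != 0) ->
  (forall i, T i * T (star i) = k) ->
  (\prod_i T (lshift d i) ^ proot r s 0 i) * k ^ ((- \sum_i proot r s 0 i) %/ 2)%Z
    = T r / T s.
Proof.
move=> k0 T0 Tk; pose chi (a : 'rV[int]_d) := \prod_i T (lshift d i) ^ a 0 i.
have chiN a : chi (- a) = (chi a)^-1.
  by rewrite /chi -prodfV; apply: eq_bigr => i _; rewrite mxE -invr_expz.
have chiB a b : chi (a - b) = chi a / chi b.
  rewrite /chi -prodf_div; apply: eq_bigr => i _.
  by rewrite !mxE expfzDr // -invr_expz.
have chie i : chi (e_ i) = T (lshift d i).
  rewrite /chi (bigD1 i) //= big1 => [|j ji]; first by rewrite mxE !eqxx mulr1.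
  by rewrite mxE (negbTE ji) andbF.
have sume (i : 'I_d) : \sum_j e_ i 0 j = 1.
  rewrite (bigD1 i) //= big1 => [|j ji]; first by rewrite mxE !eqxx addr0.
  by rewrite mxE (negbTE ji) andbF.
have Tstar i : T (rshift d i) = k / T (lshift d i).
  by rewrite -(Tk (lshift d i)) star_lshift mulrAC mulfV // mul1r.
have sumB (a b : 'rV[int]_d) : \sum_i (a - b) 0 i = \sum_i a 0 i - \sum_i b 0 i.
  by rewrite -sumrB; apply: eq_bigr => i _; rewrite !mxE.
have sumN (a : 'rV[int]_d) : \sum_i (- a) 0 i = - \sum_i a 0 i.
  by rewrite -sumrN; apply: eq_bigr => i _; rewrite !mxE.
rewrite -/(chi _) /proot sumB chiB.
case: (starP r) => -[i ->]; case: (starP s) => -[j ->]; rewrite !epsE ?chiN ?sumN !chie !sume.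
- by rewrite subrr oppr0 div0z expr0z mulr1.
- by rewrite (_ : (_ %/ 2)%Z = -1) // Tstar exprN1 invrK invf_div mulrA.
- by rewrite (_ : (_ %/ 2)%Z = 1) // Tstar expr1z mulrC mulrA.
- rewrite (_ : (_ %/ 2)%Z = 0) // !Tstar expr0z mulr1 invrK invf_div [k / _]mulrC.
  by rewrite -[RHS]mulrA [k * (_ / _)]mulrCA mulfV // mulr1.
Qed.

Lemma mulf_conj_inj (a b c x : F) : x != 0 -> a * x / b = c * x -> a / b = c.
Proof. by move=> x0; rewrite mulrAC => /(mulIf x0). Qed.

Lemma rootmx_conj (T : J -> F) k (r s i j : J) u v : k != 0 -> (forall i, T i != 0) ->
  (forall i, T i * T (star i) = k) ->
  T i * rootmx r s u v i j / T j = T r / T s * rootmx r s u v i j.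
Proof.
move=> k0 T0 Tk; rewrite rootmxE mulrDr mulrDl mulrDr; congr (_ + _).
  case: andP => [[/eqP -> /eqP ->]|_]; last by rewrite !mulr0 mul0r.
  by rewrite mulr1 mulrAC.
case: andP => [[/eqP -> /eqP ->]|_]; last by rewrite !mulr0 mul0r.
rewrite mulr1 mulrAC; congr (_ * _); apply/eqP.
by rewrite eqr_div // mulrC Tk Tk.
Qed.

End RootCharacter.

Section RootSubgroups.
Context (p : nat) (p_pr : prime p) (d : nat) (hd : (0 < d)%N).
Local Notation Qp := (padic p_pr).
Local Notation M := 'M[Qp]_(d + d).
Local Notation J := 'I_(d + d).
Implicit Types (g h : M) (r s i j : J) (u : Qp).

Lemma root_charE r s t : torus p_pr d t -> root_char (proot r s) t = t r r / t s s.
Proof.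
move=> /(torusP hd)[_ t0 k0 tk]; rewrite /root_char.
exact: (rootchar_prod (T := fun i => t i i)) k0 t0 tk.
Qed.

Definition cochar (v : J -> int) : M := diag_mx (\row_i (p%:R : Qp) ^ v i).

Lemma cocharE v i : cochar v i i = p%:R ^ v i.
Proof. by rewrite !mxE eqxx mulr1n. Qed.

Lemma cochar_torus v (e : int) : (forall i, v i + v (star i) = e) -> torus p_pr d (cochar v).
Proof.
move=> ve; apply: (@diag_torus _ _ _ _ ((p%:R : Qp) ^ e)); first exact: piX_neq0.
by move=> i; rewrite -piD ve.
Qed.

Lemma pi_inj (k l : int) : (p%:R : Qp) ^ k = p%:R ^ l -> k = l.
Proof. by move=> /(congr1 (@padic_val p p_pr)); rewrite !padic_valX. Qed.

Lemma torus_conj t g i j : torus p_pr d t ->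
  (t * g * invmx t) i j = t i i * g i j / t j j.
Proof.
move=> /(torusP hd)[tE t0 _ _]; rewrite {1 2}tE.
exact: diag_conj.
Qed.

Lemma xr_GSO r s u : rt r s -> GSO p_pr d (xr r s u).
Proof.
move=> rs; apply: sub_generated; left; split; first exact: xr_det (two_neq0 p_pr) rs.
by rewrite -[RHS]scale1r; apply/similQP; exact: xr_simil.
Qed.

Lemma root_subgroupP r s g : rt r s ->
  root_subgroup p_pr (proot r s) g <-> g = xr r s (g r s).
Proof.
move=> rs; split=> [[/GSO_simil[k k0 gk] gt]|gE].
  apply: (simil_xr rs gk) => i j gij; apply: (proot_inj rs); apply/rowP => c.
  (* Conjugation by this cocharacter multiplies the entry at (i, j) by p to the c-th coordinate of
     [proot i j]. Letting c vary identifies this root for every nonzero entry. *)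
  have ct : torus p_pr d (cochar (fun i => eps i 0 c)).
    by apply: (@cochar_torus _ 0) => a; rewrite eps_star mxE subrr.
  have := congr1 (fun A : M => A i j) (gt _ ct); rewrite torus_conj //.
  rewrite [X in _ = X -> _]mxE => /(mulf_conj_inj gij); rewrite root_charE // !cocharE.
  by rewrite !invr_expz -!piD => /pi_inj; rewrite /proot !mxE.
split=> [|t tt]; first by rewrite gE; exact: xr_GSO.
apply/matrixP => i j; rewrite torus_conj // root_charE //.
have [tE t0 k0 tk] := torusP hd tt.
rewrite gE xr_sub1 [RHS]mxE.
exact: (rootmx_conj (T := fun i => t i i)) k0 t0 tk.
Qed.

Lemma xr_root r s u : rt r s -> root_subgroup p_pr (proot r s) (xr r s u).
Proof.
by move=> rs; apply/(root_subgroupP _ rs); exact (congr1 (xr r s) (esym (xr_rs u rs))).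
Qed.

End RootSubgroups.
(** * Parahoric bounds and Iwahori subgroups *)

Section Parahoric.
Context (R : realType) (p : nat) (p_pr : prime p) (d : nat) (hd : (0 < d)%N).
Local Notation Qp := (padic p_pr).
Local Notation M := 'M[Qp]_(d + d).
Local Notation J := 'I_(d + d).
Implicit Types (g h t : M) (r s i j : J) (u : Qp) (x y : 'rV[R]_d).

(** Equivalently g does not decrease the norm that sends v to the minimum over i of val v_i + y_i.
    With the same condition on the inverse, [parahoric y] is the stabilizer of this norm. *)
Definition bounded_at y g := forall i j, val_ge (ext y j - ext y i) (g i j).

Definition parahoric y : set M :=
  [set g | [/\ g \in unitmx, bounded_at y g & bounded_at y (invmx g)]].

Lemma bounded_at1 y : bounded_at y 1.
Proof.
move=> i j; rewrite mxE; case: eqP => [->|_]; last exact: val_ge0.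
by rewrite subrr; exact: val_ge_1.
Qed.

Lemma bounded_atM y g h : bounded_at y g -> bounded_at y h -> bounded_at y (g * h).
Proof.
move=> yg yh i j; rewrite mxMl; apply: val_ge_sum => k _.
by apply: val_ge_le (val_geM (yg i k) (yh k j)); lra.
Qed.

Lemma parahoric_group y : is_subgroup (parahoric y).
Proof.
split.
- by move=> g [].
- split; [exact: unitmx1 | exact: bounded_at1 |].
  by rewrite invmx1; exact: bounded_at1.
- move=> g h [gu yg ygV] [hu yh yhV]; split; last 2 first.
  + exact (bounded_atM yg yh).
  + rewrite (invmx_mul gu hu); exact (bounded_atM yhV ygV).
  + by rewrite -[g * h]/(g *m h) unitmx_mul gu.
- by move=> g [gu yg ygV]; split; rewrite ?unitmx_inv ?invmxK; [exact gu | exact ygV | exact yg].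
Qed.

Lemma torus_exp t n i : torus p_pr d t -> (t ^+ n) i i = t i i ^+ n.
Proof.
move=> /(torusP hd)[tE _ _ _]; elim: n => [|n IH]; first by rewrite !expr0 mxE eqxx.
rewrite !exprS -IH {1}tE -[diag_mx _ * _]/(_ *m _) mul_diag_mx mxE.
by congr (_ * _); rewrite mxE.
Qed.

(** The powers of t stay in a bounded group, so [vg0_of_powers] applies to each diagonal entry. *)
Lemma bounded_torus y H t : bounded_subgroup H -> H `<=` torus p_pr d -> H t -> bounded_at y t.
Proof.
move=> [[_ H1 HM _] [c c0 cH]] HT Ht i j.
have [<-|ij] := eqVneq i j; last first.
  by have [_ /is_diag_mxP ->] := HT _ Ht; [exact: val_ge0 | exact: ij].
rewrite subrr; apply/val_geP; exists 0; split; first exact: lexx.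
have c0' : c^-1 != 0 by rewrite invr_eq0; exact c0.
apply: (@vg0_of_powers _ _ (padic_val c^-1)) => n; rewrite -torus_exp; last exact: HT.
have Hn : H (t ^+ n) by elim: n => [|n IH]; rewrite ?exprS ?expr0 //; apply: HM.
have /integralE cn := cH _ Hn i i.
by have := vgM (val_vg c0') cn; rewrite addr0 (mulKf c0) => h; exact h.
Qed.

Lemma torus0_parahoric y : torus0 p_pr d `<=` parahoric y.
Proof.
move=> t [H [bH HT] Ht]; have [[Hu _ _ HV] _] := bH.
by split; [exact: Hu | exact: bounded_torus Ht | exact: (bounded_torus _ bH HT (HV _ Ht))].
Qed.

Lemma bounded_xr y r s u : rt r s -> bounded_at y (xr r s u) <-> val_ge (ext y s - ext y r) u.
Proof.
move=> rs; split=> [/(_ r s)|yu i j]; first by rewrite xr_rs.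
rewrite /xr mxE; apply: val_geD; first exact: bounded_at1.
rewrite rootmxE; apply: val_geD.
  by case: andP => [[/eqP -> /eqP ->]|_]; rewrite ?mulr1 ?mulr0 //; exact: val_ge0.
case: andP => [[/eqP -> /eqP ->]|_]; last by rewrite mulr0; exact: val_ge0.
by rewrite mulr1 !ext_star opprK addrC; exact: val_geN.
Qed.

Lemma parahoric_xr y r s u : rt r s -> parahoric y (xr r s u) <-> val_ge (ext y s - ext y r) u.
Proof.
move=> rs; split=> [[_ /(bounded_xr _ _ rs)]|yu] //.
have [xu xV] := xr_invmx u rs; split=> //; first exact/bounded_xr.
by rewrite xV; apply/bounded_xr => //; exact: val_geN.
Qed.

Lemma facet_refl x : facet x x.
Proof. by []. Qed.

Lemma facet_le x y (a : 'rV[int]_d) (k : int) : facet x y -> Phi a ->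
  (root_eval a y <= k%:~R) = (root_eval a x <= k%:~R).
Proof.
by move=> xy Pa; rewrite -subr_le0 -[RHS]subr_le0 -sgr_le0 xy // sgr_le0.
Qed.

Lemma facet_lt x y (a : 'rV[int]_d) (k : int) : facet x y -> Phi a ->
  (root_eval a y < k%:~R) = (root_eval a x < k%:~R).
Proof.
by move=> xy Pa; rewrite -subr_lt0 -[RHS]subr_lt0 -sgr_lt0 xy // sgr_lt0.
Qed.

(** The strict inequality for the opposite root is the reversed one, and the two together determine
    the sign. *)
Lemma facetP x y : facet x y <-> forall r s (k : int), rt r s ->
  (ext y r - ext y s < k%:~R) = (ext x r - ext x s < k%:~R).
Proof.
split=> [xy r s k rs|h a k /PhiP[r [s [rs ->]]]].
  by rewrite -!root_evalE; apply: facet_lt => //; exact: proot_Phi.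
rewrite !root_evalE; have h1 := h r s k rs; have := h s r (- k) (etrans (rt_sym s r) rs).
rewrite mulrNz -(opprB (ext y r)) -(opprB (ext x r)) !ltrN2 => h2.
move: (ext y r - ext y s) (ext x r - ext x s) k%:~R h1 h2 => A B c.
case: (ltrgtP A c) => hA; case: (ltrgtP B c) => hB // _ _.
- by rewrite !ltr0_sg ?subr_lt0.
- by rewrite !gtr0_sg ?subr_gt0.
- by rewrite hA hB.
Qed.

Lemma facet_eq x y : facet x y -> facet x = facet y.
Proof.
by move=> xy; apply/seteqP; split=> z xz a k Pa; rewrite xz // xy.
Qed.

Lemma root_fixerE y r s g : rt r s ->
  root_fixer (proot r s) (facet y) g <->
  exists2 u, val_ge (ext y s - ext y r) u & g = xr r s u.
Proof.
move=> rs; split=> [[/(root_subgroupP hd _ rs) gE gy]|[u yu ->]].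
  exists (g r s) => //; have := gy y (facet_refl y) r s; rewrite root_evalE opprB.
  rewrite !mxE (_ : (r == s) = false) ?mulr0n ?subr0 //.
  by move: rs => /andP[/negbTE]; rewrite eq_sym.
split; first exact: xr_root.
move=> x yx i j; rewrite xr_sub1 rootmxE root_evalE opprB.
have xu : val_ge (ext x s - ext x r) u.
  (* Valuations are integers, and the integers satisfying the bound are the same at all points of
     the facet. *)
  apply: val_ge_eq yu => k; have := facet_le (- k) yx (proot_Phi (etrans (rt_sym s r) rs)).
  move: (facet_lt (k+1) yx (proot_Phi (etrans (rt_sym s r) rs))).
  by move: (facet_le k yx (proot_Phi (etrans (rt_sym s r) rs))); rewrite !root_evalE => ->.
apply: val_geD; case: andP => _; rewrite ?mulr1 ?mulr0; do ?[exact: val_ge0 | exact: xu].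
exact: val_geN.
Qed.

Lemma Iwahori_parahoric y : Iwahori p_pr (facet y) `<=` parahoric y.
Proof.
apply: generated_sub; first exact: parahoric_group.
move=> g [/torus0_parahoric //|[a /PhiP[r [s [rs ->]]] /(root_fixerE _ _ rs)[u yu ->]]].
exact/parahoric_xr.
Qed.

Lemma Iwahori_group y : is_subgroup (Iwahori p_pr (facet y)).
Proof.
apply: (generated_group (parahoric_group y)) => g gS.
by apply: Iwahori_parahoric; exact: sub_generated.
Qed.

Lemma xr_Iwahori y r s u : rt r s ->
  Iwahori p_pr (facet y) (xr r s u) <-> val_ge (ext y s - ext y r) u.
Proof.
move=> rs; split=> [/Iwahori_parahoric /(parahoric_xr _ _ rs)//|yu].
apply: sub_generated; right; exists (proot r s); first exact: proot_Phi.
by apply/root_fixerE => //; exists u.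
Qed.

Lemma Iwahori_rootE y r s g : rt r s ->
  (Iwahori p_pr (facet y) `&` root_subgroup p_pr (proot r s)) g <->
  exists2 u, val_ge (ext y s - ext y r) u & g = xr r s u.
Proof.
move=> rs; split=> [[gI /(root_subgroupP hd _ rs) gE]|[u yu ->]].
  by exists (g r s) => //; apply/xr_Iwahori => //; rewrite -gE.
by split; [exact/xr_Iwahori | exact: xr_root].
Qed.

End Parahoric.

(** * Subgroups of index p detected by one coordinate *)

Section Index.
Context (p : nat) (p_pr : prime p) (n : nat).
Local Notation Qp := (padic p_pr).
Local Notation M := 'M[Qp]_n.
Local Notation pi := (p%:R : Qp).
Implicit Types (H K : set M) (g h : M).

Lemma subgroup_exp H g (i : nat) : is_subgroup H -> H g -> H (g ^+ i).
Proof.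
by move=> [_ H1 HM _] Hg; elim: i => [|i IH]; rewrite ?expr0 ?exprS //; exact: HM.
Qed.

(* [c] induces an injective homomorphism from [H / K] to [p^k Z_p / p^(k+1) Z_p],
   which is onto because its image contains the class of [p^k]. *)
Lemma has_index_coord H K (c : M -> Qp) (k : int) : is_subgroup H -> is_subgroup K ->
  (forall g h, H g -> H h -> vg (k + 1) (c (g * h) - (c g + c h))) ->
  (forall g, H g -> vg k (c g)) ->
  (forall g, K g <-> H g /\ vg (k + 1) (c g)) ->
  (exists2 e, H e & vg (k + 1) (c e - pi ^ k)) ->
  has_index H K p.
Proof.
move=> gH gK cM cH KE [e He ce]; have [Hu H1 HM HV] := gH; have [Ku K1 KM KV] := gK.
pose cg x y := vg (k + 1) (x - y : Qp).
have cg_trans x y z : cg x y -> cg y z -> cg x z.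
  by move=> xy yz; rewrite /cg -(subrKA y); exact: vgD.
have cg_sym x y : cg x y -> cg y x by move=> xy; rewrite /cg -opprB; exact: vgN.
have cg_add x y z t : cg x y -> cg z t -> cg (x + z) (y + t).
  by move=> xy zt; rewrite /cg opprD addrACA; exact: vgD.
have cg_refl x : cg x x by rewrite /cg subrr; exact: vg0.
have c1 : cg (c 1) 0.
  apply: cg_sym; have := cM _ _ H1 H1.
  by rewrite mulr1 opprD addrA subrr.
have He' i : H (e ^+ i) by exact: subgroup_exp.
have cE i : cg (c (e ^+ i)) (i%:R * pi ^ k).
  elim: i => [|i IH]; first by rewrite expr0 mul0r.
  rewrite exprS; apply: cg_trans (cM _ _ He (He' i)) _.
  by rewrite -addn1 natrD mulrDl mul1r [i%:R * _ + _]addrC; exact: cg_add.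
split=> //; first by move=> g /KE[].
pose f i := [set e ^+ i * h | h in K].
suff [-> finj] : [set [set h * k | k in K] | h in H] = f @` `I_p /\ {in `I_p &, injective f}.
  exact: inj_card_eq.
split.
  apply/seteqP; split=> X.
    (* The coset of g is that of e^i, where i is the digit of [c g] at p^k. *)
    move=> [g Hg <-]; have [i [ip gi]] := vg_residue (cH _ Hg).
    exists i => //; pose h := invmx (e ^+ i) * g.
    have Hh : H h by apply: HM => //; exact: HV.
    have Ei := Hu _ (He' i).
    have eh : e ^+ i * h = g.
      by rewrite /h mulrA -[e ^+ i * _]/(_ *m _) (mulmxV Ei); exact: mul1r.
    have Kh : K h.
      apply/KE; split=> //; have := cM _ _ (He' i) Hh; rewrite eh => ceh.
      have := cg_trans _ _ _ (cg_sym _ _ ceh) (cg_trans _ _ _ gi (cg_sym _ _ (cE i))).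
      by rewrite /cg addrAC subrr add0r.
    apply/seteqP; split=> _ [k' Kk <-].
      exists (invmx h * k'); first by apply: KM => //; exact: KV.
      by rewrite -eh -mulrA; congr (_ * _); exact: (mulKVmx (Ku _ Kh)).
    exists (h * k'); first exact: KM.
    by rewrite mulrA eh.
  by move=> [i ip <-]; exists (e ^+ i).
move=> i j; rewrite !inE => ip jp fij.
have [k' Kk ek] : f j (e ^+ i) by rewrite -fij; exists 1 => //; exact: mulr1.
have [Hk ck] := (KE k').1 Kk; apply: (@vg_succ_nat _ _ k _ _ ip jp).
have cij : cg (c (e ^+ i)) (c (e ^+ j)).
  rewrite -ek; apply: cg_trans (cM _ _ (He' j) Hk) _.
  by rewrite /cg addrAC subrr add0r.
rewrite mulrBl; exact: cg_trans (cg_sym _ _ (cE i)) (cg_trans _ _ _ cij (cE j)).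
Qed.

End Index.
(** * The unipotent radical *)

Lemma big_uniq_pred1 (V : Type) (idx : V) (op : Monoid.law idx) (I : eqType)
    (r : seq I) (i : I) (f : I -> V) : uniq r -> i \in r ->
  \big[op/idx]_(j <- r | j == i) f j = f i.
Proof.
elim: r => //= a r IH /andP[ar ur]; rewrite inE big_cons.
have [<- _|_] := eqVneq a i; last exact: IH.
rewrite big_seq_cond big1 ?Monoid.mulm1 // => j /andP[jr /eqP ja].
by rewrite -ja jr in ar.
Qed.

Lemma self_opp0 (F : fieldType) (a : F) : a = - a -> (2%:R : F) != 0 -> a = 0.
Proof.
move=> e two; have: 2%:R * a = 0 by rewrite mulr_natl mulr2n {1}e addNr.
by move/eqP; rewrite mulf_eq0 (negbTE two) => /eqP.
Qed.

Section ElementaryProducts.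
Context (F : fieldType) (d : nat).
Implicit Types (q : 'I_d * 'I_d).

(* With columns in decreasing order every product of two successive elementary
   matrices [E_ij E_kl] vanishes. *)
Definition pos_pairs : seq ('I_d * 'I_d) :=
  sort (fun q q' => (q'.2 <= q.2)%N) (enum [pred q : 'I_d * 'I_d | (q.1 < q.2)%N]).

Lemma mem_pos_pairs q : (q \in pos_pairs) = (q.1 < q.2)%N.
Proof. by rewrite mem_sort mem_enum. Qed.

Lemma pos_pairs_uniq : uniq pos_pairs.
Proof. by rewrite sort_uniq enum_uniq. Qed.

Lemma pos_pairs_pairwise : pairwise (fun q q' => q.2 != q'.1) pos_pairs.
Proof.
have tot : total (fun q q' : 'I_d * 'I_d => (q'.2 <= q.2)%N) by move=> q q'; exact: leq_total.
have tr : transitive (fun q q' : 'I_d * 'I_d => (q'.2 <= q.2)%N).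
  by move=> a b c /= ba ac; exact: leq_trans ac ba.
have: pairwise (fun q q' : 'I_d * 'I_d => (q'.2 <= q.2)%N) pos_pairs.
  by rewrite -(sorted_pairwise tr) sort_sorted.
apply: sub_in_pairwise (allss pos_pairs) => a b; rewrite -!topredE /= !mem_pos_pairs => _ b12 ba.
by apply: contraTneq b12 => <-; rewrite -leqNgt.
Qed.

Lemma elementary_prod (s : seq ('I_d * 'I_d)) (a : 'I_d * 'I_d -> F) :
  pairwise (fun q q' => q.2 != q'.1) s ->
  \prod_(q <- s) (1 + a q *: delta_mx q.1 q.2) =
    1 + \sum_(q <- s) a q *: delta_mx q.1 q.2 :> 'M[F]_d.
Proof.
elim: s => [|q s IH] /=; first by rewrite !big_nil addr0.
move=> /andP[/allP qs /IH e]; rewrite !big_cons e mulrDl mul1r mulrDr mulr1 mulr_sumr.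
rewrite [X in _ + (_ + X)]big1_seq ?addr0 => [|t /andP[_ ts]].
  by rewrite -addrA [X in _ + X]addrC.
by rewrite mxZl mxZr -[delta_mx _ _ * _]/(_ *m _) mul_delta_mx_cond (negbTE (qs _ ts)) mulr0n !scaler0.
Qed.

Lemma sum_pos_pairs (a : 'M[F]_d) : (forall i, a i i = 1) ->
  (forall i j : 'I_d, (j < i)%N -> a i j = 0) ->
  1 + \sum_(q <- pos_pairs) a q.1 q.2 *: delta_mx q.1 q.2 = a.
Proof.
move=> a1 a0; apply/matrixP => i j; rewrite mxE summxE.
have E (q : 'I_d * 'I_d) : (a q.1 q.2 *: delta_mx q.1 q.2) i j = if q == (i, j) then a i j else 0.
  rewrite !mxE -xpair_eqE -surjective_pairing eq_sym; case: eqP => [->|_]; first by rewrite mulr1.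
  by rewrite mulr0.
under eq_bigr do rewrite E; rewrite -big_mkcond /=.
have [ij|ji] := ltnP i j.
  rewrite big_uniq_pred1 ?pos_pairs_uniq ?mem_pos_pairs //.
  by rewrite mxE -val_eqE /= ltn_eqF // add0r.
rewrite big_seq_cond big1 => [|q /andP[]]; last first.
  by rewrite mem_pos_pairs => qlt /eqP qE; move: qlt; rewrite qE /= ltnNge ji.
rewrite mxE addr0; have [->|] := eqVneq i j; first by rewrite a1.
by rewrite -val_eqE => ij; rewrite a0 // ltn_neqAle ji eq_sym ij.
Qed.

Lemma sum_pos_pairs_skew (w : 'M[F]_d) : (2%:R : F) != 0 -> w^T = - w ->
  \sum_(q <- pos_pairs) w q.1 q.2 *: (delta_mx q.1 q.2 - delta_mx q.2 q.1) = w.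
Proof.
(* w is the strict upper triangle minus its transpose, its diagonal being 0 as 2 is nonzero. The
   ones on the diagonal of [a] only fit [sum_pos_pairs] and are subtracted again. *)
move=> two wT; pose a : 'M[F]_d := \matrix_(i, j) if (i < j)%N then w i j else (i == j)%:R.
have wji i j : w j i = - w i j by move/matrixP/(_ i j): wT; rewrite !mxE.
have := @sum_pos_pairs a; set S := (X in _ + X).
have -> : S = \sum_(q <- pos_pairs) w q.1 q.2 *: delta_mx q.1 q.2.
  rewrite /S big_seq [RHS]big_seq; apply: eq_bigr => q; rewrite mem_pos_pairs mxE => -> //.
move=> /(_ _ _)/(canRL (addKr _)) e.
transitivity ((a - 1) - (a - 1)^T).
  rewrite [a - 1]addrC -e => [|i|i j ji].
  - rewrite raddf_sum -sumrB /=; apply: eq_bigr => q _.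
    by rewrite linearZ /= trmx_delta scalerBr.
  - by rewrite mxE ltnn eqxx.
  - by rewrite mxE ltnNge ltnW //= -val_eqE /= gtn_eqF.
apply/matrixP => i j; rewrite !mxE [j == i]eq_sym.
case: (ltngtP i j) => [ij|ji|/val_inj ->].
- by rewrite -val_eqE /= ltn_eqF // !subr0.
- by rewrite -val_eqE /= gtn_eqF // !subr0 sub0r -wji.
by rewrite eqxx !subrr (self_opp0 (wji j j)).
Qed.

End ElementaryProducts.

(** * Upper unipotent isometries and their parameters *)

Section UpperUnipotent.
Context (F : fieldType) (d : nat).
Local Notation M := 'M[F]_(d + d).
Local Notation J := 'I_(d + d).
Implicit Types (g h : M) (r s : J) (i j : 'I_d).

(* The isotropic flag fixed by the positive root subgroups adds the basis
   vectors in the order 1, ..., d, 2d, ..., d+1. *)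
Definition flag_pos r : nat := if (r < d)%N then r : nat else (d + d + d - r.+1)%N.

Lemma flag_lshift i : flag_pos (lshift d i) = i.
Proof. by rewrite /flag_pos /= ltn_ord. Qed.

Lemma flag_rshift i : flag_pos (rshift d i) = (d + d - i.+1)%N.
Proof. by rewrite /flag_pos /= ltnNge leq_addr /=; have := ltn_ord i; lia. Qed.

Lemma flag_star r : flag_pos (star r) = (d + d - (flag_pos r).+1)%N.
Proof.
by case: (starP r) => -[i ->]; rewrite epsE ?flag_lshift ?flag_rshift //; have := ltn_ord i; lia.
Qed.

Lemma flag_ltn r : (flag_pos r < d + d)%N.
Proof. by case: (starP r) => -[i ->]; rewrite ?flag_lshift ?flag_rshift; have := ltn_ord i; lia. Qed.

(** The unipotent radical of the Borel subgroup fixing the flag, by equations; [unipotentE]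
    identifies it with the product of the positive root subgroups. *)
Definition uni : set M := [set g | [/\ adj g * g = 1, forall r, g r r = 1 &
  forall r s, (flag_pos s < flag_pos r)%N -> g r s = 0]].

Lemma uni1 : uni 1.
Proof.
split=> [|r|r s sr]; first by rewrite adj1 mulr1.
  by rewrite mxE eqxx.
by rewrite mxE; case: eqP sr => [->|//]; rewrite ltnn.
Qed.

Lemma flag_inj : injective flag_pos.
Proof.
move=> r s; case: (starP r) => -[i ->]; case: (starP s) => -[j ->];
  rewrite ?flag_lshift ?flag_rshift; have := ltn_ord i; have := ltn_ord j => *.
- by congr lshift; apply/val_inj.
- by exfalso; lia.
- by exfalso; lia.
- by congr rshift; apply/val_inj => /=; lia.
Qed.

Lemma uniM g h : uni g -> uni h -> uni (g * h).
Proof.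
move=> [gg g1 g0] [hh h1 h0]; split.
- by rewrite (simil_mul gg hh) mulr1.
- move=> r; rewrite mxMl (bigD1 r) //= g1 h1 mul1r big1 ?addr0 // => k kr.
  have [rk|kr'] := leqP (flag_pos r) (flag_pos k); last by rewrite g0 ?mul0r.
  by rewrite h0 ?mulr0 // ltn_neqAle rk andbT (inj_eq flag_inj) eq_sym.
- move=> r s sr; rewrite mxMl big1 // => k _.
  have [rk|kr'] := leqP (flag_pos r) (flag_pos k); last by rewrite g0 ?mul0r.
  by rewrite h0 ?mulr0 // (leq_trans sr).
Qed.

Lemma uni_invmx g : uni g -> g \in unitmx /\ invmx g = adj g.
Proof.
by case=> gg _ _; have [gu gi _] := simil_inv (oner_neq0 _) gg; rewrite gi invr1 scale1r.
Qed.

Lemma uniV g : uni g -> uni (invmx g).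
Proof.
move=> ug; have [gu ->] := uni_invmx ug; case: ug => gg g1 g0; split.
- by rewrite adjK; have [_ _] := simil_inv (oner_neq0 _) gg.
- by move=> r; rewrite adjE g1.
- move=> r s sr; rewrite adjE g0 // !flag_star.
  by have := flag_ltn r; have := flag_ltn s; lia.
Qed.

Lemma uni_xr i j c u : (i < j)%N -> uni (xr (lshift d i) (rt_sign c j) u).
Proof.
move=> ij; have rs : rt (lshift d i) (rt_sign c j) by apply: rt_signP; rewrite -val_eqE /= ltn_eqF.
have lt : (flag_pos (lshift d i) < flag_pos (rt_sign c j))%N.
  by rewrite flag_lshift /rt_sign; case: c {rs}; rewrite ?flag_lshift ?flag_rshift //; have := ltn_ord j; lia.
have lt' : (flag_pos (star (rt_sign c j)) < flag_pos (star (lshift d i)))%N.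
  by rewrite !flag_star; have := flag_ltn (rt_sign c j); have := flag_ltn (lshift d i); lia.
have E r s : (flag_pos s <= flag_pos r)%N -> xr (lshift d i) (rt_sign c j) u r s = (r == s)%:R.
  move=> sr; rewrite /xr mxE rootmxE [in LHS]mxE.
  have -> : ((r == lshift d i) && (s == rt_sign c j)) = false.
    by apply: contraTF sr => /andP[/eqP -> /eqP ->]; rewrite -ltnNge.
  have -> : ((r == star (rt_sign c j)) && (s == star (lshift d i))) = false.
    by apply: contraTF sr => /andP[/eqP -> /eqP ->]; rewrite -ltnNge.
  by rewrite !mulr0 !addr0.
split; first exact: xr_simil.
  by move=> r; rewrite E ?eqxx.
move=> r s sr; rewrite E; last exact: ltnW.
by have [e|] := eqVneq r s; first by rewrite e ltnn in sr.
Qed.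

(* A unipotent [g] is [block_mx A (A W) 0 (A^T)^-1] with [A] upper unitriangular
   and [W] skew. *)
Definition skew_part g : 'M[F]_d := (drsubmx g)^T *m ursubmx g.

(** The parameters of the two factors in [uni_decomp]: one in the Levi subgroup GL_d, the other in
    the abelian Siegel radical. *)
Definition coord (c : bool) i j g : F :=
  if c then g (lshift d i) (lshift d j) else skew_part g i j.

Lemma adj_block (A B C D : 'M[F]_d) : adj (block_mx A B C D) = block_mx D^T B^T C^T A^T.
Proof.
apply/matrixP => r s; rewrite adjE.
by case: (starP r) => -[i ->]; case: (starP s) => -[j ->]; rewrite !epsE
  ?block_mxEul ?block_mxEur ?block_mxEdl ?block_mxEdr !mxE.
Qed.

Lemma block_mul (A B C D A' B' C' D' : 'M[F]_d) :
  block_mx A B C D * block_mx A' B' C' D' =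
  block_mx (A *m A' + B *m C') (A *m B' + B *m D') (C *m A' + D *m C') (C *m B' + D *m D').
Proof. exact: mulmx_block. Qed.

Lemma uni_blocks g : uni g ->
  let A := ulsubmx g in let D := drsubmx g in let W := skew_part g in
  [/\ g = block_mx A (A *m W) 0 D, D^T *m A = 1%:M, W^T = - W,
      forall i, A i i = 1 & forall i j : 'I_d, (j < i)%N -> A i j = 0].
Proof.
move=> [gg g1 g0] A D W; set B := ursubmx g.
have gE : g = block_mx A B 0 D.
  rewrite -[LHS]submxK; congr block_mx; apply/matrixP => i j; rewrite !mxE g0 //.
  by rewrite flag_lshift flag_rshift; have := ltn_ord i; have := ltn_ord j; lia.
move: (gg); rewrite gE adj_block block_mul !mulmx0 !trmx0 !mul0mx !addr0 !add0r.
rewrite -[1]/(1%:M) scalar_mx_block => /eq_block_mx[DA DB _ AD].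
have AD' : A *m D^T = 1%:M by exact: mulmx1C.
split=> //.
- by rewrite /W /skew_part mulmxA AD' mul1mx -/B.
- by rewrite /W /skew_part trmx_mul trmxK; apply/eqP; rewrite -addr_eq0 addrC; apply/eqP.
- by move=> i; rewrite /A !mxE g1.
- by move=> i j ji; rewrite /A !mxE g0 // !flag_lshift.
Qed.

Lemma xr_ll i j (u : F) : xr (lshift d i) (lshift d j) u =
  block_mx (1 + u *: delta_mx i j) 0 0 (1 - u *: delta_mx j i).
Proof.
apply/matrixP => r s; rewrite /xr mxE rootmxE !epsE.
by case: (starP r) => -[a ->]; case: (starP s) => -[b ->]; rewrite
  ?block_mxEul ?block_mxEur ?block_mxEdl ?block_mxEdr !mxE ?eq_lshift ?eq_rshift
  ?eq_lrshift ?eq_rlshift /= ?andbF ?mulr0 ?addr0 ?add0r ?mulNr.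
Qed.

Lemma xr_lr i j (u : F) : xr (lshift d i) (rshift d j) u =
  block_mx 1 (u *: (delta_mx i j - delta_mx j i)) 0 1.
Proof.
apply/matrixP => r s; rewrite /xr mxE rootmxE !epsE.
by case: (starP r) => -[a ->]; case: (starP s) => -[b ->]; rewrite
  ?block_mxEul ?block_mxEur ?block_mxEdl ?block_mxEdr !mxE ?eq_lshift ?eq_rshift
  ?eq_lrshift ?eq_rlshift /= ?andbF ?mulr0 ?addr0 ?add0r ?mulNr ?mulrBr.
Qed.

Lemma prod_block_diag (I : eqType) (s : seq I) (A D : I -> 'M[F]_d) :
  \prod_(q <- s) (block_mx (A q) 0 0 (D q) : M) =
  block_mx (\prod_(q <- s) A q) 0 0 (\prod_(q <- s) D q).
Proof.
elim: s => [|q s IH]; first by rewrite !big_nil -[1]/(1%:M) scalar_mx_block.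
by rewrite !big_cons IH block_mul !mulmx0 !mul0mx !addr0 !add0r.
Qed.

Lemma prod_block_add (I : eqType) (s : seq I) (W : I -> 'M[F]_d) :
  \prod_(q <- s) (block_mx 1 (W q) 0 1 : M) = block_mx 1 (\sum_(q <- s) W q) 0 1.
Proof.
elim: s => [|q s IH]; first by rewrite !big_nil -[1]/(1%:M) scalar_mx_block.
rewrite !big_cons IH block_mul -![1]/(1%:M) !mulmx0 !mul0mx !mul1mx !mulmx1 !addr0 !add0r.
by rewrite addrC.
Qed.

Lemma uni_decomp g : (2%:R : F) != 0 -> uni g ->
  g = (\prod_(q <- pos_pairs d) xr (lshift d q.1) (rt_sign true q.2) (coord true q.1 q.2 g)) *
      (\prod_(q <- pos_pairs d) xr (lshift d q.1) (rt_sign false q.2) (coord false q.1 q.2 g)).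
Proof.
move=> two ug; have [] := uni_blocks ug; set A := ulsubmx g; set D := drsubmx g.
move=> gE DA Wskew A1 A0; rewrite /rt_sign.
under [X in _ * X]eq_bigr do rewrite xr_lr.
rewrite prod_block_add /coord sum_pos_pairs_skew //.
set P := \prod_(q <- _) _.
have uP : uni P.
  rewrite /P big_seq; elim/big_ind: _ => [||q]; [exact: uni1 | exact: uniM |].
  by rewrite mem_pos_pairs => ij; exact: (uni_xr true).
(* Only the upper block of [P] is computed. The lower one is then forced to be D, both being the
   inverse transpose of A. *)
have [D' PE] : exists D', P = block_mx A 0 0 D'.
  rewrite /P; under eq_bigr do rewrite xr_ll.
  rewrite prod_block_diag elementary_prod ?pos_pairs_pairwise //.
  eexists; congr block_mx.
  rewrite -[RHS](sum_pos_pairs A1 A0); congr (_ + _).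
  by apply: eq_bigr => q _; congr (_ *: _); rewrite /A !mxE.
have D'A : D'^T *m A = 1%:M.
  by have [_] := uni_blocks uP; rewrite PE block_mxKul block_mxKdr.
have -> : P = block_mx A 0 0 D.
  rewrite PE; congr block_mx; apply/trmx_inj.
  by rewrite -[LHS]mulmx1 -(mulmx1C DA) mulmxA D'A mul1mx.
by rewrite block_mul -[1]/(1%:M) !mulmx0 !mul0mx !mulmx1 !addr0 ?add0r.
Qed.

End UpperUnipotent.
Section Unipotent.
Context (R : realType) (p : nat) (p_pr : prime p) (d : nat) (hd : (0 < d)%N).
Local Notation Qp := (padic p_pr).
Local Notation M := 'M[Qp]_(d + d).
Local Notation J := 'I_(d + d).
Implicit Types (g h : M) (r s : J) (i j : 'I_d) (c : bool) (u : Qp) (x y : 'rV[R]_d).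

Lemma Phi_pos_or_opp (a : 'rV[int]_d) : Phi a -> Phi_pos a \/ Phi_pos (- a).
Proof.
have H i j (b c : bool) : (i < j)%N -> Phi_pos ((-1) ^+ b *: e_ i + (-1) ^+ c *: e_ j) \/
    Phi_pos (- ((-1) ^+ b *: e_ i + (-1) ^+ c *: e_ j)).
  move=> ij; case: b; [right | left].
    by exists i, j, (~~ c); split=> //; rewrite opprD scaleN1r opprK; case: c; rewrite ?scaleN1r ?scale1r ?opprK.
  by exists i, j, c; rewrite scale1r.
move=> [i [j [b [c [ij ->]]]]]; case: (ltngtP i j) => [|ji|/val_inj e]; first exact: H.
  by rewrite addrC; exact: H.
by rewrite e eqxx in ij.
Qed.

Lemma rt_pos i j c : (i < j)%N -> rt (lshift d i) (rt_sign c j).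
Proof. by move=> ij; apply: rt_signP; rewrite -val_eqE /= ltn_eqF. Qed.

Lemma uni_group : is_subgroup (@uni Qp d).
Proof.
split; [by move=> g /uni_invmx[] | exact: uni1 | exact: uniM | exact: uniV].
Qed.

(** In an entry of W = D^T B the coordinates of y at the summation index cancel between the bounds
    of the two factors. *)
Lemma coord_bounded y g i j c : uni g -> bounded_at y g ->
  val_ge (ext y (rt_sign c j) - ext y (lshift d i)) (coord c i j g).
Proof.
move=> ug yg; rewrite /coord /rt_sign; case: c; first exact: yg.
rewrite /skew_part mxE; apply: val_ge_sum => k _; rewrite !mxE.
apply: val_ge_le (val_geM (yg (rshift d k) (rshift d i)) (yg (lshift d k) (rshift d j))).
by rewrite -!star_lshift !ext_star; lra.
Qed.

Lemma uni_coords (S : set M) g : is_subgroup S -> uni g ->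
  (forall c i j, (i < j)%N -> S (xr (lshift d i) (rt_sign c j) (coord c i j g))) -> S g.
Proof.
move=> gS ug Sg; rewrite (uni_decomp (two_neq0 p_pr) ug); case: (gS) => _ _ SM _.
by apply: SM; apply: prod_group => // q; rewrite mem_pos_pairs => ij _; exact: Sg.
Qed.

(** Necessity comes from the bounds on matrix entries, sufficiency from the factorization into root
    elements, each of which is a generator. *)
Lemma Iwahori_uniE y g : uni g -> Iwahori p_pr (facet y) g <->
  forall c i j, (i < j)%N -> val_ge (ext y (rt_sign c j) - ext y (lshift d i)) (coord c i j g).
Proof.
move=> ug; split=> [/(Iwahori_parahoric hd)[_ yg _] c i j _|yg]; first exact: coord_bounded.
apply: uni_coords => //; first exact: Iwahori_group.
by move=> c i j ij; apply/xr_Iwahori => //; [exact: rt_pos | exact: yg].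
Qed.

Definition pos_root (t : bool * ('I_d * 'I_d)) := proot (lshift d t.2.1) (rt_sign t.1 t.2.2).

Lemma pos_root_inj (t t' : bool * ('I_d * 'I_d)) : (t.2.1 < t.2.2)%N -> (t'.2.1 < t'.2.2)%N ->
  pos_root t = pos_root t' -> t = t'.
Proof.
case: t t' => [c [i j]] [c' [i' j']] /= ij ij' /(proot_inj (rt_pos _ ij')).
case/orP => /andP[/eqP h1 /eqP h2].
  move: h1 h2 => /= /lshift_inj ->; rewrite /rt_sign; case: c; case: c' => h.
  - by rewrite (lshift_inj h).
  - by move/eqP: h; rewrite eq_lrshift.
  - by move/eqP: h; rewrite eq_rlshift.
  - by rewrite (rshift_inj h).
exfalso; move: h1 h2 => /=; rewrite /rt_sign star_lshift.
case: c'; rewrite epsE; first by move/eqP; rewrite eq_lrshift.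
move=> /lshift_inj ij''; case: c; first by move/eqP; rewrite eq_lrshift.
by move=> /rshift_inj ji'; move: ij ij'; rewrite ij'' ji' => /ltnW; rewrite leqNgt => /negbTE ->.
Qed.

Definition pos_index : seq (bool * ('I_d * 'I_d)) :=
  [seq (true, q) | q <- pos_pairs d] ++ [seq (false, q) | q <- pos_pairs d].

Lemma mem_pos_index (t : bool * ('I_d * 'I_d)) : (t \in pos_index) = (t.2.1 < t.2.2)%N.
Proof.
case: t => c q; rewrite mem_cat -mem_pos_pairs; case: c.
  rewrite mem_map => [|? ? []//]; rewrite orbC; case: mapP => // -[? _ []//].
by rewrite mem_map => [|? ? []//]; case: mapP => // -[? _ []//].
Qed.

Lemma pos_index_uniq : uniq pos_index.
Proof.
rewrite cat_uniq !map_inj_uniq ?pos_pairs_uniq; try by move=> ? ? [].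
rewrite andbT /=; apply/hasPn => t /mapP[q _ ->].
by apply/mapP => -[? _ []].
Qed.

Lemma unipotentE : unipotent p_pr d = @uni Qp d.
Proof.
apply/seteqP; split=> g.
  move=> [s [h [_ sP hP ->]]]; apply: prod_group; first exact: uni_group.
  move=> a /sP aP _; have := hP _ aP; move/Phi_posE: aP => [i [j [c [ij ->]]]].
  by move=> /(root_subgroupP hd _ (rt_pos c ij)) ->; exact: uni_xr.
move=> ug; pose X t : M := xr (lshift d t.2.1) (rt_sign t.1 t.2.2) (coord t.1 t.2.1 t.2.2 g).
(* At a positive root exactly one factor occurs; the product turns a family indexed by pairs into
   one indexed by roots. *)
pose h a := \prod_(t <- pos_index | pos_root t == a) X t.
have hE t : t \in pos_index -> h (pos_root t) = X t.
  move=> tp; transitivity (\prod_(t' <- pos_index | t' == t) X t'); last first.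
    exact: (@big_uniq_pred1 _ _ _ _ _ _ X pos_index_uniq tp).
  rewrite /h big_seq_cond [RHS]big_seq_cond.
  apply: eq_bigl => t'; case: (boolP (t' \in pos_index)) => //= tp'.
  apply/eqP/eqP => [|->//]; move: tp tp'; rewrite !mem_pos_index => tp tp'.
  exact: pos_root_inj.
exists [seq pos_root t | t <- pos_index], h; split.
- rewrite map_inj_in_uniq ?pos_index_uniq // => t t'; rewrite !mem_pos_index.
  exact: pos_root_inj.
- move=> a; split=> [/mapP[[c [i j]]]|/Phi_posE[i [j [c [ij ->]]]]].
    by rewrite mem_pos_index /= => ij ->; apply/Phi_posE; exists i, j, c.
  by apply/mapP; exists (c, (i, j)); rewrite ?mem_pos_index.
- move=> a /Phi_posE[i [j [c [ij ->]]]].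
  have := hE (c, (i, j)); rewrite mem_pos_index => /(_ ij); rewrite /pos_root /= => ->.
  exact/xr_root/rt_pos.
rewrite big_map big_seq.
under eq_bigr => t tp do rewrite (hE _ tp).
rewrite -big_seq big_cat !big_map; exact: uni_decomp (two_neq0 p_pr) ug.
Qed.

Lemma integral_xr r s u : rt r s -> root_subgroup0 p_pr (proot r s) (xr r s u) <-> vg 0 u.
Proof.
move=> rs; split=> [[_ [/(_ r s) /integralE + _]]|u0]; first by rewrite xr_rs.
split; first exact: xr_root.
split; last exact: xr_det (two_neq0 p_pr) rs.
move=> i j; apply/integralE; rewrite /xr mxE rootmxE mxE.
apply: vgD; first exact: (vg0_nat _ (i == j)).
apply: vgD.
  by have := vgM u0 (vg0_nat p_pr ((i == r) && (j == s))); rewrite addr0.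
by have := vgM (vgN u0) (vg0_nat p_pr ((i == star s) && (j == star r))); rewrite addr0.
Qed.

(* The base chamber, where all positive roots take values in ]0, 1[. *)
Definition dominant_alcove x := forall i j c, (i < j)%N ->
  0 < ext x (lshift d i) - ext x (rt_sign c j) < 1.

Lemma val_ge_alcove (z : R) u : 0 < z < 1 -> val_ge (- z) u <-> vg 0 u.
Proof.
move=> /andP[z0 z1]; split=> [|u0].
  by move/(@val_ge_lt p p_pr R (-1)); apply; rewrite mulrN1z ltrN2.
by apply/val_geP; exists 0; split=> //; rewrite mulr0z; lra.
Qed.

Lemma unipotent0_gen i j c u : (i < j)%N -> vg 0 u ->
  unipotent0 p_pr d (xr (lshift d i) (rt_sign c j) u).
Proof.
move=> ij u0; apply: sub_generated; exists (proot (lshift d i) (rt_sign c j)).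
  by apply/Phi_posE; exists i, j, c.
by apply/integral_xr => //; exact: rt_pos.
Qed.

Lemma unipotent0_min (S : set M) : is_subgroup S ->
  (forall i j c u, (i < j)%N -> vg 0 u -> S (xr (lshift d i) (rt_sign c j) u)) ->
  unipotent0 p_pr d `<=` S.
Proof.
move=> gS SX; apply: generated_sub => // g [a /Phi_posE[i [j [c [ij ->]]]] ag].
have gE : g = xr (lshift d i) (rt_sign c j) (g (lshift d i) (rt_sign c j)).
  by case: ag => /(root_subgroupP hd _ (rt_pos c ij)).
by rewrite gE; apply: SX => //; apply/(integral_xr _ (rt_pos c ij)); rewrite -gE.
Qed.

(** On the base alcove the real bounds lie strictly between -1 and 0, so they amount to integrality
    of the parameters. *)
Lemma unipotent0E x : dominant_alcove x ->
  unipotent0 p_pr d = Iwahori p_pr (facet x) `&` unipotent p_pr d.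
Proof.
move=> xP; rewrite unipotentE; apply/seteqP; split.
  apply: unipotent0_min => [|i j c u ij u0].
    by apply: setI_group; [exact: Iwahori_group | exact: uni_group].
  split; last exact: uni_xr.
  by apply/xr_Iwahori => //; [exact: rt_pos | rewrite -opprB; apply/val_ge_alcove => //; exact: xP].
move=> g [gI ug]; apply: uni_coords => //.
  apply: generated_group uni_group _ => h [a /Phi_posE[i [j [c [ij ->]]]] [+ _]].
  by move/(root_subgroupP hd _ (rt_pos c ij)) => ->; exact: uni_xr.
move=> c i j ij; apply: unipotent0_gen => //.
by apply/(val_ge_alcove _ (xP i j c ij)); rewrite opprB; move/Iwahori_uniE: gI => /(_ ug); apply.
Qed.

(** For a positive root, the root element of parameter 1 forces the value at x to be at least 0, and
    the p-th power of the opposite one forces it to be at most 1. Equality is excluded off the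
    walls. *)
Lemma pro_p_alcove x : (forall a (k : int), Phi a -> root_eval a x <> k%:~R) ->
  pro_p_Iwahori p_pr d `<=` Iwahori p_pr (facet x) -> dominant_alcove x.
Proof.
move=> xk xI i j c ij; have rs := rt_pos c ij; set r := lshift d i in rs *; set s := rt_sign c j in rs *.
have aP : Phi_pos (proot r s) by apply/Phi_posE; exists i, j, c.
have sr : rt s r by rewrite rt_sym.
have v1 : vg 0 (1 : Qp) by exact: (vg0_nat _ 1).
have neq k : ext x r - ext x s != k%:~R.
  by rewrite -root_evalE; apply/eqP/xk; exact: proot_Phi.
have : val_ge (ext x s - ext x r) (1 : Qp).
  apply/xr_Iwahori => //; apply: xI; apply: sub_generated; left; left.
  by exists (proot r s) => //; apply/integral_xr.
have : val_ge (ext x r - ext x s) (p%:R : Qp).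
  apply/(xr_Iwahori hd _ _ sr); apply: xI; apply: sub_generated; left; right.
  exists (proot r s) => //; exists (xr s r 1); last by rewrite xrX.
  by rewrite proot_opp; apply/integral_xr.
have := neq 0; have := neq 1; rewrite mulr0z mulr1z => n1 n0.
move=> /val_geP[k [xk1 kp]] /val_geP[l [xl1 l1]].
have k1 : k <= 1.
  have := @vg_unit p p_pr k 1 1; rewrite expr1z mulr1; apply=> //; exact: unitr1.
have l0 : l <= 0.
  have := @vg_unit p p_pr l 0 1; rewrite expr0z mulr1; apply=> //; exact: unitr1.
move: xk1 xl1; move: k1 l0; rewrite -(ler_int R) -(ler_int R l) => *.
by rewrite !lt_neqAle n1 eq_sym n0 /=; apply/andP; split; lra.
Qed.

End Unipotent.
(** * Crossing a wall *)

Section WallCrossing.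
Context (R : realType) (d : nat).
Local Notation J := 'I_(d + d).
Local Notation gap x r s := (ext x r - ext x s).
Implicit Types (r s t u : J) (k n : int) (x y z : 'rV[R]_d).

Definition between k (a : R) := k%:~R < a < (k + 1)%:~R.

(* The walls separating [y1] from [y2] reduce to the wall of equation
   [proot r s = n], on which [x0] lies and no other wall passes through [x0]. *)
Definition wall_crossing y1 x0 y2 r s n :=
  [/\ rt r s, (gap x0 r s) = n%:~R, between n (gap y1 r s), between (n - 1) (gap y2 r s) &
      forall t u, rt t u -> ~~ same_root t u r s -> ~~ same_root t u s r ->
        exists k, [/\ between k (gap x0 t u), between k (gap y1 t u) & between k (gap y2 t u)]].

Lemma between_neq k l a : between k a -> a <> l%:~R.
Proof. by move=> /andP[+ +] e; rewrite e !ltr_int; lia. Qed.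

Lemma between_opp k x r s : between k (gap x r s) -> between (- (k + 1)) (gap x s r).
Proof.
by rewrite /between !(intrD, mulrNz) => /andP[h1 h2]; apply/andP; split; lra.
Qed.

Lemma same_root_ext t u r s x : same_root t u r s -> (gap x t u) = (gap x r s).
Proof. by case/orP => /andP[/eqP -> /eqP ->] //; rewrite !ext_star; lra. Qed.

Lemma wall_crossing_star y1 x0 y2 r s n :
  wall_crossing y1 x0 y2 r s n -> wall_crossing y1 x0 y2 (star s) (star r) n.
Proof.
have E x : gap x (star s) (star r) = gap x r s by rewrite !ext_star; lra.
have S t u : same_root t u (star s) (star r) = same_root t u r s.
  by rewrite /same_root !starK orbC.
have S' t u : same_root t u (star r) (star s) = same_root t u s r.
  by rewrite /same_root !starK orbC.
move=> [rs en b1 b2 H]; split; rewrite ?E //; first by rewrite rt_star rt_sym.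
by move=> t u tu; rewrite S S'; exact: H.
Qed.

Context (p : nat) (p_pr : prime p).
Local Notation Qp := (padic p_pr).
Local Notation M := 'M[Qp]_(d + d).
Implicit Types (g h : M) (v w : Qp).

Lemma val_ge_between k (a : R) v : between k a -> val_ge (- a) v <-> vg (- k) v.
Proof.
move=> /andP[ka ak]; split=> [av|kv].
  rewrite (_ : - k = - (k + 1) + 1); last by lia.
  by apply: (val_ge_lt _ av); rewrite mulrNz ltrN2.
by apply/val_geP; exists (- k); split=> //; rewrite mulrNz lerN2 ltW.
Qed.

Lemma val_ge_between_opp k x r s v : between k (gap x r s) ->
  val_ge (gap x s r) v <-> vg (- k) v.
Proof. by move=> /val_ge_between; rewrite opprB. Qed.

Context (hd : (0 < d)%N).

Section Wall.
Context (y1 x0 y2 : 'rV[R]_d) (r s : J) (n : int) (W : wall_crossing y1 x0 y2 r s n).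

Lemma rt_cases t u : rt t u ->
  [\/ same_root t u r s, same_root t u s r |
   exists k, [/\ between k (gap x0 t u), between k (gap y1 t u) & between k (gap y2 t u)]].
Proof.
case: W => _ _ _ _ H tu.
have [|nrs] := boolP (same_root t u r s); first by constructor 1.
have [|nsr] := boolP (same_root t u s r); first by constructor 2.
by constructor 3; exact: H.
Qed.

Lemma wall_between1 t u : rt t u -> exists k, between k (gap y1 t u).
Proof.
case: W => _ _ b1 _ _ /rt_cases[/same_root_ext ->|/same_root_ext ->|[k []]].
- by exists n.
- by exists (- (n + 1)); exact: between_opp.
- by exists k.
Qed.

Lemma wall_between2 t u : rt t u -> exists k, between k (gap y2 t u).
Proof.
case: W => _ _ _ b2 _ /rt_cases[/same_root_ext ->|/same_root_ext ->|[k []]].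
- by exists (n - 1).
- by exists (- (n - 1 + 1)); exact: between_opp.
- by exists k.
Qed.

Lemma ext_segment y z (e : R) t : ext (z + e *: (y - z)) t = ext z t + e * (ext y t - ext z t).
Proof.
by case: (starP t) => -[i ->]; rewrite ?ext_lshift ?ext_rshift !mxE //; lra.
Qed.

Lemma between_chamber y : (forall t u, rt t u -> exists k, between k (gap y t u)) ->
  is_chamber (facet y).
Proof.
move=> H; exists y => // a k /PhiP[t [u [tu ->]]]; rewrite root_evalE.
by have [l] := H _ _ tu; exact: between_neq.
Qed.

(** No wall strictly separates y from [x0], so the segment from a point z of the facet of [x0] to y
    lies in the facet of y, except possibly for z itself. *)
Lemma facet_closure y : (forall t u k, rt t u -> (gap x0 t u) < k%:~R -> (gap y t u) < k%:~R) ->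
  facet x0 `<=` closure (facet y).
Proof.
move=> xy z xz B /nbhs_ballP[e /= e0 zB].
have {}xz t u k : rt t u -> (gap z t u < k%:~R) = (gap x0 t u < k%:~R) by move/facetP: xz; exact.
pose S := \sum_i `|y 0 i - z 0 i|.
have S0 : 0 <= S by exact: sumr_ge0.
(* b <= 1 keeps the point on the segment, and b S < e keeps it in the ball. *)
pose b := e / (e + S + 1).
have b0 : 0 < b by apply: divr_gt0 => //; lra.
have bE : b * (e + S + 1) = e by rewrite divfK //; lra.
have b1 : b <= 1 by nra.
exists (z + b *: (y - z)); split.
  apply/facetP => t u k tu; rewrite !ext_segment.
  have ut : rt u t by rewrite rt_sym.
  have H1 := xy _ _ k tu; have H2 := xz _ _ k tu.
  have H3 := xy _ _ (- k) ut; have H4 := xz _ _ (- k) ut; rewrite mulrNz in H3 H4.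
  have [h|h] := ltP (gap y t u) k%:~R.
    have : gap z t u <= k%:~R by rewrite leNgt; apply/negP => h'; have := H3; rewrite -H4; lra.
    by move=> ?; nra.
  have : k%:~R <= gap z t u by rewrite leNgt H2; apply/negP => /H1; lra.
  by move=> ?; apply/negbTE; rewrite -leNgt; nra.
apply: zB; split=> // i j; rewrite ord1 /ball /= !mxE opprD addrA subrr add0r normrN normrM gtr0_norm //.
have : `|y 0 j - z 0 j| <= S by rewrite /S (bigD1 j) //= lerDl sumr_ge0.
by move=> ?; nra.
Qed.

Lemma wall_lt1 t u k : rt t u -> (gap x0 t u) < k%:~R -> (gap y1 t u) < k%:~R.
Proof.
case: W => rs en b1 _ _ /rt_cases[/same_root_ext E|/same_root_ext E|[l [b0 /andP[_ b] _]]].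
- rewrite !E en ltr_int => nk; case/andP: b1 => _ h; apply: (lt_le_trans h).
  by rewrite ler_int; lia.
- rewrite !E => nk; case/andP: b1 => h _; apply: lt_trans nk.
  by rewrite -ltrN2 !opprB en.
- case/andP: b0 => b0 _ h; apply: (lt_le_trans b); rewrite ler_int.
  by move: (lt_trans b0 h); rewrite ltr_int; lia.
Qed.

Lemma wall_lt2 t u k : rt t u -> (gap x0 t u) < k%:~R -> (gap y2 t u) < k%:~R.
Proof.
case: W => rs en _ b2 _ /rt_cases[/same_root_ext E|/same_root_ext E|[l [b0 _ /andP[_ b]]]].
- rewrite !E => nk; case/andP: b2 => _ h; apply: lt_trans nk.
  by rewrite en -[n](subrK 1).
- rewrite !E -opprB en -mulrNz ltr_int => nk; case/andP: b2 => h _.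
  rewrite -opprB ltrNl -mulrNz; apply: le_lt_trans h; rewrite ler_int; lia.
- case/andP: b0 => b0 _ h; apply: (lt_le_trans b); rewrite ler_int.
  by move: (lt_trans b0 h); rewrite ltr_int; lia.
Qed.

Lemma wall_adjacent : adjacent (facet y1) (facet y2).
Proof.
case: (W) => rs en b1 b2 H; split.
- exact: between_chamber wall_between1.
- exact: between_chamber wall_between2.
- move=> e; have : facet y1 y2 by rewrite e.
  move/facetP/(_ r s n rs); case/andP: b1 => h _; case/andP: b2 => _; rewrite subrK => ->.
  by rewrite ltNge ltW.
- exists (facet x0); split.
  + exists x0, (proot r s), n; split=> //; first exact: proot_Phi.
      by rewrite root_evalE.
    move=> a k /PhiP[t [u [tu ->]]]; rewrite root_evalE.
    case: (rt_cases tu) => [/same_root_proot|/same_root_proot|[l [/between_neq b _ _ /b]]] //.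
      by left.
    by right; rewrite proot_opp.
  + exact: facet_closure wall_lt1.
  + exact: facet_closure wall_lt2.
Qed.

Lemma root_index y y' t u k : rt t u -> (forall v, val_ge (gap y u t) v <-> vg k v) ->
  (forall v, val_ge (gap y' u t) v <-> vg (k + 1) v) ->
  has_index (Iwahori p_pr (facet y) `&` root_subgroup p_pr (proot t u))
            (Iwahori p_pr (facet y') `&` root_subgroup p_pr (proot t u)) p.
Proof.
move=> tu yk y'k; set H := _ `&` _; set K := _ `&` _.
have gN : is_subgroup (root_subgroup p_pr (proot t u)).
  split=> [g|||g].
  - by move=> /(root_subgroupP hd _ tu) ->; case: (xr_invmx (g t u) tu).
  - by apply/(root_subgroupP hd _ tu); rewrite -(xr0 _ t u) xr_rs.
  - move=> g h /(root_subgroupP hd _ tu) -> /(root_subgroupP hd _ tu) ->.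
    by rewrite xrD //; exact: xr_root.
  - by move=> /(root_subgroupP hd _ tu) ->; have [_ ->] := xr_invmx (g t u) tu; exact: xr_root.
have HE v : H (xr t u v) <-> vg k v.
  by rewrite -yk; split=> [[/(xr_Iwahori hd _ _ tu)]|h] //; apply/(Iwahori_rootE hd _ _ tu); exists v.
have KE v : K (xr t u v) <-> vg (k + 1) v.
  by rewrite -y'k; split=> [[/(xr_Iwahori hd _ _ tu)]|h] //; apply/(Iwahori_rootE hd _ _ tu); exists v.
have HX g : H g -> g = xr t u (g t u) by move=> [_ /(root_subgroupP hd _ tu)].
have KX g : K g -> g = xr t u (g t u) by move=> [_ /(root_subgroupP hd _ tu)].
apply: (@has_index_coord _ _ _ H K (fun g => g t u) k).
- by apply: setI_group => //; exact: Iwahori_group.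
- by apply: setI_group => //; exact: Iwahori_group.
- move=> g h /HX -> /HX ->.
  exact (eq_ind_r (vg (k + 1)) (vg0 p_pr (k + 1)) (xr_rsD (g t u) (h t u) tu)).
- by move=> g Hg; apply/HE; rewrite -(HX _ Hg).
- move=> g; split=> [Kg|[Hg gk]]; last by rewrite (HX _ Hg); exact/KE.
  have gk : vg (k + 1) (g t u) by apply/KE; rewrite -(KX _ Kg).
  split=> //; rewrite (KX _ Kg); apply/HE; apply: vg_le gk; lia.
- exists (xr t u (p%:R ^ k)); first by apply/HE; exact: vgX.
  by rewrite xr_rs // subrr; exact: vg0.
Qed.

Lemma wall_crossing_root : crossing_root p_pr (facet y1) (facet y2) (proot r s).
Proof.
case: (W) => rs en b1 b2 H; split.
- exact: proot_Phi.
- move=> a /PhiP[t [u [tu ->]]] ars asr; apply/seteqP.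
  case: (rt_cases tu) => [/same_root_proot //|/same_root_proot|[k [_ k1 k2]]].
    by move=> e; case: asr; rewrite e proot_opp.
  split=> g /(Iwahori_rootE hd _ _ tu)[v vb ->]; apply/(Iwahori_rootE hd _ _ tu); exists v => //.
    by apply/(val_ge_between_opp _ k2)/(val_ge_between_opp _ k1).
  by apply/(val_ge_between_opp _ k1)/(val_ge_between_opp _ k2).
- rewrite proot_opp; have sr : rt s r by rewrite rt_sym.
  apply: (@root_index _ _ _ _ n) => // v.
    have := val_ge_between_opp v (between_opp b2).
    by rewrite subrK opprK.
  by have := val_ge_between_opp v (between_opp b1); rewrite opprK.
- apply: (@root_index _ _ _ _ (- n)) => // v; first exact: val_ge_between_opp.
  by have -> : - n + 1 = - (n - 1); [lia | exact: val_ge_between_opp].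
Qed.

End Wall.
End WallCrossing.

(** * Index p in [N] across a wall *)

Section WallIndex.
Context (R : realType) (p : nat) (p_pr : prime p) (d : nat) (hd : (0 < d)%N).
Local Notation Qp := (padic p_pr).
Local Notation M := 'M[Qp]_(d + d).
Local Notation J := 'I_(d + d).
Local Notation gap x r s := (ext x r - ext x s).
Implicit Types (g h : M) (r s t u : J) (k n : int) (x y z : 'rV[R]_d) (v w : Qp).

Lemma has_index_self (H : set M) m : has_index H H m -> m = 1%N.
Proof.
move=> [[Hu H1 HM HV] _ _].
suff -> : [set [set h * k | k in H] | h in H] = [set H].
  rewrite (card_eql card_set1) => /card_eq_II; by [].
apply/seteqP; split=> X; last by move=> ->; exists 1 => //; apply/seteqP; split=> g; 
  [move=> [h Hh <-]; rewrite mul1r | move=> Hg; exists g => //; rewrite mul1r].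
move=> [h Hh <-]; apply/seteqP; split=> g.
  by move=> [h' Hh' <-]; exact: HM.
move=> Hg; exists (invmx h * g); first by apply: HM => //; exact: HV.
exact: (mulKVmx (Hu _ Hh)).
Qed.

(** If b is neither a nor -a, the condition on b makes the two groups at a equal, against their
    index p. If b = -a, the two groups contain each other and are equal again. *)
Lemma crossing_root_uniq (D1 D2 : set 'rV[R]_d) a b :
  crossing_root p_pr D1 D2 a -> crossing_root p_pr D1 D2 b -> a = b.
Proof.
move=> [aP aE aN ap] [bP bE bN bp]; apply: contrapT => ab.
have p1 : p <> 1%N by move=> e; move: p_pr; rewrite e.
have [aNb|aNb] := pselect (a = - b).
  move: aN ap; rewrite aNb opprK => aN _; apply: p1; apply: (@has_index_self (Iwahori p_pr D1 `&` root_subgroup p_pr b)).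
  have [_ _ s1 _] := aN; have [_ _ s2 _] := bp.
  by move: (bp); rewrite (_ : Iwahori p_pr D2 `&` _ = Iwahori p_pr D1 `&` root_subgroup p_pr b) //; apply/seteqP.
by have := ap; rewrite (bE _ aP ab aNb) => /has_index_self /p1.
Qed.

Section Wall.
Context (y1 x0 y2 : 'rV[R]_d) (i j : 'I_d) (c : bool) (n : int) (ij : (i < j)%N).
Local Notation r := (lshift d i).
Local Notation s := (rt_sign c j).
Context (W : wall_crossing y1 x0 y2 r s n).

(** By integrality the bound is the same throughout the chamber, hence persists at the point [x0] of
    its boundary. *)
Lemma wall_value t u v : rt t u -> val_ge (gap y1 u t) v -> val_ge (gap x0 u t) v.
Proof.
case: W => rs en b1 b2 H tu; case: (rt_cases W tu) => [E|E|[k [k0 k1 _]]].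
- have := same_root_ext x0 E; have := same_root_ext y1 E => E1 E0.
  rewrite -opprB E1 => /(val_ge_between _ b1) h; rewrite -opprB E0 en -mulrNz.
  exact/val_ge_int.
- have := same_root_ext x0 E; have := same_root_ext y1 E => E1 E0.
  rewrite -opprB E1 => /(val_ge_between _ (between_opp b1)) h.
  rewrite -opprB E0 opprB en; apply/val_ge_int; apply: vg_le h; lia.
- by move=> /(val_ge_between_opp _ k1) h; apply/(val_ge_between_opp _ k0).
Qed.

Lemma wall_strict t u v : rt t u -> ~~ same_root t u r s -> ~~ same_root t u s r ->
  val_ge (gap x0 u t) v -> exists2 e, gap x0 u t < e & val_ge e v.
Proof.
case: W => rs en b1 b2 H tu nrs nsr; have [k [k0 _ _]] := H _ _ tu nrs nsr.
by apply: val_ge_strict => l; exact: between_neq (between_opp k0).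
Qed.

Local Notation H := (Iwahori p_pr (facet y1) `&` @uni Qp d).
Local Notation K := (Iwahori p_pr (facet y2) `&` @uni Qp d).

Lemma wall_bounded g : H g -> bounded_at x0 g.
Proof.
move=> [gI ug]; have gc := (Iwahori_uniE hd y1 ug).1 gI.
have [_ xg _] : parahoric x0 g.
  apply: (uni_coords _ ug); first exact: parahoric_group.
  move=> c' i' j' ij'; apply/parahoric_xr; first exact: rt_pos.
  by apply: wall_value; [exact: rt_pos | exact: gc].
exact: xg.
Qed.

(** For e_i + e_j the entry is the sum over k of A_ik W_kj. The term k = i is the parameter, the
    term k = j vanishes by skewness, and in the others W_kj belongs to a root not normal to the
    wall, whose bound at [x0] is strict. *)
Lemma wall_entry g : H g -> vg (- n + 1) (g r s - coord c i j g).
Proof.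
move=> Hg; have xg := wall_bounded Hg; case: Hg => _ ug; case: W => rs en b1 b2 _.
have [cE|cE] : c = true \/ c = false by case: (c); [left | right].
  by rewrite /coord /rt_sign cE subrr; exact: vg0.
rewrite /coord cE.
have [gE _ Wskew A1 _] := uni_blocks ug.
have -> : g r (rt_sign false j) = \sum_k g (lshift d i) (lshift d k) * skew_part g k j.
  rewrite {1}gE /rt_sign block_mxEur mxE; apply: eq_bigr => k _.
  by rewrite !mxE.
have gii : g (lshift d i) (lshift d i) = 1 by have := A1 i; rewrite !mxE.
rewrite (bigD1 i) //= gii mul1r addrAC subrr add0r; apply: vg_sum => k ki.
have [->|kj] := eqVneq k j.
  have wjj : skew_part g j j = 0.
    have := two_neq0 p_pr; have := congr1 (fun A : 'M_d => A j j) Wskew; rewrite !mxE.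
    exact: self_opp0.
  by rewrite wjj mulr0; exact: vg0.
have sk : s = rt_sign false j by rewrite cE.
have kjrt : rt (lshift d k) (rt_sign false j) by exact: rt_signP.
have := coord_bounded k j false ug xg; rewrite /coord.
move=> /(wall_strict kjrt)[|| e ex ev].
- rewrite cE /same_root /= (inj_eq (@lshift_inj d d)) (negbTE ki) /rt_sign /= star_rshift.
  by rewrite (inj_eq (@lshift_inj d d)) (negbTE kj).
- by rewrite cE /same_root /rt_sign /= eq_lrshift star_lshift eq_lrshift.
rewrite mulrC.
apply: (val_ge_lt _ (val_geM ev (xg (lshift d i) (lshift d k)))).
by rewrite mulrNz -en opprB cE; lra.
Qed.

(** The remaining terms g_rt h_ts have valuation at least -n by the bounds at [x0], and one factor
    sits at a root not normal to the wall, where the bound is strict: the first one, or the second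
    one if t = [star r], when (r, t) gives no root. *)
Lemma wall_additive g h : H g -> H h ->
  vg (- n + 1) ((g * h) r s - (g r s + h r s)).
Proof.
move=> Hg Hh; have xg := wall_bounded Hg; have xh := wall_bounded Hh.
case: Hg => _ [_ g1 _]; case: Hh => _ [_ h1 _].
case: W => rs en b1 b2 _; have := rs => /andP[sr srs].
rewrite mxMl (bigD1 r) //= (bigD1 s) //= g1 h1 mul1r mulr1 addrA [h _ _ + _]addrC addrAC subrr add0r.
apply: vg_sum => t /andP[tr ts].
have X : gap x0 s t + gap x0 t r = (- n)%:~R by rewrite mulrNz -en; lra.
have [tsr|tsr] := eqVneq t (star r).
  have tsrt : rt t s by rewrite tsr /rt srs starK sr.
  have := xh t s => /(wall_strict tsrt)[|| e ex ev].
  - by rewrite /same_root (negbTE tr) tsr (inj_eq (@star_inj d)) eq_sym (negbTE sr).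
  - by rewrite /same_root tsr eq_sym (negbTE srs) eqxx /= [s == star s]eq_sym (negbTE (star_neq _)).
  rewrite mulrC; apply: (val_ge_lt _ (val_geM ev (xg r t))); rewrite -X; lra.
have rt' : rt r t by rewrite /rt tr tsr.
have := xg r t => /(wall_strict rt')[|| e ex ev].
- by rewrite /same_root eqxx (negbTE ts) /= -eq_star eq_sym (negbTE srs).
- by rewrite /same_root [r == s]eq_sym (negbTE sr) [r == star r]eq_sym (negbTE (star_neq _)).
rewrite mulrC; apply: (val_ge_lt _ (val_geM (xh t s) ev)); rewrite -X; lra.
Qed.

Lemma wall_coord c' (i' j' : 'I_d) v : (i' < j')%N ->
  (c', (i', j')) <> (c, (i, j)) ->
  val_ge (gap y1 (rt_sign c' j') (lshift d i')) v <-> val_ge (gap y2 (rt_sign c' j') (lshift d i')) v.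
Proof.
move=> ij' ne; have := rt_cases W (rt_pos c' ij') => -[E|E|[k [_ k1 k2]]].
- case: ne; apply: (@pos_root_inj d (c', (i', j')) (c, (i, j))) => //.
  exact: same_root_proot.
- exfalso; move: E; rewrite /same_root /rt_sign.
  case: (c); case: (c'); rewrite ?epsE ?eq_lrshift ?eq_rlshift ?andbF //= ?orbF.
  by move=> /andP[/eqP/lshift_inj e /eqP/lshift_inj e']; move: ij ij'; rewrite e e'; lia.
- by split=> [/(val_ge_between_opp _ k1) h|/(val_ge_between_opp _ k2) h];
    [apply/(val_ge_between_opp _ k2) | apply/(val_ge_between_opp _ k1)].
Qed.

Lemma wall_index : has_index (Iwahori p_pr (facet y1) `&` unipotent p_pr d)
  (Iwahori p_pr (facet y2) `&` unipotent p_pr d) p.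
Proof.
rewrite (unipotentE p_pr hd); case: (W) => rs en b1 b2 _.
(* Only the bound on the parameter at (i, j) separates the two groups. The other conditions are
   stated at [y1] for both, so that they can be carried over. *)
have HE g : uni g -> H g <-> vg (- n) (coord c i j g) /\ forall c' (i' j' : 'I_d), (i' < j')%N ->
    (c', (i', j')) <> (c, (i, j)) -> val_ge (gap y1 (rt_sign c' j') (lshift d i')) (coord c' i' j' g).
  move=> ug; split=> [[/(Iwahori_uniE hd _ ug) gc _]|[gk gc]].
    by split=> [|c' i' j' ij' _]; [apply/(val_ge_between_opp _ b1)/gc | exact: gc].
  split=> //; apply/(Iwahori_uniE hd _ ug) => c' i' j' ij'.
  have [[-> -> ->]|ne] := pselect ((c', (i', j')) = (c, (i, j))); last exact: gc.
  exact/(val_ge_between_opp _ b1).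
have KE g : uni g -> K g <-> vg (- n + 1) (coord c i j g) /\ forall c' (i' j' : 'I_d), (i' < j')%N ->
    (c', (i', j')) <> (c, (i, j)) -> val_ge (gap y1 (rt_sign c' j') (lshift d i')) (coord c' i' j' g).
  have nE : - n + 1 = - (n - 1) by lia.
  move=> ug; split=> [[/(Iwahori_uniE hd _ ug) gc _]|[gk gc]].
    split=> [|c' i' j' ij' ne]; first by rewrite nE; apply/(val_ge_between_opp _ b2)/gc.
    by apply/(wall_coord _ ij' ne); exact: gc.
  split=> //; apply/(Iwahori_uniE hd _ ug) => c' i' j' ij'.
  have [[-> -> ->]|ne] := pselect ((c', (i', j')) = (c, (i, j))).
    by apply/(val_ge_between_opp _ b2); rewrite -nE.
  by apply/(wall_coord _ ij' ne); exact: gc.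
apply: (@has_index_coord _ _ _ H K (fun g => g r s) (- n)).
- by apply: setI_group; [exact: Iwahori_group | exact: uni_group].
- by apply: setI_group; [exact: Iwahori_group | exact: uni_group].
- exact: wall_additive.
- by move=> g Hg; apply/(val_ge_between_opp _ b1); case: Hg => /(Iwahori_parahoric hd)[_ + _] _; apply.
(* Membership in [K] bounds the parameter, whereas the additive coordinate is the entry;
   [wall_entry] exchanges them. *)
- move=> g; split=> [Kg|[Hg gk]]; have ug : uni g by [case: Kg | case: Hg].
    have [ck cc] := (KE _ ug).1 Kg.
    have Hg : H g by apply/(HE _ ug); split=> //; apply: vg_le ck; lia.
    split=> //; rewrite -(subrK (coord c i j g) (g r s)); apply: vgD => //.
    exact: wall_entry.
  have [_ cc] := (HE _ ug).1 Hg; apply/(KE _ ug); split=> //.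
  rewrite -(subKr (g r s) (coord c i j g)); apply: vgD => //; apply: vgN.
  exact: wall_entry.
- exists (xr r s (p%:R ^ (- n))).
    split; last exact: uni_xr.
    by apply/(xr_Iwahori hd _ _ rs)/(val_ge_between_opp _ b1); exact: vgX.
  by rewrite (xr_rs _ rs) subrr; exact: vg0.
Qed.

End Wall.

End WallIndex.
(** * Monomial matrices acting on the apartment *)

Section AffineMaps.
Context (R : realType) (d : nat).
Local Notation J := 'I_(d + d).
Local Notation gap x r s := (ext x r - ext x s).
Implicit Types (f g : J -> J) (m n : J -> int) (i r s : J) (x y : 'rV[R]_d) (k : int).

Definition weyl f m :=
  [/\ injective f, forall i, f (star i) = star (f i) & forall i, m (star i) = - m i].

(** The index map acts by precomposition, so index maps compose in reverse order, as they do in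
    [mono_mul]. *)
Definition aff f m x : 'rV[R]_d := \row_i (ext x (f (lshift d i)) + (m (lshift d i))%:~R).

Lemma ext_aff f m x i : weyl f m -> ext (aff f m x) i = ext x (f i) + (m i)%:~R.
Proof.
move=> [_ fs ms]; case: (starP i) => -[j ->]; first by rewrite ext_lshift mxE.
rewrite ext_rshift mxE -star_lshift fs ms ext_star mulrNz; lra.
Qed.

Lemma ext_inj x y : (forall i, ext x i = ext y i) -> x = y.
Proof. by move=> xy; apply/rowP => i; rewrite -!ext_lshift. Qed.

Lemma weyl_comp f m g n : weyl f m -> weyl g n ->
  weyl (fun i => g (f i)) (fun i => m i + n (f i)).
Proof.
move=> [fi fs ms] [gi gs ns]; split=> [i j /gi /fi //|i|i]; first by rewrite fs gs.
by rewrite ms fs ns opprD.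
Qed.

Lemma weyl_id : weyl (fun i => i) (fun=> 0).
Proof. by split=> // i; rewrite oppr0. Qed.

Lemma aff_comp f m g n x : weyl f m -> weyl g n ->
  aff f m (aff g n x) = aff (fun i => g (f i)) (fun i => m i + n (f i)) x.
Proof.
move=> W W'; apply: ext_inj => i.
by rewrite (ext_aff _ _ (weyl_comp W W')) (ext_aff _ _ W) (ext_aff _ _ W') intrD; lra.
Qed.

Lemma aff_id x : aff (fun i => i) (fun=> 0) x = x.
Proof. by apply: ext_inj => i; rewrite ext_aff ?addr0 //; exact: weyl_id. Qed.

Lemma weyl_inv f m : weyl f m -> exists g n, [/\ weyl g n, forall x, aff g n (aff f m x) = x,
  forall x, aff f m (aff g n x) = x & cancel f g /\ cancel g f].
Proof.
move=> W; have [fi fs ms] := W; pose g := invF fi.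
have fK : cancel f g by exact: invF_f.
have gK : cancel g f by exact: f_invF.
have gs i : g (star i) = star (g i) by apply: (fi); rewrite fs !gK.
have W' : weyl g (fun i => - m (g i)).
  by split=> [|//|i]; [exact: can_inj gK | rewrite gs ms].
exists g, (fun i => - m (g i)); split=> // x; apply: ext_inj => i.
  by rewrite !ext_aff // gK mulrNz addrK.
by rewrite !ext_aff // fK mulrNz subrK.
Qed.

Lemma gap_aff f m x r s : weyl f m ->
  gap (aff f m x) r s = gap x (f r) (f s) + (m r - m s)%:~R.
Proof. by move=> W; rewrite !ext_aff // intrD mulrNz; lra. Qed.

Lemma rt_weyl f m r s : weyl f m -> rt (f r) (f s) = rt r s.
Proof. by move=> [fi fs _]; rewrite /rt -fs !(inj_eq fi). Qed.

Lemma same_root_weyl f m t u r s : weyl f m ->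
  same_root (f t) (f u) (f r) (f s) = same_root t u r s.
Proof. by move=> [fi fs _]; rewrite /same_root -!fs !(inj_eq fi). Qed.

Lemma facet_aff f m x y : weyl f m -> facet x y -> facet (aff f m x) (aff f m y).
Proof.
move=> W /facetP xy; apply/facetP => r s k rs.
have E z : (gap (aff f m z) r s < k%:~R) = (gap z (f r) (f s) < (k - (m r - m s))%:~R).
  by rewrite gap_aff // [in RHS]intrB ltrBrDr.
by rewrite !E; apply: xy; rewrite (rt_weyl _ _ W).
Qed.

Lemma image_facet f m x : weyl f m -> aff f m @` facet x = facet (aff f m x).
Proof.
move=> W; have [g [n [W' fK gK _]]] := weyl_inv W; apply/seteqP; split=> y.
  by move=> [z xz <-]; exact: facet_aff.
by move=> yf; exists (aff g n y); rewrite ?gK // -(fK x); exact: facet_aff.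
Qed.

Lemma between_aff f m k x r s : weyl f m -> between k (gap x (f r) (f s)) ->
  between (k + (m r - m s)) (gap (aff f m x) r s).
Proof.
move=> W; rewrite /between gap_aff // !intrD => /andP[h1 h2].
by apply/andP; split; lra.
Qed.

Lemma wall_crossing_aff f m y1 x0 y2 r s k : weyl f m ->
  wall_crossing y1 x0 y2 (f r) (f s) k ->
  wall_crossing (aff f m y1) (aff f m x0) (aff f m y2) r s (k + (m r - m s)).
Proof.
move=> W [rs en b1 b2 H]; split.
- by rewrite -(rt_weyl _ _ W).
- by rewrite gap_aff // en [RHS]intrD.
- exact: between_aff.
- by rewrite addrAC; exact: between_aff.
move=> t u tu nrs nsr; have [||| l [h0 h1 h2]] := H (f t) (f u).
- by rewrite (rt_weyl _ _ W).
- by rewrite (same_root_weyl _ _ _ _ W).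
- by rewrite (same_root_weyl _ _ _ _ W).
by exists (l + (m t - m u)); split; exact: between_aff.
Qed.

End AffineMaps.

Section Monomial.
Context (p : nat) (p_pr : prime p) (d : nat).
Local Notation Qp := (padic p_pr).
Local Notation M := 'M[Qp]_(d + d).
Local Notation J := 'I_(d + d).
Local Notation pi := (p%:R : Qp).
Implicit Types (f g : J -> J) (m n : J -> int) (i r s : J) (e : int).

(* Row [i] has its only entry in column [f i], of valuation [e - m i]: on the
   apartment the matrix acts by [aff f m]. *)
Definition mono f m e : M := \matrix_(i, b) if b == f i then pi ^ (e - m i) else 0.

Lemma mono_mul f m e g n e' :
  mono f m e * mono g n e' = mono (fun i => g (f i)) (fun i => m i + n (f i)) (e + e').
Proof.
apply/matrixP => i j; rewrite mxMl (bigD1 (f i)) //= big1 ?addr0 => [|k ki].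
  rewrite !mxE eqxx; case: eqP => _; last exact: mulr0.
  by rewrite -piD; congr (_ ^ _); lia.
rewrite mxE (negbTE ki); exact: mul0r.
Qed.

Lemma mono_scalar (k : nat) f m e : (pi ^+ k)%:M * mono f m e = mono f m (e + k%:Z).
Proof.
rewrite mxMsl; apply/matrixP => i j; rewrite !mxE; case: eqP => _; last exact: mulr0.
by rewrite (exprnP pi k) -piD; congr (_ ^ _); lia.
Qed.

Lemma mono1 : mono (fun i => i) (fun=> 0) 0 = 1.
Proof. by apply/matrixP => i j; rewrite !mxE eq_sym; case: eqP. Qed.


Lemma mono_simil f m e : weyl f m -> adj (mono f m e) * mono f m e = (pi ^ (e + e))%:M.
Proof.
move=> [fi fs ms]; pose g := invF fi.
have gK i : f (g i) = i by exact: f_invF.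
have fE i a : (star i == f (star a)) = (a == g i).
  by rewrite fs (inj_eq (@star_inj d)) eq_sym -[in RHS](inj_eq fi) gK.
apply/matrixP => i j; rewrite mxMl (bigD1 (g i)) //= big1 ?addr0 => [|a ai].
  rewrite !mxE fE eqxx gK ms; have [_|_] := eqVneq j i; last first.
    by rewrite mulr0n; exact: mulr0.
  by rewrite mulr1n -piD; congr (_ ^ _); lia.
rewrite !mxE fE (negbTE ai); exact: mul0r.
Qed.

Context (hd : (0 < d)%N).

Lemma kappa_mono f m e : weyl f m -> kappa (mono f m e) = pi ^ (e + e).
Proof. by move=> W; apply: (kappaE hd); exact: mono_simil. Qed.

(** The similitude factor has valuation 2e, and its half cancels the common exponent e; scalars
    therefore act trivially. *)
Lemma act_mono (R : realType) f m e (x : 'rV[R]_d) : weyl f m ->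
  act (mono f m e) x = aff f m x.
Proof.
move=> W; apply/rowP => i; rewrite [LHS]mxE [RHS]mxE kappa_mono // padic_valX.
rewrite (big_pred1 (f (lshift d i))) => [|b].
  by rewrite -/(ext x _) mxE eqxx padic_valX !(intrD, mulrNz); lra.
rewrite /= mxE; case: (b =P f _) => _; first by rewrite piX_neq0.
by rewrite eqxx.
Qed.

Lemma chamber_mono (R : realType) f m e (x : 'rV[R]_d) : weyl f m ->
  act (mono f m e) @` facet x = facet (aff f m x).
Proof.
move=> W; rewrite -(image_facet _ W); apply: eq_imagel => y _; exact: act_mono.
Qed.

End Monomial.
(** [A + e] is congruent to [A'] modulo H, hence no multiple of H, and it is too close to [A] to lie
    beyond one. Enumerating m1 - m2 makes the problem linear. *)
Lemma same_side (H A A' e m1 m2 : int) : -1 <= e <= 1 -> -1 <= m1 <= 1 -> -1 <= m2 <= 1 ->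
  1 < H -> A' + H * (m1 - m2) = A + e ->
  (0 < A' < H) \/ (- H < A' < 0) -> (0 < A < H) \/ (- H < A < 0) ->
  (0 < A < H /\ 0 < A + e < H) \/ (- H < A < 0 /\ - H < A + e < 0).
Proof.
move=> he h1 h2; have : m1 - m2 = -2 \/ m1 - m2 = -1 \/ m1 - m2 = 0 \/ m1 - m2 = 1 \/ m1 - m2 = 2.
  by lia.
by case=> [->|[->|[->|[->|->]]]]; lia.
Qed.

(* Innermost conditions first; contradictory branches are closed at once. *)
Ltac ifs := repeat match goal with
  | |- context [if ?b then _ else _] =>
    lazymatch b with context [if _ then _ else _] => fail | _ => idtac end;
    case: (boolP b) => ?; try (exfalso; lia)
  end; try lia.

(** * Combinatorics of the simple affine reflections *)

Section SimpleReflections.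
Context (d : nat) (hd4 : (4 <= d)%N).
Local Notation J := 'I_(d + d).
Implicit Types (s k t u : nat).

(** Zero-based linear part of the reflection: in e_1 + e_2 for s = 0, in e_(d-1) + e_d for s = d, in
    e_s - e_(s+1) otherwise. Working with natural numbers leaves the identities to [lia] after case
    distinctions. *)
Definition sref s k : nat :=
  if s == 0%N then
    if k == 0%N then d.+1 else if k == 1%N then d else if k == d then 1%N
    else if k == d.+1 then 0%N else k
  else if s == d then
    if k == (d - 2)%N then (d + d - 1)%N else if k == (d - 1)%N then (d + d - 2)%N
    else if k == (d + d - 2)%N then (d - 1)%N else if k == (d + d - 1)%N then (d - 2)%N else k
  else
    if k == (s - 1)%N then s else if k == s then (s - 1)%N
    else if k == (d + s - 1)%N then (d + s)%N else if k == (d + s)%N then (d + s - 1)%N else k.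

Definition sshift s k : int :=
  if s == 0%N then
    if (k == 0%N) || (k == 1%N) then 1 else if (k == d) || (k == d.+1) then -1 else 0
  else 0.

Definition starn k : nat := if (k < d)%N then (k + d)%N else (k - d)%N.

Lemma sref_lt s k : (s <= d)%N -> (k < d + d)%N -> (sref s k < d + d)%N.
Proof. by rewrite /sref => sd kd; ifs. Qed.

Lemma sref_invol s k : (s <= d)%N -> (k < d + d)%N -> sref s (sref s k) = k.
Proof. by rewrite /sref => sd kd; ifs. Qed.

Lemma sref_starn s k : (s <= d)%N -> (k < d + d)%N -> sref s (starn k) = starn (sref s k).
Proof. by rewrite /sref /starn => sd kd; ifs. Qed.

Lemma sshift_starn s k : (k < d + d)%N -> sshift s (starn k) = - sshift s k.
Proof. by rewrite /sshift /starn => kd; ifs. Qed.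

(* [2 d - 2] times the coordinates of the point rho / h of the base alcove,
   h = 2 d - 2 being the Coxeter number. *)
Definition rho t : int := if (t < d)%N then (d - 1)%N%:Z - t%:Z else t%:Z - (d + d - 1)%N%:Z.

(* The affine root [wall_r s - wall_s s = wall_n s] vanishes on the wall of [s]
   and decreases from the base alcove to its image under [s]. *)
Definition wall_r s : nat := if s == 0%N then d else if s == d then (d - 2)%N else (s - 1)%N.
Definition wall_s s : nat := if s == 0%N then 1%N else if s == d then (d + d - 1)%N else s.
Definition wall_n s : int := if s == 0%N then -1 else 0.

Lemma rho_pos t u : (t < d)%N -> (u < d + d)%N -> (t < u)%N -> u <> (t + d)%N -> (u < d)%N \/ (t < u - d)%N ->
  1 <= rho t - rho u <= (d + d - 3)%N%:Z.
Proof. by rewrite /rho => *; ifs. Qed.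

Lemma wall_rs_rt s : (s <= d)%N -> (wall_s s != wall_r s) && (wall_s s != starn (wall_r s)).
Proof. by rewrite /wall_r /wall_s /starn => sd; ifs. Qed.

(** The sum places the midpoint of the base point and its image on the wall; the inequalities place
    the two points in the adjacent strips. *)
Lemma rho_wall s : (s <= d)%N ->
  let A := rho (wall_r s) - rho (wall_s s) in
  let B := rho (sref s (wall_r s)) - rho (sref s (wall_s s))
    + (d + d - 2)%N%:Z * (sshift s (wall_r s) - sshift s (wall_s s)) in
  [/\ A + B = 2 * (d + d - 2)%N%:Z * wall_n s,
      (d + d - 2)%N%:Z * wall_n s < A < (d + d - 2)%N%:Z * (wall_n s + 1) &
      (d + d - 2)%N%:Z * (wall_n s - 1) < B < (d + d - 2)%N%:Z * wall_n s].
Proof.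
rewrite /wall_r /wall_s /wall_n /rho /sref /sshift => sd /=.
split; ifs.
Qed.

(** Minus the coroot of the wall: the affine root of the wall is 1 / h at the base point, so the
    reflection displaces this point by minus the coroot over h. *)
Definition wall_shift s t : int :=
  ((t == wall_s s) || (t == starn (wall_r s)))%:Z - ((t == wall_r s) || (t == starn (wall_s s)))%:Z.

Lemma rho_sref s t : (s <= d)%N -> (t < d + d)%N ->
  rho (sref s t) + (d + d - 2)%N%:Z * sshift s t = rho t + wall_shift s t.
Proof.
move=> sd td; rewrite /wall_shift /wall_r /wall_s /starn /rho /sref /sshift.
have [s0|s0] := eqVneq s 0%N; last have [sd'|sd'] := eqVneq s d; ifs.
Qed.

Lemma rho_range t u : (t < d + d)%N -> (u < d + d)%N -> u != t -> u != starn t ->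
  (0 < rho t - rho u < (d + d - 2)%N%:Z) \/ (- (d + d - 2)%N%:Z < rho t - rho u < 0).
Proof. by rewrite /rho /starn => td ud; ifs. Qed.

Lemma starnK k : (k < d + d)%N -> starn (starn k) = k.
Proof. by rewrite /starn => ?; ifs. Qed.

Lemma starn_lt k : (k < d + d)%N -> (starn k < d + d)%N.
Proof. by rewrite /starn => ?; ifs. Qed.

Lemma wall_r_lt s : (s <= d)%N -> (wall_r s < d + d)%N.
Proof. by rewrite /wall_r => ?; ifs. Qed.

Lemma wall_s_lt s : (s <= d)%N -> (wall_s s < d + d)%N.
Proof. by rewrite /wall_s => ?; ifs. Qed.

(** Type D is simply laced: a coroot pairs to -1, 0 or 1 with each root not proportional to it. The
    pairs with u = [star t], which could give 2, are ruled out first. *)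
Lemma wall_shift_diff s t u : (s <= d)%N -> (u < d + d)%N -> u != starn t ->
  ~~ ((t == wall_r s) && (u == wall_s s)) ->
  ~~ ((t == starn (wall_s s)) && (u == starn (wall_r s))) ->
  ~~ ((t == wall_s s) && (u == wall_r s)) ->
  ~~ ((t == starn (wall_r s)) && (u == starn (wall_s s))) ->
  -1 <= wall_shift s t - wall_shift s u <= 1.
Proof.
move=> sd ud uts.
have x1 : ~~ ((t == wall_r s) && (u == starn (wall_r s))).
  by apply: contra uts => /andP[/eqP -> /eqP ->].
have x2 : ~~ ((t == starn (wall_r s)) && (u == wall_r s)).
  by apply: contra uts => /andP[/eqP -> /eqP ->]; rewrite starnK // wall_r_lt.
have x3 : ~~ ((t == wall_s s) && (u == starn (wall_s s))).
  by apply: contra uts => /andP[/eqP -> /eqP ->].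
have x4 : ~~ ((t == starn (wall_s s)) && (u == wall_s s)).
  by apply: contra uts => /andP[/eqP -> /eqP ->]; rewrite starnK // wall_s_lt.
move: x1 x2 x3 x4; rewrite /wall_shift; clear.
case: (t == wall_r s); case: (t == wall_s s);
case: (t == starn (wall_r s)); case: (t == starn (wall_s s));
case: (u == wall_r s); case: (u == wall_s s);
by case: (u == starn (wall_r s)); case: (u == starn (wall_s s)).
Qed.

Lemma sshift_bound s t : -1 <= sshift s t <= 1.
Proof. by rewrite /sshift; ifs. Qed.

(* [s] permutes the roots, so the value of a root at the image of the base
   point is again no multiple of [h]; as the value moves by at most one
   unless the root is normal to the wall, it crosses no multiple of [h]. *)
Lemma rho_other s t u : (s <= d)%N -> (t < d + d)%N -> (u < d + d)%N ->
  u != t -> u != starn t ->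
  ~~ ((t == wall_r s) && (u == wall_s s)) ->
  ~~ ((t == starn (wall_s s)) && (u == starn (wall_r s))) ->
  ~~ ((t == wall_s s) && (u == wall_r s)) ->
  ~~ ((t == starn (wall_r s)) && (u == starn (wall_s s))) ->
  let A := rho t - rho u in
  let B := rho (sref s t) - rho (sref s u) + (d + d - 2)%N%:Z * (sshift s t - sshift s u) in
  (0 < A < (d + d - 2)%N%:Z /\ 0 < B < (d + d - 2)%N%:Z) \/
  (- (d + d - 2)%N%:Z < A < 0 /\ - (d + d - 2)%N%:Z < B < 0).
Proof.
move=> sd td ud ut uts n1 n2 n3 n4 A B.
have := rho_range td ud ut uts.
have := @rho_range (sref s t) (sref s u) (sref_lt sd td) (sref_lt sd ud).
have ut' : sref s u != sref s t.
  by apply: contra ut => /eqP e; rewrite -(sref_invol sd ud) e sref_invol.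
have uts' : sref s u != starn (sref s t).
  have st := starn_lt td.
  by apply: contra uts => /eqP e; rewrite -(sref_invol sd ud) e -sref_starn // sref_invol.
move=> /(_ ut' uts').
have BA : B = A + (wall_shift s t - wall_shift s u).
  rewrite /B mulrBr; move: (rho_sref sd td) (rho_sref sd ud); rewrite /A; clear; lia.
have := sshift_bound s t; have := sshift_bound s u.
have e1 := wall_shift_diff sd ud uts n1 n2 n3 n4.
move=> m1 m2 h' h; rewrite BA; apply: same_side e1 m2 m1 _ BA h' h.
by clear -hd4; lia.
Qed.

End SimpleReflections.

(** * The base alcove and its walls *)

Section BaseAlcove.
Context (R : realType) (d : nat) (hd4 : (4 <= d)%N).
Local Notation J := 'I_(d + d).
Local Notation gap x r s := (ext x r - ext x s).
Local Notation h := (d + d - 2)%N.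
Implicit Types (s k : nat) (r t u i : J) (x y : 'rV[R]_d).

Lemma dd_gt0 : (0 < d + d)%N.
Proof. lia. Qed.

Definition ix k : J := insubd (Ordinal dd_gt0) k.

Lemma val_ix k : (k < d + d)%N -> val (ix k) = k.
Proof. by move=> kd; rewrite val_insubd kd. Qed.

Lemma val_starn i : val (star i) = starn d i.
Proof. exact: val_star. Qed.

Definition srefl s i : J := ix (sref d s i).
Definition srefl_shift s i : int := sshift d s i.

Lemma val_srefl s i : (s <= d)%N -> val (srefl s i) = sref d s i.
Proof. by move=> sd; rewrite val_ix ?sref_lt. Qed.

Lemma srefl_invol s : (s <= d)%N -> involutive (srefl s).
Proof. by move=> sd i; apply: val_inj; rewrite !val_srefl ?sref_invol. Qed.

Lemma weyl_srefl s : (s <= d)%N -> weyl (srefl s) (srefl_shift s).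
Proof.
move=> sd; split=> [|i|i]; first exact: inv_inj (srefl_invol sd).
  by apply: val_inj; rewrite val_srefl // !val_starn val_srefl // sref_starn.
by rewrite /srefl_shift val_starn sshift_starn.
Qed.

Definition alcove_point : 'rV[R]_d := \row_i ((rho d i)%:~R / (h%:Z)%:~R).

Lemma ext_alcove i : ext alcove_point i = (rho d i)%:~R / (h%:Z)%:~R.
Proof.
case: (starP i) => -[j ->]; first by rewrite ext_lshift mxE.
rewrite ext_rshift mxE -mulNr -mulrNz; congr (_%:~R / _).
by rewrite /rho /= ltn_ord ltnNge leq_addr /=; have := ltn_ord j; lia.
Qed.

Lemma h_gt0 : (0 : R) < (h%:Z)%:~R.
Proof. by rewrite ltr0z; lia. Qed.

Lemma between_div (A k : int) : h%:Z * k < A < h%:Z * (k + 1) ->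
  between k (A%:~R / (h%:Z)%:~R : R).
Proof.
have h0 := h_gt0; rewrite -(ltr_int R) -[X in _ && X](ltr_int R) !intrM => /andP[h1 h2].
by rewrite /between ltr_pdivlMr // ltr_pdivrMr // [_ * (h%:Z)%:~R]mulrC h1 [_ * (h%:Z)%:~R]mulrC h2.
Qed.

Lemma between_mid (k : int) (a b : R) : between k a -> between k b -> between k ((a + b) / 2%:R).
Proof. by move=> /andP[? ?] /andP[? ?]; apply/andP; split; lra. Qed.

(** The midpoint lies on the wall, and by convexity it stays in every open strip between integers
    that contains both ends. *)
Definition wall_mid s : 'rV[R]_d :=
  2%:R^-1 *: (alcove_point + aff (srefl s) (srefl_shift s) alcove_point).

Lemma ext_mid x y i : ext (2%:R^-1 *: (x + y)) i = (ext x i + ext y i) / 2%:R.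
Proof.
by case: (starP i) => -[j ->]; rewrite ?ext_lshift ?ext_rshift !mxE; lra.
Qed.

Lemma gap_alcove t u : gap alcove_point t u = (rho d t - rho d u)%:~R / (h%:Z)%:~R.
Proof. by rewrite !ext_alcove intrB mulrBl. Qed.

Lemma gap_srefl s t u : (s <= d)%N -> gap (aff (srefl s) (srefl_shift s) alcove_point) t u =
  (rho d (sref d s t) - rho d (sref d s u) + h%:Z * (sshift d s t - sshift d s u))%:~R
    / (h%:Z)%:~R.
Proof.
move=> sd; rewrite (gap_aff _ _ _ (weyl_srefl sd)) gap_alcove -!val_srefl // [in RHS]intrD [RHS]mulrDl.
by congr (_ + _); rewrite intrM mulrC mulKf // gt_eqF // h_gt0.
Qed.

Lemma base_wall s : (s <= d)%N ->
  wall_crossing alcove_point (wall_mid s) (aff (srefl s) (srefl_shift s) alcove_point)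
    (ix (wall_r d s)) (ix (wall_s d s)) (wall_n s).
Proof.
move=> sd; have rV := val_ix (wall_r_lt hd4 sd); have sV := val_ix (wall_s_lt hd4 sd).
have [AB Ab Bb] := rho_wall hd4 sd.
split.
- rewrite /rt -!val_eqE val_starn /= rV sV; exact: wall_rs_rt.
- rewrite !ext_mid -mulrBl opprD addrACA gap_alcove gap_srefl // rV sV -mulrDl -intrD AB.
  have h0 : (h%:Z)%:~R != 0 :> R by rewrite gt_eqF // h_gt0.
  have two : 2%:R != 0 :> R by rewrite pnatr_eq0.
  by rewrite !intrM; apply: (canLR (mulfK two)); apply: (canLR (mulfK h0)); ring.
- by rewrite gap_alcove rV sV; exact: between_div.
- by rewrite gap_srefl // rV sV; apply: between_div; rewrite subrK.
move=> t u /andP[tu ts] nrs nsr.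
have H := @rho_other d hd4 s (val t) (val u) sd (ltn_ord t) (ltn_ord u).
move: nrs nsr; rewrite /same_root !negb_or -!val_eqE !val_starn /= rV sV => /andP[n1 n2] /andP[n3 n4].
move: tu ts; rewrite -!val_eqE val_starn /= => tu ts.
have E A : 0 < A < h%:Z -> between 0 (A%:~R / (h%:Z)%:~R : R).
  by move=> ?; apply: between_div; rewrite mulr0 add0r mulr1.
have E' A : - h%:Z < A < 0 -> between (-1) (A%:~R / (h%:Z)%:~R : R).
  by move=> ?; apply: between_div; rewrite mulrN1 addNr mulr0.
have xm : gap (wall_mid s) t u =
    (gap alcove_point t u + gap (aff (srefl s) (srefl_shift s) alcove_point) t u) / 2%:R.
  by rewrite !ext_mid; lra.
rewrite xm gap_srefl // gap_alcove.
case: (H tu ts n1 n2 n3 n4) => -[/= hA hB].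
  by exists 0; split; [apply: between_mid; exact: E | exact: E | exact: E].
by exists (-1); split; [exact: (between_mid (E' _ hA) (E' _ hB)) | exact: (E' _ hA) | exact: (E' _ hB)].
Qed.

Lemma between_sg (k l : int) (a b : R) : between k a -> between k b -> Num.sg (a - l%:~R) = Num.sg (b - l%:~R).
Proof.
move=> /andP[ka ak] /andP[kb bk]; have [lk|kl] := leP l k.
  by rewrite !gtr0_sg // subr_gt0; apply: le_lt_trans _ kb || apply: le_lt_trans _ ka; rewrite ler_int.
rewrite !ltr0_sg // subr_lt0; [apply: (lt_le_trans bk) | apply: (lt_le_trans ak)];
by rewrite ler_int lezD1.
Qed.

Lemma between0N (a : R) : between 0 (- a) -> between (-1) a.
Proof.
rewrite /between add0r addNr mulr0z mulr1z mulrN1z oppr_gt0 ltrNl => /andP[a0 a1].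
by rewrite a0 a1.
Qed.

(** Up to sign every root takes its value in ]0, 1[ at both points. This lets rho / h replace the
    given point of [C]. *)
Lemma dominant_facet x : dominant_alcove x -> facet x = facet alcove_point.
Proof.
move=> xP; apply: facet_eq => a k Pa.
have H (i j : 'I_d) c : (i < j)%N -> between 0 (root_eval (proot (lshift d i) (rt_sign c j)) x) /\
    between 0 (root_eval (proot (lshift d i) (rt_sign c j)) alcove_point).
  move=> ij; split; first by rewrite root_evalE; exact: xP.
  rewrite root_evalE gap_alcove; apply: between_div; rewrite mulr0 add0r mulr1.
  have := @rho_pos d hd4 i (rt_sign c j) (ltn_ord i) (ltn_ord _).
  by rewrite /rt_sign; case: c => /=; have := ltn_ord j; have := ltn_ord i; lia.
case: (Phi_pos_or_opp Pa) => /Phi_posE[i [j [c [ij aE]]]].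
  by have [b1 b2] := H i j c ij; rewrite aE; exact: between_sg b2 b1.
have [b1 b2] := H i j c ij; move: b1 b2; rewrite -aE !root_evalN => b1 b2.
by apply: between_sg (between0N b2) (between0N b1).
Qed.

End BaseAlcove.
(** * The gallery of phi *)

Section Gallery.
Context (d : nat) (hd4 : (4 <= d)%N).
Implicit Types (b k l : nat).

Lemma beta_le b : (b < d + d - 2)%N -> (beta d b.+1 <= d)%N.
Proof. by rewrite /beta => ?; ifs. Qed.

Definition neg_at m k : bool := if (k < d)%N then k != m else k == (d + m)%N.

(** The minus sign, initially at d - 1, travels down to 0; then the letter d makes the signs at d -
    2 and d - 1 negative. Of these three the one at d - 2 travels down to 1, and the letter 0
    restores the signs at 0 and 1. *)
Definition neg_at3 m k : bool :=
  if (k < d)%N then ~~ [|| k == 0%N, k == d.-1 | k == m]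
  else [|| k == d, k == (d + d).-1 | k == (d + m)%N].

(* Signs of the coordinates of the transform, by the first [b] reflections, of
   the cocharacter (1, ..., 1, -1) underlying [tau]; [true] stands for 1. *)
Definition zsign b k : bool :=
  if (b <= d - 1)%N then neg_at (d - 1 - b)%N k
  else if (b <= d + d - 3)%N then neg_at3 (d + d - 2 - b)%N k
  else neg_at (d - 1)%N k.

Lemma beta_cases b : (b < d + d - 2)%N ->
  [\/ (b < d - 1)%N /\ beta d b.+1 = (d - b.+1)%N,
      b = (d - 1)%N /\ beta d b.+1 = d,
      [/\ (d <= b)%N, (b < d + d - 3)%N & beta d b.+1 = (d + d - b.+2)%N] |
      b = (d + d - 3)%N /\ beta d b.+1 = 0%N].
Proof.
move=> bh; rewrite /beta.
have [?|?] := leqP b.+1 (d - 1); first by constructor 1; lia.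
have [?|?] := eqVneq b.+1 d; first by constructor 2; lia.
have [?|?] := leqP b.+1 (d + d - 3); first by constructor 3; split; lia.
by constructor 4; lia.
Qed.

Lemma zsign_period k : zsign (d + d - 2) k = zsign 0 k.
Proof. by rewrite /zsign; ifs; rewrite subn0. Qed.

Lemma neg_at_sref m k : (0 < m < d)%N -> (k < d + d)%N ->
  neg_at m.-1 (sref d m k) = neg_at m k.
Proof. by rewrite /neg_at /sref => ? ?; ifs. Qed.

Lemma neg_at_sref_last k : (k < d + d)%N -> neg_at3 (d - 2)%N (sref d d k) = neg_at 0 k.
Proof.
rewrite /neg_at /neg_at3 /sref => kd.
case: (eqVneq k (d - 2)%N) => [->|?]; first ifs.
case: (eqVneq k (d - 1)%N) => [->|?]; first ifs.
case: (eqVneq k (d + d - 2)%N) => [->|?]; first ifs.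
case: (eqVneq k (d + d - 1)%N) => [->|?]; ifs.
Qed.

Lemma neg_at3_sref m k : (1 < m < d.-1)%N -> (k < d + d)%N ->
  neg_at3 m.-1 (sref d m k) = neg_at3 m k.
Proof.
move=> md kd; rewrite /neg_at3 /sref.
have -> : (m == 0%N) = false by lia.
have -> : (m == d) = false by lia.
case: (eqVneq k (m - 1)%N) => [->|?]; first ifs.
case: (eqVneq k m) => [->|?]; first ifs.
case: (eqVneq k (d + m - 1)%N) => [->|?]; first ifs.
case: (eqVneq k (d + m)%N) => [->|?]; ifs.
Qed.

Lemma neg_at3_sref0 k : (k < d + d)%N -> neg_at (d - 1)%N (sref d 0 k) = neg_at3 1 k.
Proof.
rewrite /neg_at /neg_at3 /sref => kd.
case: (eqVneq k 0%N) => [->|?]; first ifs.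
case: (eqVneq k 1%N) => [->|?]; first ifs.
case: (eqVneq k d) => [->|?]; first ifs.
case: (eqVneq k d.+1) => [->|?]; ifs.
Qed.

Lemma zsign_low b k : (b <= d - 1)%N -> zsign b k = neg_at (d - 1 - b)%N k.
Proof. by rewrite /zsign => ->. Qed.

Lemma zsign_mid b k : (d <= b <= d + d - 3)%N -> zsign b k = neg_at3 (d + d - 2 - b)%N k.
Proof. by rewrite /zsign => ?; ifs. Qed.

Lemma zsign_step b k : (b < d + d - 2)%N -> (k < d + d)%N ->
  zsign b.+1 (sref d (beta d b.+1) k) = zsign b k.
Proof.
move=> bh kd; case/beta_cases: bh => [[bd ->]|[-> ->]|[db bd ->]|[-> ->]].
- rewrite !zsign_low; try lia.
  have -> : (d - b.+1 = d - 1 - b)%N by lia.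
  have -> : (d - 1 - b.+1 = (d - 1 - b).-1)%N by lia.
  by rewrite neg_at_sref //; lia.
- rewrite zsign_mid ?zsign_low; try lia.
  have -> : (d + d - 2 - (d - 1).+1 = d - 2)%N by lia.
  by rewrite neg_at_sref_last // subnn.
- rewrite !zsign_mid; try lia.
  have -> : (d + d - b.+2 = d + d - 2 - b)%N by lia.
  have -> : (d + d - 2 - b.+1 = (d + d - 2 - b).-1)%N by lia.
  by rewrite neg_at3_sref //; lia.
- rewrite [RHS]zsign_mid; last lia.
  have -> : ((d + d - 3).+1 = d + d - 2)%N by lia.
  have -> : (d + d - 2 - (d + d - 3) = 1)%N by lia.
  by rewrite zsign_period zsign_low // subn0 neg_at3_sref0.
Qed.

Lemma zsign_wall b : (b < d + d - 2)%N ->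
  zsign b (wall_r d (beta d b.+1)) && ~~ zsign b (wall_s d (beta d b.+1)).
Proof.
case/beta_cases => [[bd ->]|[-> ->]|[db bd ->]|[-> ->]].
- by rewrite !zsign_low /neg_at /wall_r /wall_s; try lia; ifs.
- by rewrite !zsign_low /neg_at /wall_r /wall_s; try lia; ifs.
- by rewrite !zsign_mid /neg_at3 /wall_r /wall_s; try lia; ifs.
- by rewrite !zsign_mid /neg_at3 /wall_r /wall_s; try lia; ifs.
Qed.

(* The coordinates where (1, ..., 1, -1) is positive, along which [phi] is a
   cyclic shift by two places. *)
Definition pos_coord l : nat := if (l < d - 1)%N then l else (d + d - 1)%N.

(** The place of [pos_coord d l] after the first b reflections. Each of the two descending runs of
    the word moves most coordinates up by one, whence the shift by two. *)
Definition loc b l : nat :=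
  if (b <= d - 1)%N then
    if (l < d - 1)%N then (if (d - 1 - l <= b)%N then l.+1 else l) else (d + d - 1 - b)%N
  else if (b <= d + d - 3)%N then
    if l == (d - 1)%N then d else if l == (d - 2)%N then (3 * d - 2 - b)%N
    else if l == (d - 3)%N then (d + d - 1)%N
    else if (d + d - 3 - l <= b)%N then l.+2 else l.+1
  else pos_coord ((l + 2) %% d).

Lemma loc0 l : (l < d)%N -> loc 0 l = pos_coord l.
Proof. by rewrite /loc /pos_coord => ?; ifs. Qed.

Lemma mod_shift l : (l < d)%N ->
  ((l + 2) %% d)%N = (if (l < d - 2)%N then l + 2 else l + 2 - d)%N /\
  ((l + 2) %/ d)%N = (if (l < d - 2)%N then 0 else 1)%N.
Proof.
move=> ld; case: ifP => h.
  by rewrite modn_small ?divn_small //; lia.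
have e : (l + 2 = 1 * d + (l + 2 - d))%N by lia.
by rewrite e modnMDl divnMDl ?modn_small ?divn_small; lia.
Qed.

Lemma sref_midE m k : (0 < m < d)%N -> sref d m k =
  if k == (m - 1)%N then m else if k == m then (m - 1)%N
  else if k == (d + m - 1)%N then (d + m)%N else if k == (d + m)%N then (d + m - 1)%N else k.
Proof.
move=> md; rewrite /sref; have -> : (m == 0%N) = false by lia.
by have -> : (m == d) = false by lia.
Qed.

Lemma sshift_pos m k : (0 < m)%N -> sshift d m k = 0.
Proof. by rewrite /sshift; case: m. Qed.

Lemma loc_step_low b l : (b < d - 1)%N -> (l < d)%N ->
  loc b.+1 l = sref d (d - b.+1) (loc b l).
Proof.
move=> bd ld; rewrite /loc sref_midE; last lia.
have -> : (b.+1 <= d - 1)%N by lia.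
have -> : (b <= d - 1)%N by lia.
by have [?|?] := ltnP l (d - 1); ifs.
Qed.

Lemma loc_step_turn l : (l < d)%N -> loc d l = sref d d (loc (d - 1) l).
Proof.
move=> ld; rewrite /loc leqnn.
have -> : (d <= d - 1)%N = false by lia.
have -> : (d <= d + d - 3)%N by lia.
rewrite /sref eqxx; have -> : (d == 0%N) = false by lia.
case: (eqVneq l (d - 1)%N) => [->|?]; first ifs.
case: (eqVneq l (d - 2)%N) => [->|?]; first ifs.
by case: (eqVneq l (d - 3)%N) => [->|?]; ifs.
Qed.

Lemma loc_step_mid b l : (d <= b)%N -> (b < d + d - 3)%N -> (l < d)%N ->
  loc b.+1 l = sref d (d + d - b.+2) (loc b l).
Proof.
move=> db bd ld; rewrite /loc sref_midE; last lia.
have -> : (b.+1 <= d - 1)%N = false by lia.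
have -> : (b <= d - 1)%N = false by lia.
have -> : (b.+1 <= d + d - 3)%N by lia.
have -> : (b <= d + d - 3)%N by lia.
case: (eqVneq l (d - 1)%N) => [?|?]; first ifs.
case: (eqVneq l (d - 2)%N) => [?|?]; first ifs.
by case: (eqVneq l (d - 3)%N) => [?|?]; ifs.
Qed.

(** Only the letter 0 translates, and among the positive coordinates it translates exactly the two
    that wrap around, for which the quotient is 1. *)
Lemma loc_step_last l : (l < d)%N ->
  loc (d + d - 2) l = sref d 0 (loc (d + d - 3) l) /\
  sshift d 0 (loc (d + d - 3) l) = - ((l + 2) %/ d)%N%:Z.
Proof.
move=> ld; have [e1 e2] := mod_shift ld; rewrite /loc e1 e2 /pos_coord /sref /sshift leqnn.
clear e1 e2.
have -> : (d + d - 2 <= d - 1)%N = false by lia.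
have -> : (d + d - 3 <= d - 1)%N = false by lia.
have -> : (d + d - 2 <= d + d - 3)%N = false by lia.
rewrite !eqxx.
case: (eqVneq l (d - 1)%N) => [->|?]; first by split; ifs.
case: (eqVneq l (d - 2)%N) => [->|?]; first by split; ifs.
case: (eqVneq l (d - 3)%N) => [->|?]; first by split; ifs.
by split; ifs.
Qed.

Lemma loc_step b l : (b < d + d - 2)%N -> (l < d)%N ->
  loc b.+1 l = sref d (beta d b.+1) (loc b l) /\
  sshift d (beta d b.+1) (loc b l) =
    if (b.+1 == d + d - 2)%N then - ((l + 2) %/ d)%N%:Z else 0.
Proof.
move=> bh ld; case/beta_cases: bh => [[bd ->]|[-> ->]|[db bd ->]|[-> ->]].
- rewrite loc_step_low // sshift_pos; last lia.
  by have -> : (b.+1 == d + d - 2)%N = false by lia.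
- have -> : ((d - 1).+1 = d)%N by lia.
  rewrite loc_step_turn // sshift_pos; last lia.
  by have -> : (d == d + d - 2)%N = false by lia.
- rewrite loc_step_mid // sshift_pos; last lia.
  by have -> : (b.+1 == d + d - 2)%N = false by lia.
- have -> : ((d + d - 3).+1 = d + d - 2)%N by lia.
  by rewrite eqxx; exact: loc_step_last.
Qed.

Lemma zsign_pos_coord l : (l < d)%N -> zsign 0 (pos_coord l).
Proof. by move=> ld; rewrite zsign_low // /neg_at /pos_coord; ifs. Qed.

Lemma pos_coord_lt l : (pos_coord l < d + d)%N.
Proof. by rewrite /pos_coord; ifs. Qed.

Lemma pos_coordP k : (k < d + d)%N -> exists l, (l < d)%N /\
  (k = pos_coord l \/ starn d k = pos_coord l).
Proof.
move=> kd; rewrite /pos_coord /starn.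
have [?|?] := ltnP k d.
  have [?|?] := ltnP k (d - 1); first by exists k; split; ifs.
  by exists (d - 1)%N; split; ifs.
by exists (k - d)%N; split; ifs.
Qed.

End Gallery.

(** * The matrices of the simple reflections *)

Section SimpleReflectionMatrices.
Context (p : nat) (p_pr : prime p) (d : nat) (hd4 : (4 <= d)%N).
Local Notation Qp := (padic p_pr).
Local Notation M := 'M[Qp]_(d + d).
Local Notation J := 'I_(d + d).
Local Notation pi := (p%:R : Qp).
Implicit Types (s k : nat) (i : J).

Lemma eq_mono (f g : J -> J) (m n : J -> int) e : f =1 g -> m =1 n ->
  mono p_pr f m e = mono p_pr g n e.
Proof. by move=> fg mn; apply/matrixP => i j; rewrite !mxE fg mn. Qed.

(** [monomial] prescribes columns and [mono] rows; for an involution these differ only by reading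
    the coefficient at [g i]. *)
Lemma monomialE (f : nat -> nat) (c : nat -> Qp) (g : J -> J) (m : J -> int) :
  involutive g -> (forall i, f i.+1 = (val (g i)).+1) ->
  (forall i, c (val (g i)).+1 = pi ^ (- m i)) ->
  monomial d f c = mono p_pr g m 0.
Proof.
move=> gg fg cg; apply/matrixP => i j; rewrite !mxE fg eqSS add0r -(cg i).
have -> : (val i == val (g j)) = (j == g i) by rewrite (inj_eq val_inj) eq_sym (inv_eq gg).
by case: (j =P g i) => [->|].
Qed.

Lemma swap_sref s k : (0 < s < d)%N ->
  swap s s.+1 (swap (d + s) (d + s).+1 k.+1) = (sref d s k).+1.
Proof. by rewrite /swap /sref => ?; ifs. Qed.

Lemma sdot_midE s : (0 < s < d)%N ->
  sdot_mid p_pr d s = mono p_pr (srefl hd4 s) (srefl_shift s) 0.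
Proof.
move=> sd; have sd' : (s <= d)%N by lia.
apply: monomialE => [|i|i]; first exact: srefl_invol.
  by rewrite val_srefl //; exact: swap_sref.
rewrite /srefl_shift sshift_pos ?oppr0 //; lia.
Qed.

(** The permutation underlying [udot], which realizes the automorphism of the affine diagram
    exchanging 0 with 1 and d - 1 with d. *)
Definition uref k : nat :=
  if k == 0%N then d else if k == d then 0%N else if k == (d - 1)%N then (d + d - 1)%N
  else if k == (d + d - 1)%N then (d - 1)%N else k.

Definition ushift (k : nat) : int := if k == 0%N then 1 else if k == d then -1 else 0.

Lemma uref_lt k : (k < d + d)%N -> (uref k < d + d)%N.
Proof. by rewrite /uref => ?; ifs. Qed.

Lemma urefK k : (k < d + d)%N -> uref (uref k) = k.
Proof. by rewrite /uref => ?; ifs. Qed.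

Lemma uref_neq k : k != 0%N -> k != d -> (k < d + d)%N -> uref k != 0%N /\ uref k != d.
Proof. by rewrite /uref => ? ? ?; ifs. Qed.

Lemma udotE : udot p_pr d = mono p_pr (fun i => ix hd4 (uref i)) (fun i => ushift i) 0.
Proof.
have vu i : val (ix hd4 (uref (val i))) = uref i by rewrite val_ix // (uref_lt (ltn_ord i)).
apply: monomialE => [i|i|i].
- by apply: val_inj; rewrite /= !vu urefK.
- by rewrite /= vu /swap /uref; have := ltn_ord i; ifs.
rewrite vu; have [e|i0] := eqVneq (val i) 0%N.
  rewrite e /uref /ushift !eqxx; have -> : (d.+1 == 1%N) = false by lia.
  by rewrite exprN1.
have [e|id] := eqVneq (val i) d.
  rewrite e /uref /ushift !eqxx; have -> : (d == 0%N) = false by lia.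
  by rewrite eqxx opprK expr1z.
have [u0 ud] := uref_neq i0 id (ltn_ord i).
rewrite /ushift (negbTE i0) (negbTE id) oppr0 expr0z !eqSS.
by rewrite (negbTE u0) (negbTE ud).
Qed.

Lemma uref_sref1 k : (k < d + d)%N -> uref (sref d 1 (uref k)) = sref d 0 k /\
  ushift k + ushift (sref d 1 (uref k)) = sshift d 0 k.
Proof.
move=> kd; rewrite (sref_midE hd4); last lia.
rewrite /uref /ushift /sref /sshift.
case: (eqVneq k 0%N) => [->|?]; first by split; ifs.
case: (eqVneq k 1%N) => [->|?]; first by split; ifs.
case: (eqVneq k d) => [->|?]; first by split; ifs.
case: (eqVneq k d.+1) => [->|?]; first by split; ifs.
case: (eqVneq k (d - 1)%N) => [->|?]; first by split; ifs.
case: (eqVneq k (d + d - 1)%N) => [->|?]; first by split; ifs.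
by split; ifs.
Qed.

Lemma uref_sref_last k : (k < d + d)%N -> uref (sref d (d - 1) (uref k)) = sref d d k /\
  ushift k + ushift (sref d (d - 1) (uref k)) = sshift d d k.
Proof.
move=> kd; rewrite (sref_midE hd4); last lia.
rewrite sshift_pos; last lia.
rewrite /uref /ushift /sref.
have -> : (d == 0%N) = false by lia.
rewrite eqxx.
case: (eqVneq k 0%N) => [->|?]; first by split; ifs.
case: (eqVneq k d) => [->|?]; first by split; ifs.
case: (eqVneq k (d - 1)%N) => [->|?]; first by split; ifs.
case: (eqVneq k (d - 2)%N) => [->|?]; first by split; ifs.
case: (eqVneq k (d + d - 2)%N) => [->|?]; first by split; ifs.
case: (eqVneq k (d + d - 1)%N) => [?|?]; first by split; ifs.
by split; ifs.
Qed.

Lemma udot_conj s t : (0 < s < d)%N -> (t <= d)%N ->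
  (forall k, (k < d + d)%N -> uref (sref d s (uref k)) = sref d t k /\
     ushift k + ushift (sref d s (uref k)) = sshift d t k) ->
  udot p_pr d * sdot_mid p_pr d s * udot p_pr d = mono p_pr (srefl hd4 t) (srefl_shift t) 0.
Proof.
move=> sd td H; rewrite sdot_midE // udotE !mono_mul; apply: eq_mono => i.
  apply: val_inj; rewrite val_srefl // -(proj1 (H _ (ltn_ord i))) val_ix.
    by rewrite val_srefl ?val_ix ?(uref_lt (ltn_ord i)) //; lia.
  exact: uref_lt (ltn_ord _).
rewrite /srefl_shift sshift_pos; last lia.
rewrite addr0 -(proj2 (H _ (ltn_ord i))) val_srefl; last lia.
by rewrite val_ix // (uref_lt (ltn_ord i)).
Qed.

Lemma sdotE s : (s <= d)%N -> sdot p_pr d s = mono p_pr (srefl hd4 s) (srefl_shift s) 0.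
Proof.
move=> sd; rewrite /sdot; case: (eqVneq s 0%N) => [->|s0].
  by apply: udot_conj => //; [lia | exact: uref_sref1].
case: (eqVneq s d) => [->|s1]; last by apply: sdot_midE; lia.
by rewrite -subn1; apply: udot_conj => //; [lia | exact: uref_sref_last].
Qed.

End SimpleReflectionMatrices.

(** * Prefixes of the periodic word and powers of phi *)

Section ChamberGallery.
Context (d : nat) (hd4 : (4 <= d)%N).
Local Notation J := 'I_(d + d).
Local Notation h := (d + d - 2)%N.
Implicit Types (j b : nat) (i r s : J).

Definition gal_refl j : nat := beta d (j %% h).+1.

Lemma h_pos : (0 < h)%N.
Proof. lia. Qed.

Lemma gal_refl_le j : (gal_refl j <= d)%N.
Proof. by apply: beta_le => //; exact: ltn_pmod h_pos. Qed.

(** The recursion runs across the periods of the word: the scalar in phi acts trivially on the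
    apartment and appears only in the exponent of [gal_mxE]. *)
Fixpoint gal_idx j i : J :=
  if j is j'.+1 then srefl hd4 (gal_refl j') (gal_idx j' i) else i.

Fixpoint gal_shift j i : int :=
  if j is j'.+1 then gal_shift j' i + srefl_shift (gal_refl j') (gal_idx j' i) else 0.

Lemma gal_weyl j : weyl (gal_idx j) (gal_shift j).
Proof.
elim: j => [|j IH]; first exact: weyl_id.
exact: weyl_comp IH (weyl_srefl hd4 (gal_refl_le j)).
Qed.

Lemma divmod_succ j : ((j %% h).+1 = h /\ (j.+1 %% h = 0)%N /\ (j.+1 %/ h = (j %/ h).+1)%N) \/
  (((j %% h).+1 < h)%N /\ (j.+1 %% h = (j %% h).+1)%N /\ (j.+1 %/ h = j %/ h)%N).
Proof.
have hp := h_pos; have lt := ltn_pmod j hp.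
have e : (j.+1 = (j %/ h) * h + (j %% h).+1)%N by rewrite addnS -divn_eq.
have [h1|h1] := leqP h (j %% h).+1.
  left; have e1 : (j %% h).+1 = h by apply/eqP; rewrite eqn_leq h1 andbT.
  rewrite e1 in e *; split=> //.
  by rewrite e -mulSnr modnMl mulnK.
right; split=> //; split; first by rewrite {1}e modnMDl modn_small.
by rewrite {1}e divnMDl // (divn_small h1) addn0.
Qed.

Lemma gal_sign j i : zsign d (j %% h) (gal_idx j i) = zsign d 0 i.
Proof.
elim: j => [|j IH]; first by rewrite mod0n.
have bh := ltn_pmod j h_pos; rewrite -IH /= val_srefl; last exact: gal_refl_le.
have := zsign_step hd4 bh (ltn_ord (gal_idx j i)).
have [[e [-> _]]|[_ [-> _]]] := divmod_succ j => <- //.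
by rewrite /gal_refl; move: (sref d _ _) => k; rewrite e zsign_period.
Qed.

(** Each complete period adds 2 to l; the quotient by d counts the wrap-arounds, each contributing a
    translation by -1. *)
Lemma gal_loc j l : (l < d)%N ->
  val (gal_idx j (ix hd4 (pos_coord d l))) = loc d (j %% h) ((l + 2 * (j %/ h)) %% d) /\
  gal_shift j (ix hd4 (pos_coord d l)) = - ((l + 2 * (j %/ h)) %/ d)%N%:Z.
Proof.
move=> ld; have d0 : (0 < d)%N by lia.
elim: j => [|j [IH1 IH2]].
  rewrite mod0n div0n muln0 addn0 modn_small // divn_small // loc0 //=.
  by rewrite val_ix // pos_coord_lt.
have bh := ltn_pmod j h_pos; set l' := ((l + 2 * (j %/ h)) %% d)%N in IH1.
have ld' : (l' < d)%N by exact: ltn_pmod.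
have [s1 s2] := loc_step hd4 bh ld'.
rewrite /= val_srefl; last exact: gal_refl_le.
rewrite /srefl_shift IH1 IH2 -s1 s2.
have [[e [-> ->]]|[h1 [-> ->]]] := divmod_succ j; last first.
  by rewrite (ltn_eqF h1) addr0.
rewrite e eqxx loc0 ?ltn_pmod // /loc.
have -> : (h <= d - 1)%N = false by lia.
have -> : (h <= d + d - 3)%N = false by lia.
have dE : (l + 2 * (j %/ h).+1 = (l + 2 * (j %/ h)) %/ d * d + (l' + 2))%N.
  by rewrite addnA -divn_eq; lia.
by rewrite dE modnMDl divnMDl // PoszD opprD.
Qed.

Lemma phi_pow_idx : gal_idx (d * h) =1 id.
Proof.
have d0 : (0 < d)%N by lia.
have H l : (l < d)%N -> gal_idx (d * h) (ix hd4 (pos_coord d l)) = ix hd4 (pos_coord d l).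
  move=> ld; apply: val_inj; rewrite (proj1 (gal_loc _ ld)) modnMl mulnK ?h_pos //.
  by rewrite addnC modnMDl modn_small // loc0 // val_ix // pos_coord_lt.
have [_ fs _] := gal_weyl (d * h).
move=> i; have [l [ld [e|e]]] := pos_coordP hd4 (ltn_ord i).
  have -> : i = ix hd4 (pos_coord d l) by apply: val_inj; rewrite -e val_ix.
  exact: H.
apply: (@star_inj d); rewrite -fs.
have -> : star i = ix hd4 (pos_coord d l).
  by apply: val_inj; rewrite val_starn e val_ix // pos_coord_lt.
exact: H.
Qed.

Lemma phi_pow_shift i : gal_shift (d * h) i = if zsign d 0 i then -2 else 2.
Proof.
have d0 : (0 < d)%N by lia.
have H l : (l < d)%N -> gal_shift (d * h) (ix hd4 (pos_coord d l)) = -2.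
  move=> ld; rewrite (proj2 (gal_loc _ ld)) mulnK ?h_pos //.
  by rewrite addnC divnMDl // divn_small.
have zs k : (k < d + d)%N -> zsign d 0 (starn d k) = ~~ zsign d 0 k.
  by move=> kd; rewrite !zsign_low // /neg_at /starn; case: (ltnP k d) => ?; do ?case: ifP => ?; lia.
have [_ _ ms] := gal_weyl (d * h).
have [l [ld [e|e]]] := pos_coordP hd4 (ltn_ord i).
  have -> : i = ix hd4 (pos_coord d l) by apply: val_inj; rewrite -e val_ix.
  by rewrite H // val_ix ?pos_coord_lt // zsign_pos_coord.
have -> : zsign d 0 i = false.
  by apply/negbTE; rewrite -zs // e zsign_pos_coord.
apply: oppr_inj; rewrite -ms.
have -> : star i = ix hd4 (pos_coord d l).
  by apply: val_inj; rewrite val_starn e val_ix // pos_coord_lt.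
exact: H.
Qed.

Context (R : realType) (p : nat) (p_pr : prime p).
Local Notation Qp := (padic p_pr).
Local Notation M := 'M[Qp]_(d + d).

Definition gal_mx j : M :=
  phi p_pr d ^+ (j %/ h) * \prod_(1 <= i < (j %% h).+1) sdot p_pr d (beta d i).

Lemma prod_sdot_recr b : \prod_(1 <= i < b.+2) sdot p_pr d (beta d i) =
  \prod_(1 <= i < b.+1) sdot p_pr d (beta d i) * sdot p_pr d (beta d b.+1).
Proof. by rewrite big_nat_recr. Qed.

Lemma phiE : phi p_pr d = ((p%:R : Qp) ^+ (if odd d then 2 else 1))%:M *
  \prod_(1 <= i < h.+1) sdot p_pr d (beta d i).
Proof. by rewrite /phi (_ : h.+1 = (d + d - 1)%N) //; lia. Qed.

Lemma mul_phi (x : M) : x * phi p_pr d = ((p%:R : Qp) ^+ (if odd d then 2 else 1))%:M *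
  (x * \prod_(1 <= i < h.+1) sdot p_pr d (beta d i)).
Proof. by rewrite phiE !mxMsl mxZr. Qed.

Lemma gal_mx_succ j : gal_mx j.+1 = gal_mx j * sdot p_pr d (gal_refl j) \/
  gal_mx j.+1 = ((p%:R : Qp) ^+ (if odd d then 2 else 1))%:M * (gal_mx j * sdot p_pr d (gal_refl j)).
Proof.
rewrite /gal_mx /gal_refl; have [[e [-> ->]]|[_ [-> ->]]] := divmod_succ j; [right | left].
  rewrite big_geq // mulr1 exprSr mul_phi; move: (prod_sdot_recr (j %% h)); rewrite e => ->.
  by rewrite (mulrA (phi _ _ ^+ _)).
by rewrite prod_sdot_recr mulrA.
Qed.

Lemma gal_mxE j : exists e : int, gal_mx j = mono p_pr (gal_idx j) (gal_shift j) e.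
Proof.
elim: j => [|j [e IH]].
  by exists 0; rewrite /gal_mx div0n mod0n expr0 mul1r big_geq // mono1.
have [->|->] := gal_mx_succ j; rewrite IH (sdotE p_pr hd4 (gal_refl_le j)) mono_mul.
  by eexists.
by rewrite mono_scalar; eexists.
Qed.

Lemma gal_mx_period a : gal_mx (a * h) = phi p_pr d ^+ a.
Proof. by rewrite /gal_mx mulnK ?h_pos // modnMl big_geq // mulr1. Qed.

Lemma chamber_seqE j : chamber_seq p_pr (facet (alcove_point R d)) j =
  facet (aff (gal_idx j) (gal_shift j) (alcove_point R d)).
Proof.
have [e gE] := gal_mxE j; have hd : (0 < d)%N by lia.
by rewrite /chamber_seq -/(gal_mx j) gE (chamber_mono p_pr hd e (alcove_point R d) (gal_weyl j)).
Qed.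

End ChamberGallery.

(** * Conjugation of [N_0], the cocharacter tau, and the steps of the gallery *)

Section Conjugation.
Context (p : nat) (p_pr : prime p) (d : nat) (hd : (0 < d)%N).
Local Notation Qp := (padic p_pr).
Local Notation M := 'M[Qp]_(d + d).
Local Notation J := 'I_(d + d).

Lemma torus_conj_xr (t : M) (r s : J) u : torus p_pr d t -> rt r s ->
  t * xr r s u * invmx t = xr r s (t r r / t s s * u).
Proof.
move=> tt rs; have [_ /(_ _ tt)] := xr_root hd u rs.
rewrite (root_charE hd _ _ tt) xr_sub1 => e.
have tu : t \in unitmx by case: (simil_group p_pr d) => + _ _ _; apply; apply: GSO_simil; case: tt.
rewrite {1}/xr mulrDr mulr1 mulrDl e [t * invmx t](mulmxV tu).
by rewrite /xr /rootmx scalerDr !scalerA mulrN.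
Qed.

Lemma unipotent0_conj (t : M) : torus p_pr d t ->
  (forall (i j : 'I_d) c, (i < j)%N ->
     vg 0 (t (lshift d i) (lshift d i) / t (rt_sign c j) (rt_sign c j))) ->
  [set t * g * invmx t | g in unipotent0 p_pr d] `<=` unipotent0 p_pr d.
Proof.
move=> tt tpos.
have gU : is_subgroup (unipotent0 p_pr d).
  apply: (generated_group (uni_group p_pr d)) => g [a /Phi_posE[i [j [c [ij ->]]]] [+ _]].
  by move/(root_subgroupP hd _ (rt_pos c ij)) => ->; exact: uni_xr.
have [Uu U1 UM UV] := gU.
have tu : t \in unitmx by case: (simil_group p_pr d) => + _ _ _; apply; apply: GSO_simil; case: tt.
(* As [N_0] is given by generators, it is enough that its preimage under conjugation is a subgroup
   containing them. *)
pose S := [set g : M | g \in unitmx /\ unipotent0 p_pr d (t * g * invmx t)].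
have conjM g h : t * (g * h) * invmx t = t * g * invmx t * (t * h * invmx t).
  rewrite -!mulrA; congr (_ * (_ * _)); rewrite [RHS]mulrA.
  by rewrite [invmx t * t](mulVmx tu) mul1r.
have gS : is_subgroup S.
  split.
  - by move=> g [].
  - by split; [exact: unitmx1 | rewrite mulr1 [t * invmx t](mulmxV tu)].
  - move=> g h [gu gU'] [hu hU']; split; first by rewrite -[g * h]/(g *m h) unitmx_mul gu.
    by rewrite conjM; exact: UM gU' hU'.
  - move=> g [gu gU']; split; first by rewrite unitmx_inv.
    suff -> : t * invmx g * invmx t = invmx (t * g * invmx t) by exact: UV.
    apply/esym; apply: (proj2 (invmx_uniq _)).
    by rewrite -conjM [g * invmx g](mulmxV gu) mulr1 [t * invmx t](mulmxV tu).
have : unipotent0 p_pr d `<=` S.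
  apply: (unipotent0_min hd gS) => i j c u ij u0.
  split; first by case: (xr_invmx u (rt_pos c ij)).
  rewrite (torus_conj_xr _ tt (rt_pos c ij)); apply: unipotent0_gen => //.
  by rewrite -[0](addr0 0); apply: vgM u0; exact: tpos.
by move=> US _ [g /US[_ gU'] <-].
Qed.

End Conjugation.

Section Tau.
Context (d : nat) (hd4 : (4 <= d)%N).
Local Notation J := 'I_(d + d).

Lemma zsign_star (i : J) : zsign d 0 (val (star i)) = ~~ zsign d 0 (val i).
Proof.
rewrite val_starn !zsign_low // /neg_at /starn; have := ltn_ord i => /=.
by case: (ltnP i d) => ?; case: ifP => ?; lia.
Qed.

Lemma zsign_lshift (i j : 'I_d) : (i < j)%N -> zsign d 0 (val (lshift d i)).
Proof.
by move=> ij; rewrite zsign_low // /neg_at /= ltn_ord; have := ltn_ord j; lia.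
Qed.

(** These are the roots in the unipotent radical of a Siegel parabolic subgroup containing the Borel
    subgroup; the one remaining pair of indices, dual to each other, gives no root. *)
Lemma sign_pos_root (r s : J) : rt r s -> zsign d 0 (val r) -> ~~ zsign d 0 (val s) ->
  Phi_pos (proot r s).
Proof.
move=> rs; rewrite !zsign_low // subn0.
have E (i : 'I_d) : neg_at d (d - 1)%N (lshift d i) = (val i != d - 1)%N.
  by rewrite /neg_at /= ltn_ord.
have E' (i : 'I_d) : neg_at d (d - 1)%N (rshift d i) = (val i == d - 1)%N.
  by rewrite /neg_at /= ltnNge leq_addr /= eqn_add2l.
have pos (i j : 'I_d) c : (i < j)%N -> Phi_pos (proot (lshift d i) (rt_sign c j)).
  by move=> ij; apply/Phi_posE; exists i, j, c.
case: (starP r) rs => -[i ->]; case: (starP s) => -[j ->]; rewrite /= ?E ?E' ?negbK.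
- move=> _ i1 /eqP j1; apply: (pos i j true); move: i1 j1 (ltn_ord i) => /=; lia.
- rewrite /rt star_lshift eq_rshift => /andP[_ ji] _ _.
  case: (ltngtP i j) => [|ji'|/val_inj e]; first exact: (pos i j false).
    by rewrite -proot_star !epsE; exact: (pos j i false).
  by rewrite e eqxx in ji.
- by rewrite /rt star_rshift eq_lshift => /andP[_ +] /eqP i1 /eqP j1; rewrite -val_eqE /= i1 j1 eqxx.
- move=> _ /eqP i1 j1; rewrite -proot_star !epsE; apply: (pos j i true); move: i1 j1 (ltn_ord j) => /=; lia.
Qed.

Context (p : nat) (p_pr : prime p).
Local Notation Qp := (padic p_pr).
Local Notation M := 'M[Qp]_(d + d).

Lemma tauE (x : Qp) : tau d x = diag_mx (\row_i if zsign d 0 (val i) then x else 1).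
Proof.
rewrite /tau; congr diag_mx; apply/rowP => i; rewrite !mxE.
congr (if _ then _ else _); rewrite zsign_low // /neg_at /=; have := ltn_ord i.
by case: ifP => ? ?; lia.
Qed.

Lemma tau_torus (x : Qp) : x != 0 -> torus p_pr d (tau d x).
Proof.
move=> x0; rewrite tauE; apply: (@diag_torus _ _ _ _ x); first exact: x0.
by move=> i; rewrite zsign_star; case: (zsign _ _ _) => /=; rewrite ?mulr1 ?mul1r.
Qed.

Lemma tau_mono (x : Qp) f m e : (forall i, zsign d 0 (val (f i)) = zsign d 0 (val i)) ->
  tau d x * mono p_pr f m e = mono p_pr f m e * tau d x.
Proof.
move=> fz; rewrite tauE; apply/matrixP => i j.
rewrite -[LHS]/((_ *m _) i j) -[RHS]/((_ *m _) i j) mul_diag_mx mul_mx_diag !mxE.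
case: (j =P f i) => [->|_]; last by rewrite mulr0 mul0r.
by rewrite fz mulrC.
Qed.

End Tau.

Section Gallery.
Context (R : realType) (p : nat) (p_pr : prime p) (d : nat) (hd4 : (4 <= d)%N).
Local Notation Qp := (padic p_pr).
Local Notation M := 'M[Qp]_(d + d).
Local Notation J := 'I_(d + d).
Local Notation h := (d + d - 2)%N.
Local Notation C := (facet (alcove_point R d)).

Lemma gallery_step j : exists a,
  [/\ [/\ adjacent (chamber_seq p_pr C j) (chamber_seq p_pr C j.+1),
          crossing_root p_pr (chamber_seq p_pr C j) (chamber_seq p_pr C j.+1) a,
          forall a', crossing_root p_pr (chamber_seq p_pr C j) (chamber_seq p_pr C j.+1) a' -> a' = a &
          Phi_pos a],
      has_index (N0_seq p_pr C j) (N0_seq p_pr C j.+1) p &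
      forall x : Qp, x != 0 -> root_char a (tau d x) = x].
Proof.
have hd : (0 < d)%N by lia.
have bh := ltn_pmod j (h_pos hd4); have sd := gal_refl_le hd4 j.
have W := gal_weyl hd4 j; have W' := weyl_srefl hd4 sd.
have [g [n [_ _ _ [_ gK]]]] := weyl_inv R W.
set f := gal_idx hd4 j in gK W; set m := gal_shift hd4 j in W.
(* [g] inverts the index map of the prefix, so (r, s) is the direction of the transported wall. *)
set r := g (ix hd4 (wall_r d (gal_refl d j))); set s := g (ix hd4 (wall_s d (gal_refl d j))).
have bw : wall_crossing (alcove_point R d) (wall_mid R hd4 (gal_refl d j))
    (aff (srefl hd4 (gal_refl d j)) (srefl_shift (gal_refl d j)) (alcove_point R d))
    (f r) (f s) (wall_n (gal_refl d j)).
  by rewrite /r /s !gK; exact: base_wall.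
have := wall_crossing_aff W bw; rewrite aff_comp // -/(gal_idx hd4 j.+1) -/(gal_shift hd4 j.+1).
set y1 := aff f m _; set y2 := aff _ _ (alcove_point R d); set k := _ + _ => wc.
have rs : rt r s by case: wc.
have /andP[zr zs] := zsign_wall hd4 bh.
have signr : zsign d 0 (val r).
  by rewrite -(gal_sign hd4 j r) -/f /r gK val_ix // wall_r_lt.
have signs : ~~ zsign d 0 (val s).
  by rewrite -(gal_sign hd4 j s) -/f /s gK val_ix // wall_s_lt.
have apos := sign_pos_root hd4 rs signr signs.
have cr := wall_crossing_root p_pr hd wc.
rewrite /N0_seq !chamber_seqE.
exists (proot r s); split; first split.
- exact: (wall_adjacent p_pr hd wc).
- exact: cr.
- by move=> a' ca'; exact: crossing_root_uniq ca' cr.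
- exact: apos.
- have [i [i' [c [ii' aE]]]] := (Phi_posE _).1 apos.
  (* The index in [N] is computed for a direction with first index i < i'; (r, s) may be the other
     expression of the same root. *)
  have wc' : wall_crossing y1 (aff f m (wall_mid R hd4 (gal_refl d j))) y2
      (lshift d i) (rt_sign c i') k.
    have := proot_inj rs (esym aE); case/orP => /andP[/eqP -> /eqP ->]; first exact: wc.
    exact: wall_crossing_star.
  exact: (wall_index p_pr hd ii' wc').
- move=> x x0; rewrite (root_charE hd _ _ (tau_torus hd4 x0)) tauE // !mxE !eqxx signr (negbTE signs).
  by rewrite !mulr1n divr1.
Qed.

Lemma phi_powE : exists e : int,
  phi p_pr d ^+ d = cochar p_pr (fun i : J => if zsign d 0 (val i) then e + 2 else e - 2).
Proof.
have [e gE] := gal_mxE hd4 p_pr (d * h); exists e.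
rewrite -gal_mx_period // gE; apply/matrixP => i j; rewrite !mxE phi_pow_idx phi_pow_shift.
rewrite eq_sym; case: (i =P j) => [_|_]; last by [].
by rewrite mulr1n; case: (zsign _ _ _); rewrite ?opprK.
Qed.

End Gallery.

Theorem lemma4p12 (R : realType) (p : nat) (p_pr : prime p) (d : nat)
    (hd : (4 <= d)%N) (C : set 'rV[R]_d) (hC : is_chamber C)
    (hI : pro_p_Iwahori p_pr d `<=` Iwahori p_pr C) :
  exists alpha : nat -> 'rV[int]_d,
  [/\ (* (a) *)
      [/\ torus p_pr d (phi p_pr d ^+ d),
          [set phi p_pr d ^+ d * g * invmx (phi p_pr d ^+ d)
            | g in unipotent0 p_pr d] `<=` unipotent0 p_pr d,
          chamber_seq p_pr C 0 = C /\ unipotent0 p_pr d = N0_seq p_pr C 0,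
          forall i, has_index (N0_seq p_pr C i) (N0_seq p_pr C i.+1) p &
          forall j,
            [/\ adjacent (chamber_seq p_pr C j) (chamber_seq p_pr C j.+1),
                crossing_root p_pr (chamber_seq p_pr C j)
                  (chamber_seq p_pr C j.+1) (alpha j),
                forall delta, crossing_root p_pr (chamber_seq p_pr C j)
                  (chamber_seq p_pr C j.+1) delta -> delta = alpha j &
                Phi_pos (alpha j)]],
      (* (b) *)
      forall (j : nat) (x : padic_int p_pr), x \is a GRing.unit ->
        root_char (alpha j) (tau d (FracField.tofrac x)) = FracField.tofrac x &
      (* (c) *)
      forall a : padic_int p_pr, a \is a GRing.unit ->
        tau d (FracField.tofrac a) * phi p_pr d
          = phi p_pr d * tau d (FracField.tofrac a)].
Proof.
have hd0 : (0 < d)%N by lia.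
have [x xw CE] := hC.
have xdom : dominant_alcove x by apply: (pro_p_alcove hd0 xw (p_pr := p_pr)); rewrite -CE.
have CE' : C = facet (alcove_point R d) by rewrite CE (dominant_facet hd xdom).
have C0 : chamber_seq p_pr C 0 = C.
  by rewrite CE' (chamber_seqE hd R p_pr 0) aff_id.
have /choice[alpha alphaP] := gallery_step R p_pr hd.
have [e phiE] := phi_powE p_pr hd.
have phiT : torus p_pr d (phi p_pr d ^+ d).
  rewrite phiE; apply: (@cochar_torus _ _ _ _ (e + e)) => i.
  by rewrite (zsign_star hd); case: (zsign _ _ _) => /=; lia.
have unit_neq0 (u : padic_int p_pr) : u \is a GRing.unit -> u%:F != 0.
  by move=> uu; rewrite tofrac_eq0; apply: contraTneq uu => ->; rewrite unitr0.
exists alpha; split.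
- split.
  + exact: phiT.
  + apply: (unipotent0_conj hd0 phiT) => i j c ij.
    rewrite phiE !cocharE (zsign_lshift hd ij).
    (* The two exponents differ by 0 or 4. *)
    by case: (zsign _ _ _); rewrite invr_expz -piD; apply: (@vg_le _ _ 0 _ _ _ (vgX _ _)); lia.
  + split; first exact: C0.
    by rewrite /N0_seq C0 CE; exact: unipotent0E.
  + by move=> i; rewrite CE'; have [] := alphaP i.
  + by move=> j; rewrite CE'; have [] := alphaP j.
- by move=> j u /unit_neq0 u0; have [_ _] := alphaP j; apply; exact u0.
(* One full period gives phi, whose index map preserves the signs defining tau by [gal_sign]. *)
- move=> a _; have [e' gE] := gal_mxE hd p_pr (1 * (d + d - 2)).
  move: gE; rewrite (gal_mx_period hd p_pr 1) expr1 => ->.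
  apply: (tau_mono hd) => i.
  by rewrite -[in RHS](gal_sign hd (1 * (d + d - 2)) i) modnMl.
Qed.
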